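(* For every ideal $\mathfrak M\mid\mathfrak N$ and $i\in\{0,1\}$ we have $\#\mathfrak Q_i(\mathfrak M,\mathfrak N)=\#Q_i(\mathfrak M,\mathfrak N)$. Therefore the number of cusps of $X_i(\mathfrak N)$ is $\sum_{\mathfrak M\mid\mathfrak N}\#Q_i(\mathfrak M,\mathfrak N)$.
   Context: $F$ is a totally real number field with ring of integers $R$; $R_{>0}^\times$ is the group of totally positive units; $\mathfrak N\subseteq R$ is a nonzero ideal; $\mathrm{Cl}^+R$ is the narrow class group. For a nonzero fractional ideal $\mathfrak b$, $\Gamma_0(\mathfrak N)_{\mathfrak b}$ is the group of matrices $\begin{pmatrix} a&b\\c&d\end{pmatrix}$ with $a,d\in R$, $b\in\mathfrak b^{-1}$, $c\in\mathfrak N\mathfrak b$, $ad-bc\in R_{>0}^\times$, and $\Gamma_1(\mathfrak N)_{\mathfrak b}$ is the subgroup where moreover $a\in1+\mathfrak N$. The cusps of a group are its orbits on $\mathbb P^1(F)$. Fixing representatives $\mathfrak b$ of $\mathrm{Cl}^+R$, $X_i(\mathfrak N)=\bigsqcup_{[\mathfrak b]\in\mathrm{Cl}^+R}X_i(\mathfrak N)_{\mathfrak b}$, so the set of cusps of $X_i(\mathfrak N)$ is the disjoint union over $[\mathfrak b]\in \mathrm{Cl}^+R$ of $\Gamma_i(\mathfrak N)_{\mathfrak b}\backslash\mathbb P^1(F)$. For a cusp $(a:c)$ on the component indexed by $\mathfrak b$, let $\mathfrak s=aR+c\mathfrak b^{-1}$ and $\mathfrak M(a,c)=\mathfrak N+c(\mathfrak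 b\mathfrak s)^{-1}$; this integral ideal dividing $\mathfrak N$ depends only on the cusp. For $\mathfrak M\mid\mathfrak N$, $\mathfrak Q_i(\mathfrak M,\mathfrak N)$ is the set of cusps $(a:c)$ of $X_i(\mathfrak N)$ with $\mathfrak M(a,c)=\mathfrak M$. $\mathrm{Cl}^+(\mathfrak M)$ denotes the narrow ray class group of modulus $\mathfrak M$, and $\mathfrak N/\mathfrak M=\mathfrak N\mathfrak M^{-1}$. $Q_0(\mathfrak M,\mathfrak N)$ is the quotient of $\mathrm{Cl}^+(\mathfrak M)\times\mathrm{Cl}^+(\mathfrak N/\mathfrak M)$ by the subgroup generated by $\{([xR],[x^{-1}R]): x\in R\setminus\{0\},\ xR+\mathfrak N=R\}$. $Q_1(\mathfrak M,\mathfrak N)$ is the quotient of the same group by the subgroup generated by $\{([xR],[x^{-1}R]): x\in R\setminus\{0\},\ x\equiv1\pmod{\mathfrak N}\}$. *)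

(* Defs.v *)
From HB Require Import structures.
From mathcomp Require Import all_boot all_order all_algebra all_field.
From mathcomp Require Import finmap.
From mathcomp Require Import boolp classical_sets functions cardinality fsbigop.
Set Implicit Arguments.
Unset Strict Implicit.
Unset Printing Implicit Defensive.
Import Order.TTheory GRing.Theory Num.Theory.
Local Open Scope classical_set_scope.
Local Open Scope ring_scope.

(* A number field is a [fieldExtType rat].  Its ideals are subsets of the
   field, and two ideals are equal when they are equal as sets.  All complex
   embeddings of a number field take values in the algebraic numbers [algC]. *)

Definition totally_real (F : fieldExtType rat) : Prop :=
  forall (s : {rmorphism F -> algC}) (x : F), s x \is Num.real.
Arguments totally_real F : clear implicits.

(* In [algC], [0 < z] means that z is real and positive. *)
Definition totally_positive (F : fieldExtType rat) (x : F) : Prop :=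
  forall s : {rmorphism F -> algC}, 0 < s x.

Definition int_ring (F : fieldExtType rat) : set F :=
  [set x | integralOver (intr : int -> F) x].
Arguments int_ring F : clear implicits.

Definition totpos_unit (F : fieldExtType rat) (x : F) : Prop :=
  [/\ int_ring F x, int_ring F x^-1 & totally_positive x].

Definition set_add (F : fieldExtType rat) (A B : set F) : set F :=
  [set x + y | x in A & y in B].

Definition set_scale (F : fieldExtType rat) (x : F) (A : set F) : set F :=
  [set x * y | y in A].

Definition principal (F : fieldExtType rat) (x : F) : set F :=
  set_scale x (int_ring F).

Definition ideal_mul (F : fieldExtType rat) (I J : set F) : set F :=
  [set x | exists (n : nat) (u v : 'I_n -> F),
     [/\ forall k, I (u k), forall k, J (v k) & x = \sum_k u k * v k]].

Definition ideal_inv (F : fieldExtType rat) (I : set F) : set F :=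
  [set x | set_scale x I `<=` int_ring F].

Record frac_ideal (F : fieldExtType rat) (I : set F) : Prop := FracIdeal {
  frac_ideal0 : I 0;
  frac_idealD : forall x y, I x -> I y -> I (x + y);
  frac_idealM : forall r x, int_ring F r -> I x -> I (r * x);
  frac_ideal_neq0 : exists2 x, I x & x != 0;
  frac_ideal_denom :
    exists d, [/\ int_ring F d, d != 0 & set_scale d I `<=` int_ring F] }.

Definition int_ideal (F : fieldExtType rat) (I : set F) : Prop :=
  frac_ideal I /\ I `<=` int_ring F.

Definition ideal_dvd (F : fieldExtType rat) (M N : set F) : Prop :=
  int_ideal M /\ exists2 J, int_ideal J & N = ideal_mul M J.

Definition ideal_coprime (F : fieldExtType rat) (I J : set F) : Prop :=
  set_add I J = int_ring F.

(* Quotients of (possibly infinite) groups are sets of cosets; the product and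
   the inverse of cosets are the elementwise ones. *)
Definition coset_by (T : Type) (op : T -> T -> T) (H : set T) (g : T) : set T :=
  [set op g h | h in H].

Definition quotient_by (T : Type) (op : T -> T -> T) (G H : set T) :
    set (set T) :=
  [set coset_by op H g | g in G].

Definition subgroup_gen (T : Type) (op : T -> T -> T) (e : T) (inv : T -> T)
    (S : set T) : set T :=
  [set x | forall H : set T, H e ->
     (forall y z, H y -> H z -> H (op y z)) -> (forall y, H y -> H (inv y)) ->
     S `<=` H -> H x].

(* x = 1 mod^* M, multiplicatively. *)
Definition mult_congr1 (F : fieldExtType rat) (M : set F) (x : F) : Prop :=
  exists a b : F,
    [/\ int_ring F a /\ int_ring F b, a != 0 /\ b != 0,
        ideal_coprime (principal a) M /\ ideal_coprime (principal b) M,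
        M (a - b) & x = a / b].

Definition ideals_prime_to (F : fieldExtType rat) (M : set F) : set (set F) :=
  [set I | exists J K : set F,
     [/\ int_ideal J /\ int_ideal K, ideal_coprime J M, ideal_coprime K M
       & I = ideal_mul J (ideal_inv K)]].

Definition narrow_principal (F : fieldExtType rat) (M : set F) :
    set (set F) :=
  [set principal x | x in [set x | totally_positive x /\ mult_congr1 M x]].

(* The modulus is M times all the real places. *)
Definition narrow_ray_class (F : fieldExtType rat) (M : set F) :
    set F -> set (set F) :=
  coset_by (@ideal_mul F) (narrow_principal M).

Definition narrow_ray_class_group (F : fieldExtType rat) (M : set F) :
    set (set (set F)) :=
  quotient_by (@ideal_mul F) (ideals_prime_to M) (narrow_principal M).

Definition narrow_class_group (F : fieldExtType rat) : set (set (set F)) :=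
  narrow_ray_class_group (int_ring F).
Arguments narrow_class_group F : clear implicits.

Definition narrow_class_reps (F : fieldExtType rat) (B : set (set F)) : Prop :=
  (forall b, B b -> frac_ideal b) /\
  (forall C, narrow_class_group F C -> exists! b, B b /\ C b).

Definition class_mul (F : fieldExtType rat) (C D : set (set F)) :
    set (set F) :=
  [set ideal_mul I J | I in C & J in D].

Definition class_inv (F : fieldExtType rat) (C : set (set F)) : set (set F) :=
  [set ideal_inv I | I in C].

Definition class_pair_mul (F : fieldExtType rat)
    (p q : set (set F) * set (set F)) : set (set F) * set (set F) :=
  (class_mul p.1 q.1, class_mul p.2 q.2).

Definition class_pair_inv (F : fieldExtType rat)
    (p : set (set F) * set (set F)) : set (set F) * set (set F) :=
  (class_inv p.1, class_inv p.2).

Definition ideal_div (F : fieldExtType rat) (N M : set F) : set F :=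
  ideal_mul N (ideal_inv M).

Definition Q_condition (F : fieldExtType rat) (i : 'I_2) (N : set F) (x : F) :
    Prop :=
  if i == 0 then ideal_coprime (principal x) N else N (x - 1).

Definition Q_relations (F : fieldExtType rat) (i : 'I_2) (M N : set F) :
    set (set (set F) * set (set F)) :=
  [set (narrow_ray_class M (principal x),
        narrow_ray_class (ideal_div N M) (principal x^-1)) |
    x in [set x | [/\ int_ring F x, x != 0 & Q_condition i N x]]].

Definition Q_group (F : fieldExtType rat) (i : 'I_2) (M N : set F) :
    set (set (set (set F) * set (set F))) :=
  quotient_by (@class_pair_mul F)
    (narrow_ray_class_group M `*` narrow_ray_class_group (ideal_div N M))
    (subgroup_gen (@class_pair_mul F)
       (narrow_principal M, narrow_principal (ideal_div N M))
       (@class_pair_inv F) (Q_relations i M N)).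

Definition Gamma0 (F : fieldExtType rat) (N b : set F) : set 'M[F]_2 :=
  [set g : 'M[F]_2 | [/\ int_ring F (g 0 0) /\ int_ring F (g 1 1),
                         ideal_inv b (g 0 1), ideal_mul N b (g 1 0)
                       & totpos_unit (\det g)]].

Definition Gamma1 (F : fieldExtType rat) (N b : set F) : set 'M[F]_2 :=
  [set g : 'M[F]_2 | Gamma0 N b g /\ N (g 0 0 - 1)].

Definition Gamma (F : fieldExtType rat) (i : 'I_2) (N b : set F) :
    set 'M[F]_2 :=
  if i == 0 then Gamma0 N b else Gamma1 N b.

(* Points of P^1(F) are the lines in F^2. *)
Definition proj_line (F : fieldExtType rat) : set {vspace 'cV[F]_2} :=
  [set L | \dim L = 1%N].
Arguments proj_line F : clear implicits.

Definition proj_point (F : fieldExtType rat) (a c : F) : {vspace 'cV[F]_2} :=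
  <[(\col_(k < 2) (if k == 0 then a else c))%R]>%VS.

Definition proj_act (F : fieldExtType rat) (g : 'M[F]_2)
    (L : {vspace 'cV[F]_2}) : {vspace 'cV[F]_2} :=
  (linfun (mulmx g : 'cV[F]_2 -> 'cV[F]_2) @: L)%VS.

Definition proj_orbit (F : fieldExtType rat) (G : set 'M[F]_2)
    (L : {vspace 'cV[F]_2}) : set {vspace 'cV[F]_2} :=
  [set proj_act g L | g in G].

(* A cusp of X_i(N) is a pair (b, orbit), b being the representative ideal that
   indexes the component. *)
Definition cusps (F : fieldExtType rat) (B : set (set F)) (i : 'I_2)
    (N : set F) : set (set F * set {vspace 'cV[F]_2}) :=
  [set p | B p.1 /\
     exists2 L, proj_line F L & p.2 = proj_orbit (Gamma i N p.1) L].

Definition cusp_s (F : fieldExtType rat) (b : set F) (a c : F) : set F :=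
  set_add (principal a) (set_scale c (ideal_inv b)).

Definition cusp_M (F : fieldExtType rat) (N b : set F) (a c : F) : set F :=
  set_add N (set_scale c (ideal_inv (ideal_mul b (cusp_s b a c)))).

Definition cusps_at (F : fieldExtType rat) (B : set (set F)) (i : 'I_2)
    (M N : set F) : set (set F * set {vspace 'cV[F]_2}) :=
  [set p | B p.1 /\
     exists a c : F, [/\ (a, c) != (0, 0),
       p.2 = proj_orbit (Gamma i N p.1) (proj_point a c)
       & cusp_M N p.1 a c = M]].

(* Main.v *)
From HB Require Import structures.
Require Import Defs.
From mathcomp Require Import all_boot all_order all_fingroup all_algebra all_field.
From mathcomp Require Import finmap.
From mathcomp Require Import boolp classical_sets functions cardinality fsbigop.
From mathcomp Require Import ring lra.
Set Implicit Arguments.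
Unset Strict Implicit.
Unset Printing Implicit Defensive.
Import Order.TTheory GRing.Theory Num.Theory.
Import passmx.
Local Open Scope classical_set_scope.
Local Open Scope ring_scope.

(** Write R for the ring of integers.  Let (a : c) be a cusp on the component
    of b, and put S = aR + c b^-1 and T = b S, so that a S^-1 and c T^-1 are
    coprime integral ideals.  If M = N + c T^-1 is the level of the cusp and
    L = N M^-1, then a generates S modulo M S, and c generates M T modulo
    L M T = N T.  Choose totally positive a' = a mod M S and c' = c mod N T.
    The cusp is sent to the pair of narrow ray classes of a' S^-1 modulo M and
    of c' (M T)^-1 modulo L, taken in Q_i(M, N).

    This is well defined ([cusp_invariant_orbit]).  A matrix of Gamma_i with
    diagonal entries alpha, delta multiplies a by alpha modulo M S and c by
    delta modulo N T, and alpha delta is a totally positive unit modulo N;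
    rescaling the point by lambda changes the signs of both coordinates.
    An x = alpha mod N with the signs of lambda accounts for both effects at
    once, and the pair of classes changes by ([x], [x^-1]).  For i = 1 moreover
    x = 1 mod N.

    It is injective ([cusp_invariant_inj]).  When two cusps, on the components
    of b and b2, have the same invariant, comparing the ideals gives
    b2 = tau b with tau totally positive, whence b2 = b, and tau is a unit.
    After rescaling the second point (A : C) to have the same S, one has
    A = x a mod M S and x C = tau c mod N T.  Complete (a, c) and (A, C) to
    matrices g1, g2 of determinant 1; every matrix of determinant tau taking
    the first vector to the second has the form g2 [[1, n], [0, tau]] g1^-1,
    and [cusp_datum_matrix] finds an n for which it lies in Gamma_i.

    It is surjective ([cusp_invariant_surj]).  Represent the two classes by
    integral ideals A, C coprime to M and to L, let S = A^-1, let b = t C^-1 M^-1 A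
    be the chosen ideal of its narrow class, with t totally positive, and take
    c = t and an a = 1 mod M S which generates S modulo C M S.  Such an a exists
    because a unit of R/M lifts to a unit of the finite ring R/CM
    ([generates_mod_lift]).

    The level is constant on orbits and divides N, so that the cusps are the
    disjoint union of the sets of cusps of given level, and the counts add up.

    The arithmetic behind this is the invertibility of fractional ideals and the
    finiteness of ray class groups.  Comparing values of the norm form on a
    lattice shows that every ideal is proportional to one which contains a fixed
    integer ([ideal_class_bound]), so there are finitely many ideals up to
    proportionality.  Hence two powers A^i and A^j, i < j, are proportional,
    and the determinant trick, used once for integrality and once in the form of
    Nakayama's lemma, makes A^(j-i) principal ([ideal_mulV]).  A narrow ray class
    is determined by an ideal class, a residue modulo M and a pattern of signs
    ([finite_ray_class_group]). *)

(** * Lattices and integrality in a number field *)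

Lemma pigeonhole (T : finType) (f : nat -> T) :
  exists i j, (i < j <= #|T|)%N /\ f i = f j.
Proof.
have : ~~ injectiveb (fun i : 'I_#|T|.+1 => f i).
  by apply/negP => /injectiveP/leq_card; rewrite card_ord ltnn.
case/injectivePn => i [j ij Eij].
case: (ltngtP i j) => [h|h|/val_inj h]; last by rewrite h eqxx in ij.
  by exists i, j; rewrite h -ltnS ltn_ord.
by exists j, i; rewrite h -ltnS ltn_ord.
Qed.

Section IntegerRing.
Variable F : fieldExtType rat.
Local Notation O := (int_ring F).

Lemma int_ring0 : O 0. Proof. exact: integral0. Qed.
Lemma int_ring1 : O 1. Proof. exact: integral1. Qed.
Lemma int_ring_nat n : O n%:R. Proof. exact: integral_nat. Qed.
Lemma int_ring_int (z : int) : O z%:~R. Proof. exact: integral_id. Qed.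
Lemma int_ringN x : O x -> O (- x). Proof. exact: integral_opp. Qed.
Lemma int_ringD x y : O x -> O y -> O (x + y). Proof. exact: integral_add. Qed.
Lemma int_ringB x y : O x -> O y -> O (x - y). Proof. exact: integral_sub. Qed.
Lemma int_ringM x y : O x -> O y -> O (x * y). Proof. exact: integral_mul. Qed.
Lemma int_ringX x n : O x -> O (x ^+ n).
Proof.
by move=> Ox; elim: n => [|n IH]; rewrite ?expr0 ?exprS; [exact: int_ring1|exact: int_ringM].
Qed.
Lemma int_ring_sum I (r : seq I) (P : pred I) (f : I -> F) :
  (forall i, P i -> O (f i)) -> O (\sum_(i <- r | P i) f i).
Proof. by move=> h; apply: big_ind => //; [exact: int_ring0|exact: int_ringD]. Qed.
Lemma int_ring_prod I (r : seq I) (P : pred I) (f : I -> F) :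
  (forall i, P i -> O (f i)) -> O (\prod_(i <- r | P i) f i).
Proof. by move=> h; apply: big_ind => //; [exact: int_ring1|exact: int_ringM]. Qed.

(** The boolean form of membership, needed for the closure lemmas of
    polynomials whose coefficients are integral. *)
Definition int_ring_pred : {pred F} := fun x => `[< O x >].
Lemma int_ring_predP x : reflect (O x) (x \in int_ring_pred). Proof. exact: asboolP. Qed.
Lemma int_ring_subring : subring_closed int_ring_pred.
Proof.
split=> [|x y /int_ring_predP Ox /int_ring_predP Oy|x y /int_ring_predP Ox /int_ring_predP
  Oy]; apply/int_ring_predP.
- exact: int_ring1.
- exact: int_ringB.
- exact: int_ringM.
Qed.
HB.instance Definition _ := GRing.isSubringClosed.Build F int_ring_pred int_ring_subring.

(** The eigenvalue is a root of the characteristic polynomial, which is monic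
    with integral coefficients; integrality is transitive. *)
Lemma integral_of_eigenvector n (v : 'rV[F]_n) (g : 'M[F]_n) x :
  v != 0 -> (forall i j, O (g i j)) -> v *m g = x *: v -> O x.
Proof.
move=> v0 Og vg; have rx : root (char_poly g) x.
  by rewrite -eigenvalue_root_char; apply/eigenvalueP; exists v.
apply: (integral_root_monic (char_poly_monic g) rx).
suff : char_poly g \is a polyOver int_ring_pred.
  by move=> /polyOverP h y /(nthP 0)[i _ <-]; apply/int_ring_predP/h.
apply: rpred_sum => s _; apply: rpredM; first by apply: rpredX; rewrite rpredN rpred1.
apply: rpred_prod => i _; rewrite !mxE; apply: rpredB.
  by apply: rpredMn; rewrite polyOverX.
by rewrite polyOverC; apply/int_ring_predP.
Qed.

Lemma common_denominator (I : finType) (f : I -> rat) :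
  exists2 D : nat, (0 < D)%N & forall i, D%:R * f i \is a Num.int.
Proof.
exists (\prod_i `|denq (f i)|)%N.
  by rewrite prodn_gt0 // => i; rewrite absz_gt0 denq_neq0.
move=> i; rewrite (bigD1 i) //= natrM mulrAC; apply: rpredM; last exact: natr_int.
suff -> : `|denq (f i)|%:R * f i = (numq (f i))%:~R :> rat by exact: intr_int.
by rewrite numqE mulrC pmulrn absz_denq.
Qed.

Local Notation n := (\dim {:F}).
Local Notation e := (vbasis {:F}).

(** Coordinates on an arbitrary basis of F over Q; below, the ring of integers is
    squeezed between two lattices. *)
Definition coords (x : F) : 'rV[rat]_n := rVof e x.
Definition of_coords (v : 'rV[rat]_n) : F := vecof e v.
Definition mulmat (x : F) : 'M[rat]_n := mxof e e (amull x).

Lemma coordsK : cancel coords of_coords.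
Proof. exact/rVofK/vbasisP. Qed.
Lemma of_coordsK : cancel of_coords coords.
Proof. exact/vecofK/vbasisP. Qed.
HB.instance Definition _ := GRing.isLinear.Build rat F 'rV[rat]_n _ coords
  (@rVof_linear _ _ e).
HB.instance Definition _ := GRing.isLinear.Build rat 'rV[rat]_n F _ of_coords
  (@vecof_linear _ _ e).

Lemma coordsM x y : coords (x * y) = coords y *m mulmat x.
Proof.
by rewrite /coords -rVof_app ?vbasisP // lfunE.
Qed.

Lemma dim_gt0 : (0 < n)%N.
Proof. exact: adim_gt0. Qed.

Lemma mulmat_inj (A B : 'M[rat]_n) :
  (forall y, coords y *m A = coords y *m B) -> A = B.
Proof. by move=> h; apply/row_matrixP => i; rewrite !rowE -[delta_mx _ _]of_coordsK. Qed.

Lemma mulmatD x y : mulmat (x + y) = mulmat x + mulmat y.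
Proof.
by apply: mulmat_inj => z; rewrite mulmxDr -!coordsM mulrDl linearD.
Qed.
Lemma mulmatM x y : mulmat (x * y) = mulmat y *m mulmat x.
Proof. by apply: mulmat_inj => z; rewrite mulmxA -!coordsM mulrA. Qed.
Lemma mulmatZ (a : rat) x : mulmat (a *: x) = a *: mulmat x.
Proof.
by apply: mulmat_inj => z; rewrite -scalemxAr -!coordsM -scalerAl linearZ.
Qed.
HB.instance Definition _ := GRing.isLinear.Build rat F 'M[rat]_n _ mulmat
  (fun a x y => etrans (mulmatD _ _) (congr1 (fun z => z + _) (mulmatZ a x))).
Lemma mulmat1 : mulmat 1 = 1%:M.
Proof. by apply: mulmat_inj => z; rewrite mulmx1 -!coordsM mul1r. Qed.

(** Over the algebraic numbers an eigenvalue of multiplication by x is a root of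
    any monic integer polynomial killing x, hence an algebraic integer.  So the
    coefficients are rational algebraic integers. *)
Lemma char_poly_int x k : O x -> (char_poly (mulmat x))`_k \is a Num.int.
Proof.
move=> [P monP rP].
pose M := map_mx (ratr : rat -> algC) (mulmat x).
pose E := map_poly (intr : int -> algC) P.
have hornM (v : 'rV[algC]_n) z (p : {poly int}) : v *m M = z *: v ->
    v *m map_mx ratr (mulmat (map_poly intr p).[x])
      = (map_poly intr p).[z] *: v.
  move=> vM; elim/poly_ind: p => [|p c IH].
    by rewrite !rmorph0 !horner0 linear0 map_mx0 mulmx0 scale0r.
  rewrite !rmorphD !rmorphM /= !map_polyX !map_polyC /= !hornerMXaddC.
  rewrite mulmatD mulmatM map_mxD map_mxM mulmxDr mulmxA vM -scalemxAl IH.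
  rewrite scalerA mulrC scalerDl; congr (_ + _).
  have -> : c%:~R = (c%:~R : rat) *: (1 : F) by rewrite scaler_int.
  rewrite mulmatZ mulmat1.
  rewrite map_mxZ rmorph_int map_scalar_mx rmorph1 -scalemxAr mulmx1.
  by rewrite scaler_int.
have rootE z : root (char_poly M) z -> z \in Aint.
  rewrite -eigenvalue_root_char => /eigenvalueP[v vM v0].
  apply: (@root_monic_Aint E).
  - rewrite /root; have := hornM v z P vM; move/rootP: rP => ->.
    rewrite linear0 map_mx0 mulmx0 => /esym/eqP.
    by rewrite scaler_eq0 (negbTE v0) orbF.
  - by rewrite monic_map.
  - by apply/polyOverP => i; rewrite coef_map /=; exact: intr_int.
have : char_poly M \is a polyOver Aint.
  have [r Er] := closed_field_poly_normal (char_poly M).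
  rewrite (monicP (char_poly_monic _)) scale1r in Er.
  rewrite Er big_seq; apply: rpred_prod => z zr; rewrite polyOverXsubC.
  by apply: rootE; rewrite Er root_prod_XsubC.
rewrite -map_char_poly => /polyOverP/(_ k); rewrite coef_map /= => h.
have /intrP[z Ez] := Cint_rat_Aint (Crat_rat _) h.
apply/intrP; exists z; apply: (fmorph_inj (ratr : {rmorphism rat -> algC})).
by rewrite /= Ez rmorph_int.
Qed.

Lemma det_int x : O x -> \det (mulmat x) \is a Num.int.
Proof.
move=> Ox; have := char_poly_int 0 Ox.
by rewrite char_poly_det rpredMsign.
Qed.

Lemma tr_int x : O x -> \tr (mulmat x) \is a Num.int.
Proof.
by move=> Ox; have := char_poly_int n.-1 Ox; rewrite char_poly_trace ?dim_gt0 // rpredN.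
Qed.

Lemma of_coordsE v : of_coords v = \sum_i v 0 i *: of_coords (delta_mx 0 i).
Proof.
by rewrite [v in LHS]row_sum_delta linear_sum; apply: eq_bigr => i _; rewrite linearZ.
Qed.

Lemma ratrZ (q : rat) (y : F) : ratr q * y = q *: y.
Proof. by rewrite -[y in LHS]mul1r mulrA mulr1 -alg_num_field mulr_algl. Qed.

(** A common denominator D of the matrices of multiplication makes each D e_i act
    by an integer matrix, with the vector of the basis as eigenvector. *)
Lemma int_ring_of_coords : exists2 D : nat, (0 < D)%N &
  forall v : 'rV[rat]_n, (forall i, v 0 i \is a Num.int) -> O (D%:R * of_coords v).
Proof.
pose f (p : 'I_n * 'I_n * 'I_n) := (mulmat (of_coords (delta_mx 0 p.1.1))) p.1.2 p.2.
have [D D0 hD] := common_denominator f; exists D => // v vint.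
have Oe i : O (D%:R * of_coords (delta_mx 0 i)).
  set x := of_coords _.
  (* the basis itself is the common eigenvector *)
  pose w : 'rV[F]_n := \row_j of_coords (delta_mx 0 j).
  apply: (@integral_of_eigenvector n w
    (\matrix_(j, k) (ratr (D%:R * mulmat x k j)))).
  - apply/negP => /eqP/rowP/(_ (Ordinal dim_gt0)); rewrite !mxE => /eqP.
    rewrite -(inj_eq (can_inj coordsK)) of_coordsK linear0 => /eqP/rowP.
    move/(_ (Ordinal dim_gt0)) => /eqP; rewrite !mxE !eqxx oner_eq0.
    by [].
  - move=> j k; rewrite mxE; have /intrP[z ->] := hD (i, k, j).
    by rewrite ratr_int; exact: int_ring_int.
  apply/rowP => k; rewrite !mxE -mulrA.
  have -> : x * of_coords (delta_mx 0 k) = of_coords (row k (mulmat x)).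
    by apply: (can_inj coordsK); rewrite coordsM !of_coordsK rowE.
  rewrite of_coordsE mulr_sumr; apply: eq_bigr => j _.
  by rewrite !mxE mulrC ratrZ -scalerA scaler_nat mulr_natl.
rewrite of_coordsE mulr_sumr; apply: int_ring_sum => i _.
have /intrP[z ->] := vint i.
by rewrite -scalerAr scaler_int -mulrzr; apply: int_ringM => //; exact: int_ring_int.
Qed.

Lemma int_ring_denominator x : exists2 d : nat, (0 < d)%N & O (d%:R * x).
Proof.
have [D D0 hD] := int_ring_of_coords.
have [d d0 hd] := common_denominator (fun i => coords x 0 i).
exists (D * d)%N; first by rewrite muln_gt0 D0.
have := hD (coords (d%:R * x)); rewrite coordsK natrM -mulrA; apply => i.
by rewrite mulr_natl linearMn /= mulmxnE; have := hd i; rewrite mulr_natl.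
Qed.

(** The trace form takes integral values on integral elements and is
    nondegenerate, since the trace of x x^-1 is the degree; D is a denominator of
    the inverse of its Gram matrix. *)
Lemma int_ring_coords : exists2 D : nat, (0 < D)%N &
  forall x, O x -> forall i, D%:R * coords x 0 i \is a Num.int.
Proof.
have [D D0 hD] := int_ring_of_coords.
pose e_ j := D%:R * of_coords (delta_mx 0 j).
have Oe j : O (e_ j).
  by apply: hD => i; rewrite mxE natr_int.
pose T : 'M[rat]_n := \matrix_(i, j) \tr (mulmat (of_coords (delta_mx 0 i) * e_ j)).
have trT x j : (coords x *m T) 0 j = \tr (mulmat (x * e_ j)).
  rewrite -{2}[x]coordsK of_coordsE mulr_suml linear_sum /= linear_sum /= mxE.
  by apply: eq_bigr => i _; rewrite !mxE -scalerAl mulmatZ linearZ.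
have Tunit : T \in unitmx.
  rewrite -row_free_unit; apply/row_freeP; exists (invmx T).
  apply: mulmxV; rewrite -row_free_unit -kermx_eq0; apply/eqP/row_matrixP => i.
  rewrite row0; set v := row i _.
  have vT : v *m T = 0 by apply/sub_kermxP; exact: row_sub.
  apply/eqP; apply/negPn/negP => v0.
  have x0 : of_coords v != 0.
    by rewrite -(inj_eq (can_inj coordsK)) of_coordsK linear0.
  have tr0 y : \tr (mulmat (of_coords v * y)) = 0.
    rewrite -[y]coordsK [of_coords (coords y)]of_coordsE mulr_sumr linear_sum /= linear_sum
      /= big1 // => j _.
    rewrite -scalerAr mulmatZ linearZ /=.
    have : \tr (mulmat (of_coords v * e_ j)) = 0.
      by rewrite -trT of_coordsK vT mxE.
    rewrite /e_ mulr_natl mulrnAr linearMn /= linearMn /= => /eqP.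
    rewrite mulrn_eq0 => /orP[|/eqP ->]; last by rewrite mulr0.
    by rewrite eqn0Ngt D0.
  have := tr0 (of_coords v)^-1; rewrite divff // mulmat1 mxtrace1 => /eqP.
  by rewrite pnatr_eq0 eqn0Ngt dim_gt0.
have [D' D'0 hD'] := common_denominator (fun p : 'I_n * 'I_n => invmx T p.1 p.2).
exists D' => // x Ox i.
rewrite -[coords x](mulmxK Tunit) mxE mulr_sumr; apply: rpred_sum => j _.
rewrite mulrCA; apply: rpredM; last exact: (hD' (j, i)).
by rewrite trT; apply: tr_int; apply: int_ringM.
Qed.
End IntegerRing.

(** * Embeddings and positivity *)

Section Embeddings.
Variable F : fieldExtType rat.
Local Notation O := (int_ring F).
Local Notation evalF a p := (map_poly (in_alg F) p).[a].
Local Notation evalC z p := (map_poly (ratr : rat -> algC) p).[z].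

Lemma primitive_element : exists a : F, forall x, exists p : {poly rat}, x = evalF a p.
Proof.
exists (separable_generator 1 {:F}) => x; apply/Fadjoin1_polyP.
rewrite -eq_adjoin_separable_generator ?sub1v ?memvf //.
by apply/separableP => y _; apply: pcharf0_separable => i;
  rewrite pchar_lalg; exact: pchar_num.
Qed.

(** A generator of the ideal of rational polynomials vanishing at a. *)
Lemma rat_min_poly (a : F) : exists2 p : {poly rat},
  (1 < size p)%N /\ evalF a p = 0 & forall q, evalF a q = 0 -> p %| q.
Proof.
have /polyOver1P[p Ep] := minPolyOver 1 a.
exists p => [|q qa0].
  by split; [rewrite -(size_map_poly (in_alg F)) -Ep size_minPoly | rewrite -Ep minPolyxx].
rewrite -(dvdp_map (in_alg F)) -Ep; apply: minPoly_dvdp; last exact/eqP.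
exact: alg_polyOver.
Qed.

Lemma rmorph_evalF (s : {rmorphism F -> algC}) a p : s (evalF a p) = evalC (s a) p.
Proof.
rewrite -horner_map -map_poly_comp; congr (_.[_]).
by apply: eq_map_poly => q /=; rewrite alg_num_field fmorph_rat.
Qed.

(** With F = Q(a), send p(a) to p(z) for a complex root z of the minimal
    polynomial of a. *)
Lemma embedding_exists : exists s : {rmorphism F -> algC}, True.
Proof.
have [a ha] := primitive_element.
have [p [p1 pa0] hp] := rat_min_poly a.
have [z pz0] : exists z, evalC z p = 0.
  have [z /rootP] : exists z, root (map_poly (ratr : rat -> algC) p) z.
    by apply/closed_rootP; rewrite size_map_poly neq_ltn p1 orbT.
  by exists z.
have [P hP'] := boolp.choice ha.
have hP x : evalF a (P x) = x by rewrite -hP'.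
pose f x := evalC z (P x).
have fE q x : evalF a q = x -> f x = evalC z q.
  move=> qx; apply/eqP; rewrite -subr_eq0 /f -hornerN -hornerD -rmorphN -rmorphD /=.
  have /dvdpP[r ->] : p %| P x - q by apply: hp; rewrite rmorphB /= !hornerE hP qx subrr.
  by rewrite rmorphM /= hornerM pz0 mulr0.
have fB : zmod_morphism f.
  move=> x y; rewrite (fE (P x - P y)) ?rmorphB /= ?hornerE //.
  by rewrite !hP.
have fM : monoid_morphism f.
  split=> [|x y]; first by rewrite (fE 1) rmorph1 hornerC.
  by rewrite (fE (P x * P y)) rmorphM /= hornerM // !hP.
pose s1 := GRing.isZmodMorphism.Build _ _ f fB.
pose s2 := GRing.isMonoidMorphism.Build _ _ f fM.
pose s : {rmorphism F -> algC} := HB.pack f s1 s2.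
by exists s.
Qed.

(** Positivity at all embeddings excludes 0 because there is an embedding. *)
Lemma totally_positive_neq0 (x : F) : totally_positive x -> x != 0.
Proof.
have [s _] := embedding_exists.
by move=> /(_ s); apply: contraTneq => ->; rewrite rmorph0 ltxx.
Qed.

Lemma totally_positiveM (x y : F) :
  totally_positive x -> totally_positive y -> totally_positive (x * y).
Proof. by move=> hx hy s; rewrite rmorphM mulr_gt0. Qed.
Lemma totally_positiveV (x : F) : totally_positive x -> totally_positive x^-1.
Proof. by move=> hx s; rewrite fmorphV invr_gt0. Qed.
Lemma totally_positive1 : totally_positive (1 : F).
Proof. by move=> s; rewrite rmorph1. Qed.

(** All conjugates of y are roots of one rational polynomial, so that they lie in
    a finite list; this bounds them uniformly. *)
Lemma embedding_values (y : F) : exists r : seq algC,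
  forall s : {rmorphism F -> algC}, s y \in r.
Proof.
have [p [p1 py0] _] := rat_min_poly y.
have [r Er] := closed_field_poly_normal (map_poly (ratr : rat -> algC) p).
exists r => s; rewrite -root_prod_XsubC.
suff : root (map_poly (ratr : rat -> algC) p) (s y).
  rewrite Er rootZ // lead_coef_eq0 map_poly_eq0; apply: contraTneq p1 => ->.
  by rewrite size_poly0.
by rewrite /root -rmorph_evalF py0 rmorph0.
Qed.

Hypothesis hF : totally_real F.

(** The main source of totally positive elements in congruence classes: m will be
    a positive integer of the ideal which serves as modulus. *)
Lemma totally_positive_shift (y : F) (m : nat) : (0 < m)%N ->
  exists k : nat, totally_positive (y + (k * m)%:R).
Proof.
move=> m0; have [r hr] := embedding_values y.
pose b := \sum_(z <- r) `|z|.
have b0 : 0 <= b by apply: sumr_ge0.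
exists (Num.bound b) => s; rewrite rmorphD rmorph_nat.
have sb : `|s y| <= b.
  by rewrite /b (big_rem (s y)) //= lerDl sumr_ge0.
have h1 : `|s y| < (Num.bound b * m)%:R.
  apply: le_lt_trans sb _; apply: lt_le_trans (archi_boundP b0) _.
  by rewrite ler_nat leq_pmulr.
rewrite -ltrBlDr sub0r ltrNl; apply: le_lt_trans h1.
by rewrite -normrN real_ler_norm // rpredN hF.
Qed.

(** An embedding is determined by the image of a primitive element, which is one
    of finitely many numbers, so there are finitely many patterns of signs.  All
    finiteness statements below have this shape: a code with values in a finite
    type, equality of codes forcing the relation of interest. *)
Lemma sign_code : exists (T : finType) (c : F -> T),
  forall x y, x != 0 -> y != 0 -> c x = c y -> totally_positive (x / y).
Proof.
have [a ha] := primitive_element.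
have [r hr] := embedding_values a.
pose c x : (size r).-tuple bool :=
  [tuple of [seq `[< exists2 s : {rmorphism F ->
    algC}, s a = z & 0 < s x >] | z <- in_tuple r]].
exists _, c => x y x0 y0 cxy s.
have key : 0 < s x <-> 0 < s y.
  have h u w : c u = c w -> 0 < s u -> 0 < s w.
    move=> /(congr1 val) /= /eq_in_map/(_ _ (hr s)) cuw su.
    have : `[< exists2 s0 : {rmorphism F -> algC}, s0 a = s a & 0 < s0 u >].
      by apply/asboolP; exists s.
    rewrite cuw => /asboolP[s' s'a]; congr (_ < _).
    by have [p ->] := ha w; rewrite !rmorph_evalF s'a.
  by split; apply: h.
have sgn u : u != 0 -> ~ 0 < s u -> s u < 0.
  move=> u0 su; rewrite real_ltNge ?hF ?real0 //; apply/negP => su'.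
  by apply: su; rewrite lt_def su' fmorph_eq0 u0.
rewrite fmorph_div; case: (pselect (0 < s x)) => sx.
  by apply: divr_gt0 => //; exact/key.
have sy : ~ 0 < s y by rewrite -key.
by rewrite nmulr_rgt0 ?invr_lt0 ?sgn.
Qed.
End Embeddings.

(** * Fractional ideals and their finite quotients *)

Section FracIdeals.
Variable F : fieldExtType rat.
Local Notation O := (int_ring F).
Implicit Types (I J K A B D E : set F) (x y z r : F).

Lemma natF_neq0 (n : nat) : (0 < n)%N -> (n%:R : F) != 0.
Proof. by move=> n0; rewrite (pcharf0P F).1 -?lt0n // => p; rewrite pchar_lalg;
  exact: pchar_num. Qed.

Lemma fracI0 I : frac_ideal I -> I 0. Proof. by case. Qed.
Lemma fracID I x y : frac_ideal I -> I x -> I y -> I (x + y).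
Proof. by case=> _ h *; apply: h. Qed.
Lemma fracIM I r x : frac_ideal I -> O r -> I x -> I (r * x).
Proof. by case=> _ _ h *; apply: h. Qed.
Lemma fracIMr I r x : frac_ideal I -> O r -> I x -> I (x * r).
Proof. by move=> *; rewrite mulrC; apply: fracIM. Qed.
Lemma fracIN I x : frac_ideal I -> I x -> I (- x).
Proof. by move=> fI Ix; rewrite -mulN1r; apply: fracIM => //; exact/int_ringN/int_ring1. Qed.
Lemma fracIB I x y : frac_ideal I -> I x -> I y -> I (x - y).
Proof. by move=> fI Ix Iy; apply: fracID => //; apply: fracIN. Qed.
Lemma fracI_sum I (T : Type) (s : seq T) (P : pred T) (f : T -> F) : frac_ideal I ->
  (forall i, P i -> I (f i)) -> I (\sum_(i <- s | P i) f i).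
Proof. by move=> fI h; apply: big_ind => //; [exact: fracI0|move=> *; exact: fracID]. Qed.

Lemma frac_int_ring : frac_ideal O.
Proof.
split; [exact: int_ring0|exact: int_ringD|exact: int_ringM|by exists 1;
  rewrite ?oner_neq0 //; exact: int_ring1|].
by exists 1; rewrite oner_neq0; split=> //; [exact: int_ring1|move=> _ [y Oy <-];
  rewrite mul1r].
Qed.

Lemma frac_scale x I : x != 0 -> frac_ideal I -> frac_ideal (set_scale x I).
Proof.
move=> x0 fI; split.
- by exists 0; rewrite ?mulr0 //; exact: fracI0.
- by move=> _ _ [y Iy <-] [z Iz <-]; exists (y + z); rewrite ?mulrDr //; apply: fracID.
- by move=> r _ Or [y Iy <-]; exists (r * y); [apply: fracIM|rewrite mulrCA].
- by have [y Iy y0] := frac_ideal_neq0 fI; exists (x * y); [exists y|rewrite mulf_neq0].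
have [d [Od d0 dI]] := frac_ideal_denom fI.
have [k k0 Ok] := int_ring_denominator x.
exists (k%:R * d); split.
- by apply: int_ringM => //; exact: int_ring_nat.
- by rewrite mulf_neq0 // natF_neq0.
move=> _ [_ [y Iy <-] <-]; rewrite mulrACA; apply: int_ringM => //.
by apply: dI; exists y.
Qed.

Lemma set_scaleP x I y : x != 0 -> set_scale x I y <-> I (y / x).
Proof.
move=> x0; split=> [[z Iz <-]|h]; first by rewrite mulrAC divff // mul1r.
by exists (y / x); rewrite // mulrC divfK.
Qed.

Lemma frac_principal x : x != 0 -> frac_ideal (principal x).
Proof. by move=> x0; apply: frac_scale => //; exact: frac_int_ring. Qed.

Lemma principal_sub x I : frac_ideal I -> I x -> principal x `<=` I.
Proof. by move=> fI Ix _ [r Or <-]; rewrite mulrC; apply: fracIM. Qed.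

Lemma principal_id x : principal x x.
Proof. by exists 1; rewrite ?mulr1 //; exact: int_ring1. Qed.

(** If y is in I and d y^-1 is integral then d is in I. *)
Lemma frac_nat_mem I : frac_ideal I -> exists2 m : nat, (0 < m)%N & I m%:R.
Proof.
move=> fI; have [y Iy y0] := frac_ideal_neq0 fI.
have [d d0 Od] := int_ring_denominator y^-1; exists d => //.
by rewrite -[d%:R](divfK y0); apply: fracIM.
Qed.

(** After clearing denominators, code an element by its integral coordinates
    modulo a multiple of an integer lying in J. *)
Lemma finite_quotient I J : frac_ideal I -> frac_ideal J ->
  exists (T : finType) (f : F -> T), forall x y, I x -> I y -> f x = f y -> J (x - y).
Proof.
move=> fI fJ; have [d [Od d0 dI]] := frac_ideal_denom fI.
have [m m0 Jm] := frac_nat_mem (frac_scale d0 fJ).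
have [D1 D10 h1] := int_ring_of_coords F; have [D2 D20 h2] := int_ring_coords F.
pose q := (D1 * D2 * m)%N.
have q0 : (0 < q)%N by rewrite !muln_gt0 D10 D20.
pose cf x i : int := numq (D2%:R * coords (d * x) 0 i).
exists {ffun 'I_(\dim {:F}) -> 'I_q.+1},
  (fun x => [ffun i => inord `|(cf x i %% q)%Z|]) => x y Ix Iy /ffunP hxy.
have Odxy : O (d * x) /\ O (d * y) by split; apply: dI; [exists x|exists y].
have dvd i : exists z : int, cf x i - cf y i = z * q%:Z.
  have qz : q%:Z != 0 by case: (q) q0.
  have lt u : (`|(cf u i %% q)%Z| < q.+1)%N.
    by rewrite -ltz_nat gez0_abs ?modz_ge0 // (lt_trans (ltz_mod _ qz)) // ltz_nat.
  have := hxy i; rewrite !ffunE => /(congr1 val); rewrite /= !inordK //.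
  move=> /(congr1 Posz); rewrite !gez0_abs ?modz_ge0 // => /eqP.
  by rewrite eqz_mod_dvd => /dvdzP.
have cfE u i : O (d * u) -> (cf u i)%:~R = D2%:R * coords (d * u) 0 i.
  by move=> Ou; have /intrP[z Ez] := h2 _ Ou i; rewrite /cf Ez numq_int.
suff : set_scale d J (d * (x - y)).
  by rewrite set_scaleP // mulrAC divff // mul1r.
pose v : 'rV[rat]_(\dim {:F}) := (D1 * m)%:R^-1 *: coords (d * (x - y)).
have Ov : O (D1%:R * of_coords v).
  apply: h1 => i; rewrite mxE mulrBr linearB /= mxE [X in _ + X]mxE.
  have [z Ez] := dvd i; have := congr1 (intr : int -> rat) Ez.
  rewrite rmorphB rmorphM /= !cfE; try by case: Odxy.
  rewrite -mulrBr => /(canRL (mulKf _)) ->; last by rewrite pnatr_eq0 -lt0n.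
  suff -> : (D1 * m)%:R^-1 * (D2%:R^-1 * (z%:~R * q%:Z%:~R)) = z%:~R :> rat by exact: intr_int.
  rewrite -pmulrn /q !natrM; field.
  by rewrite !pnatr_eq0 -!lt0n D10 D20 m0.
suff -> : d * (x - y) = (D1%:R * of_coords v) * m%:R by apply: (fracIM (frac_scale d0 fJ)).
rewrite mulrAC -natrM mulr_natl -linearMn /= /v -scaler_nat scalerA divff ?scale1r ?coordsK //.
by rewrite pnatr_eq0 -lt0n muln_gt0 D10.
Qed.

End FracIdeals.

(** * Products of ideals and the determinant trick *)

Section IdealProducts.
Variable F : fieldExtType rat.
Local Notation O := (int_ring F).
Implicit Types (I J K A B D E : set F) (x y z r : F).

Lemma ideal_mul_mem I J x y : I x -> J y -> ideal_mul I J (x * y).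
Proof.
by move=> Ix Jy; exists 1%N, (fun=> x), (fun=> y); split=> //; rewrite big_ord1.
Qed.

Lemma ideal_mul0 I J : ideal_mul I J 0.
Proof.
by exists 0%N, (fun=> 0), (fun=> 0); split; [case|case|rewrite big_ord0].
Qed.

Lemma ideal_mulD I J x y : ideal_mul I J x -> ideal_mul I J y -> ideal_mul I J (x + y).
Proof.
move=> [n [u [v [Iu Jv ->]]]] [m [w [t [Iw Jt ->]]]].
pose g T (a : 'I_n -> T) (b : 'I_m -> T) (k : 'I_(n + m)) :=
  match fintype.split k with inl i => a i | inr j => b j end.
exists (n + m)%N, (g _ u w), (g _ v t); split.
- by move=> k; rewrite /g; case: fintype.split.
- by move=> k; rewrite /g; case: fintype.split.
by rewrite big_split_ord /=; congr (_ + _); apply: eq_bigr => k _;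
   rewrite /g; [rewrite (unsplitK (inl k))|rewrite (unsplitK (inr k))].
Qed.

Lemma ideal_mul_sum I J (T : Type) (s : seq T) (P : pred T) (f : T -> F) :
  (forall i, P i -> ideal_mul I J (f i)) -> ideal_mul I J (\sum_(i <- s | P i) f i).
Proof. by move=> h; apply: big_ind => //; [exact: ideal_mul0|exact: ideal_mulD]. Qed.

(** The induction principle for products: membership in an additively closed set
    is checked on products of two elements. *)
Lemma ideal_mul_sub I J K : K 0 -> (forall x y, K x -> K y -> K (x + y)) ->
  (forall x y, I x -> J y -> K (x * y)) -> ideal_mul I J `<=` K.
Proof. by move=> K0 KD h _ [n [u [v [Iu Jv ->]]]]; apply: big_ind => // i _; apply: h. Qed.

Lemma ideal_mul_sub_mul I J K L : (forall x y, I x -> J y -> ideal_mul K L (x * y)) ->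
  ideal_mul I J `<=` ideal_mul K L.
Proof. by apply: ideal_mul_sub; [exact: ideal_mul0|exact: ideal_mulD]. Qed.

Lemma ideal_mul_sub_frac I J K : frac_ideal K -> (forall x y, I x -> J y -> K (x * y)) ->
  ideal_mul I J `<=` K.
Proof. by move=> fK; apply: ideal_mul_sub; [exact: fracI0|move=> *; exact: fracID]. Qed.

Lemma ideal_mulS I J K L : I `<=` K -> J `<=` L -> ideal_mul I J `<=` ideal_mul K L.
Proof. by move=> IK JL; apply: ideal_mul_sub_mul => x y Ix Jy; apply: ideal_mul_mem; auto. Qed.

Lemma ideal_mulC : commutative (@ideal_mul F).
Proof.
suff h I J : ideal_mul I J `<=` ideal_mul J I by move=> I J; apply/seteqP; split; exact: h.
by apply: ideal_mul_sub_mul => x y Ix Jy; rewrite mulrC; apply: ideal_mul_mem.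
Qed.

Lemma ideal_mulA : associative (@ideal_mul F).
Proof.
have h I J K : ideal_mul I (ideal_mul J K) `<=` ideal_mul (ideal_mul I J) K.
  apply: ideal_mul_sub_mul => x _ Ix [n [u [v [Ju Kv ->]]]].
  rewrite mulr_sumr; apply: ideal_mul_sum => i _; rewrite mulrA.
  by apply: ideal_mul_mem => //; apply: ideal_mul_mem.
move=> I J K; apply/seteqP; split; first exact: h.
by rewrite [X in X `<=` _]ideal_mulC [ideal_mul I J]ideal_mulC [ideal_mul I _]ideal_mulC
  [ideal_mul J K]ideal_mulC; exact: h.
Qed.

Lemma ideal_mulCA : left_commutative (@ideal_mul F).
Proof. by move=> I J K; rewrite !ideal_mulA [ideal_mul I J]ideal_mulC. Qed.
Lemma ideal_mulAC : right_commutative (@ideal_mul F).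
Proof. by move=> I J K; rewrite -!ideal_mulA [ideal_mul J K]ideal_mulC. Qed.
Lemma ideal_mulACA : interchange (@ideal_mul F) (@ideal_mul F).
Proof. by move=> I J K L; rewrite -!ideal_mulA [ideal_mul J _]ideal_mulCA. Qed.

Lemma ideal_mulr1 I : frac_ideal I -> ideal_mul I O = I.
Proof.
move=> fI; apply/seteqP; split; first by apply: ideal_mul_sub_frac => // x y Ix Oy;
  exact: fracIMr.
by move=> x Ix; rewrite -[x]mulr1; apply: ideal_mul_mem => //; exact: int_ring1.
Qed.
Lemma ideal_mul1r I : frac_ideal I -> ideal_mul O I = I.
Proof. by move=> fI; rewrite ideal_mulC ideal_mulr1. Qed.

Lemma frac_mul I J : frac_ideal I -> frac_ideal J -> frac_ideal (ideal_mul I J).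
Proof.
move=> fI fJ; split.
- exact: ideal_mul0.
- exact: ideal_mulD.
- move=> r _ Or [n [u [v [Iu Jv ->]]]]; rewrite mulr_sumr; apply: ideal_mul_sum => i _.
  by rewrite mulrA; apply: ideal_mul_mem => //; apply: fracIM.
- have [x Ix x0] := frac_ideal_neq0 fI; have [y Jy y0] := frac_ideal_neq0 fJ.
  by exists (x * y); [apply: ideal_mul_mem|rewrite mulf_neq0].
have [d [Od d0 dI]] := frac_ideal_denom fI; have [e [Oe e0 eJ]] := frac_ideal_denom fJ.
exists (d * e); split; [exact: int_ringM|by rewrite mulf_neq0|].
move=> _ [_ [n [u [v [Iu Jv ->]]]] <-]; rewrite mulr_sumr; apply: int_ring_sum => i _.
by rewrite mulrACA; apply: int_ringM; [apply: dI; exists (u i)|apply: eJ; exists (v i)].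
Qed.

Lemma set_scaleE x I : frac_ideal I -> set_scale x I = ideal_mul (principal x) I.
Proof.
move=> fI; apply/seteqP; split.
  by move=> _ [y Iy <-]; apply: ideal_mul_mem => //; exact: principal_id.
move=> _ [n [u [v [xu Iv ->]]]].
have [w hw] := boolp.choice (fun i => let: ex_intro2 r Or e := xu i in ex_intro (fun r =>
  O r /\ x * r = u i) r (conj Or e)).
exists (\sum_i w i * v i).
  by apply: fracI_sum => // i _; apply: fracIM => //; case: (hw i).
by rewrite mulr_sumr; apply: eq_bigr => i _; case: (hw i) => _ <-; rewrite mulrA.
Qed.

Lemma principalM x y : ideal_mul (principal x) (principal y) = principal (x * y).
Proof.
apply/seteqP; split => [_ [n [u [v [xu yv ->]]]]|_ [r Or <-]]; last first.
  rewrite -mulrA; apply: ideal_mul_mem; first exact: principal_id.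
  by exists r.
have h i : exists r, O r /\ x * y * r = u i * v i.
  have [r Or <-] := xu i; have [s Os <-] := yv i.
  by exists (r * s); split; [exact: int_ringM|rewrite mulrACA].
have [w hw] := boolp.choice h; exists (\sum_i w i).
  by apply: int_ring_sum => i _; case: (hw i).
by rewrite mulr_sumr; apply: eq_bigr => i _; case: (hw i).
Qed.

Lemma principal1 : principal (1 : F) = O.
Proof. by apply/seteqP; split => [_ [y Oy <-]|y Oy]; [rewrite mul1r|exists y;
  rewrite ?mul1r]. Qed.

Lemma frac_inv I : frac_ideal I -> frac_ideal (ideal_inv I).
Proof.
move=> fI; split.
- by move=> _ [y Iy <-]; rewrite mul0r; exact: int_ring0.
- move=> x y hx hy _ [z Iz <-]; rewrite mulrDl; apply: int_ringD; [apply: hx|apply: hy];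
  by exists z.
- by move=> r x Or hx _ [z Iz <-]; rewrite -mulrA; apply: int_ringM => //; apply: hx; exists z.
- by have [d [Od d0 dI]] := frac_ideal_denom fI; exists d.
have [y Iy y0] := frac_ideal_neq0 fI.
have [k k0 Ok] := int_ring_denominator y.
exists (k%:R * y); split => //; first by rewrite mulf_neq0 ?natF_neq0.
move=> _ [x hx <-]; rewrite -mulrA; apply: int_ringM; first exact: int_ring_nat.
by rewrite mulrC; apply: hx; exists y.
Qed.

Lemma ideal_inv_mem I x y : ideal_inv I x -> I y -> O (x * y).
Proof. by move=> h Iy; apply: h; exists y. Qed.

Lemma mul_inv_sub_int_ring I : ideal_mul I (ideal_inv I) `<=` O.
Proof.
apply: ideal_mul_sub; [exact: int_ring0|exact: int_ringD|].
by move=> x y Ix hy; rewrite mulrC; apply: ideal_inv_mem Ix.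
Qed.

(** For y != 0 in D the quotient D/yR is finite, so that y together with
    representatives of the quotient generates D. *)
Lemma frac_finite_gen D : frac_ideal D -> exists (n : nat) (d : 'I_n -> F),
  [/\ forall i, D (d i), exists i, d i != 0 &
      forall x, D x -> exists2 r : 'I_n -> F, forall i, O (r i) & x = \sum_i r i * d i].
Proof.
move=> fD; have [y Dy y0] := frac_ideal_neq0 fD.
have [T [f hf]] := finite_quotient fD (frac_principal y0).
have hg (t : T) : exists z, D z /\ forall x, D x -> f x = t -> f z = t.
  case: (pselect (exists2 x, D x & f x = t)) => [[x Dx fx]|h].
    by exists x; split.
  by exists 0; split; [exact: fracI0|move=> x Dx fx; case: h; exists x].
have [g gP] := boolp.choice hg.
pose d (o : option T) := if o is Some t then g t else y.
exists #|{: option T}|, (fun i => d (enum_val i)); split.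
- by move=> i; case: (enum_val i) => [t|] //=; case: (gP t).
- by exists (enum_rank None); rewrite enum_rankK.
move=> x Dx; have [Dg fg] := gP (f x).
have [r Or Er] := hf _ _ Dx Dg (esym (fg x Dx erefl)).
pose c (o : option T) := if o is Some t then (t == f x)%:R else r.
exists (fun i => c (enum_val i)).
  by move=> i; case: (enum_val i) => [t|] //=; exact: int_ring_nat.
rewrite -(big_enum_val (A := {: option T}) (fun o => c o * d o)) /=.
rewrite (bigD1 None) //= (bigD1 (Some (f x))) //= eqxx mul1r big1 ?addr0.
  by rewrite mulrC Er subrK.
by case=> [t|] //= /eqP h; case: eqP => [E|]; [rewrite E in h|rewrite mul0r].
Qed.

(** Cayley-Hamilton for multiplication by x on generators of D. *)
Lemma stable_integral D x : frac_ideal D -> (forall y, D y -> D (x * y)) -> O x.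
Proof.
move=> fD xD; have [n [d [Dd [i0 d0] gD]]] := frac_finite_gen fD.
have h i : exists r : 'I_n -> F, (forall j, O (r j)) /\ x * d i = \sum_j r j * d j.
  by have [r Or Er] := gD _ (xD _ (Dd i)); exists r.
have [r hr] := boolp.choice h.
apply: (@integral_of_eigenvector F n (\row_j d j) (\matrix_(i, j) r j i)).
- by apply: contra_neq d0 => /rowP/(_ i0); rewrite !mxE.
- by move=> i j; rewrite mxE; case: (hr j) => Or _; apply: Or.
apply/rowP => j; rewrite !mxE; case: (hr j) => _ ->.
by apply: eq_bigr => i _; rewrite !mxE mulrC.
Qed.

(** Writing generators of D as combinations of themselves with coefficients in E
    gives a matrix X = 1 - (e_ij) which kills them; its determinant is 0, and is
    congruent to 1 modulo E. *)
Lemma nakayama D E : frac_ideal D -> E 0 -> (forall x y, E x -> E y -> E (x + y)) ->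
  (forall r x, O r -> E x -> E (r * x)) -> E `<=` O ->
  D `<=` ideal_mul E D -> E 1.
Proof.
move=> fD E0 ED Emul EO DE; have [n [d [Dd [i0 d0] gD]]] := frac_finite_gen fD.
have EN x : E x -> E (- x) by move=> Ex; rewrite -mulN1r; apply: Emul => //;
  exact/int_ringN/int_ring1.
have Esum (T : Type) (s : seq T) (P : pred T) (f : T -> F) :
  (forall i, P i -> E (f i)) -> E (\sum_(i <- s | P i) f i).
  by move=> h; apply: big_ind.
have h i : exists e : 'I_n -> F, (forall j, E (e j)) /\ d i = \sum_j e j * d j.
  have [m [u [v [Eu Dv ->]]]] := DE _ (Dd i).
  have h2 k : exists r : 'I_n -> F, (forall j, O (r j)) /\ v k = \sum_j r j * d j.
    by have [r Or Er] := gD _ (Dv k); exists r.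
  have [r hr] := boolp.choice h2.
  exists (fun j => \sum_k u k * r k j); split.
    by move=> j; apply: Esum => k _; rewrite mulrC; apply: Emul => //; case: (hr k) => Or _.
  under [RHS]eq_bigr do rewrite mulr_suml.
  rewrite exchange_big /=; apply: eq_bigr => k _; case: (hr k) => _ ->.
  by rewrite mulr_sumr; apply: eq_bigr => j _; rewrite mulrA.
have [e he] := boolp.choice h.
pose X : 'M[F]_n := \matrix_(i, j) ((i == j)%:R - e j i).
have det0 : \det X = 0.
  apply/eqP/det0P; exists (\row_j d j).
    by apply: contra_neq d0 => /rowP/(_ i0); rewrite !mxE.
  apply/rowP => j; rewrite !mxE.
  under eq_bigr do rewrite !mxE mulrBr.
  rewrite sumrB (bigD1 j) //= eqxx mulr1 big1 ?addr0; last first.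
    by move=> i /negbTE ->; rewrite mulr0.
  by case: (he j) => _ {1}->; apply/eqP; rewrite subr_eq0; apply/eqP/eq_bigr => i _;
    rewrite mulrC.
have prodE (s : seq 'I_n) : exists2 a, E a & \prod_(i <- s) (1 - e i i) = 1 - a.
  elim: s => [|i s [a Ea IH]]; first by exists 0; rewrite ?big_nil ?subr0.
  rewrite big_cons IH; exists (e i i + (1 - e i i) * a); last by ring.
  have Eii : E (e i i) by case: (he i) => Ei _; apply: Ei.
  by apply: ED => //; apply: Emul => //; apply: int_ringB; [exact: int_ring1|exact: EO].
have int_ringX i j : O (X i j).
  by rewrite mxE; apply: int_ringB; [exact: int_ring_nat|apply: EO; case: (he j) => Ei _;
    apply: Ei].
have [a Ea Ea1] := prodE (index_enum 'I_n).
move: det0; rewrite /determinant (bigD1 (1%g : {perm 'I_n})) //= odd_perm1 expr0 mul1r.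
have -> : \prod_i X i ((1%g : {perm 'I_n}) i) = 1 - a.
  by rewrite -Ea1; apply: eq_bigr => i _; rewrite mxE perm1 eqxx.
set b := \sum_(s | _) _ => h0.
suff Eb : E b.
  have -> : (1 : F) = a - b by rewrite -[LHS]subr0 -h0; ring.
  by apply: ED => //; apply: EN.
apply: Esum => s s1; apply: (Emul).
  by rewrite -signr_odd; case: odd; rewrite ?expr1 ?expr0;
    [exact/int_ringN/int_ring1|exact: int_ring1].
have [i si] : exists i, i != s i.
  apply/existsP; apply: contraNT s1 => /existsPn hs; apply/eqP/permP => i.
  by rewrite perm1; apply/esym/eqP; have := hs i; rewrite negbK.
rewrite (bigD1 i) //= mulrC; apply: (Emul); first by apply: int_ring_prod.
by rewrite mxE (negbTE si) sub0r; apply: EN; case: (he (s i)).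
Qed.
End IdealProducts.

(** * Finiteness of the class number and invertibility *)

Section ClassNumber.
Variable F : fieldExtType rat.
Local Notation O := (int_ring F).
Local Notation n := (\dim {:F}).
Implicit Types (I J K A B D E : set F) (x y z r : F).

Definition fnorm (x : F) : rat := \det (mulmat x).

Lemma fnormM x y : fnorm (x * y) = fnorm x * fnorm y.
Proof. by rewrite /fnorm mulmatM det_mulmx mulrC. Qed.
Lemma fnorm1 : fnorm 1 = 1.
Proof. by rewrite /fnorm mulmat1 det1. Qed.
Lemma fnorm_neq0 x : x != 0 -> fnorm x != 0.
Proof.
move=> x0; have : fnorm (x * x^-1) != 0 by rewrite divff // fnorm1 oner_neq0.
by rewrite fnormM mulf_eq0 negb_or => /andP[].
Qed.

(** The norm form is homogeneous of degree n in the coordinates. *)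
Lemma fnorm_bound : exists2 C : rat, 1 <= C &
  forall x (d : rat), 0 <= d -> (forall i, `|coords x 0 i| <= d) -> `|fnorm x| <= C * d ^+ n.
Proof.
pose K := \sum_i \sum_j \sum_k `|mulmat (of_coords (delta_mx 0 k) : F) i j|.
have K0 : 0 <= K by do 3![apply: sumr_ge0 => ? _].
exists (1 + \sum_(s : 'S_n) K ^+ n).
  by rewrite lerDl; apply: sumr_ge0 => s _; apply: exprn_ge0.
move=> x d d0 hx; have ent i j : `|mulmat x i j| <= d * K.
  rewrite -[x]coordsK of_coordsE linear_sum /= summxE.
  apply: (le_trans (ler_norm_sum _ _ _)).
  apply: (@le_trans _ _ (\sum_k d * `|mulmat (of_coords (delta_mx 0 k) : F) i j|)).
    apply: ler_sum => k _; rewrite mulmatZ mxE normrM ler_wpM2r //.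
  rewrite -mulr_sumr ler_wpM2l //.
  have term (f : 'I_n -> rat) l : (forall m, 0 <= f m) -> f l <= \sum_m f m.
    by move=> f0; rewrite (bigD1 l) //= lerDl sumr_ge0.
  apply: (le_trans (term (fun j => \sum_k _) j _)).
    by move=> m; apply: sumr_ge0.
  apply: (term (fun i => \sum_j \sum_k _) i) => m.
  by do 2![apply: sumr_ge0 => ? _].
rewrite mulrDl mul1r ler_wpDl ?exprn_ge0 // /fnorm /determinant mulr_suml.
apply: (le_trans (ler_norm_sum _ _ _)); apply: ler_sum => s _.
rewrite normrM normrX normrN1 expr1n mul1r normr_prod -exprMn mulrC.
rewrite -[X in _ ^+ X]card_ord -prodr_const; apply: ler_prod => i _.
by rewrite normr_ge0 /= ent.
Qed.

(** A weak form of division with remainder.  Among k^n + 1 multiples of x two have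
    fractional parts of their coordinates in the same cube of side 1/k; their
    difference is 1/k-close to a lattice point, where the norm form is small. *)
Lemma hurwitz : exists2 H : nat, (0 < H)%N &
  forall x, exists t : nat, exists2 w : F,
    [/\ (0 < t)%N, (t <= H)%N & O w] & `|fnorm (t%:R * x - w)| < 1.
Proof.
have [D D0 hD] := int_ring_of_coords F; have [C C1 hC] := fnorm_bound.
have C0 : 0 < C := lt_le_trans ltr01 C1.
(* k > C D makes C (D/k)^n < 1 *)
pose k := (Num.bound (C * D%:R)).+1.
have CDk : C * D%:R < k%:R.
  by apply: lt_trans (archi_boundP _) _; rewrite ?mulr_ge0 ?ler0n ?ltW // ltr_nat.
have k0 : 0 < k%:R :> rat by rewrite ltr0n.
exists (k ^ n)%N; first by rewrite expn_gt0.
move=> x; pose g i := coords (D%:R^-1 * x) 0 i.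
pose fr (t : nat) i := t%:R * g i - (Num.floor (t%:R * g i))%:~R.
have fr01 t i : 0 <= fr t i < 1.
  by rewrite subr_ge0 floor_le /= ltrBlDl; have := floorD1_gt (t%:R * g i); rewrite intrD addrC.
pose bx t : {ffun 'I_n -> 'I_k} := [ffun i => inord `|Num.floor (k%:R * fr t i)|].
have [t1 [t2 [/andP[t12 t2k] Eb]]] := pigeonhole bx.
rewrite card_ffun !card_ord in t2k.
pose z : 'rV[rat]_n := \row_i (Num.floor (t2%:R * g i) - Num.floor (t1%:R * g i))%:~R.
exists (t2 - t1)%N, (D%:R * of_coords z).
  split; first by rewrite subn_gt0.
    exact: leq_trans (leq_subr _ _) t2k.
  by apply: hD => i; rewrite mxE intr_int.
have -> : (t2 - t1)%:R * x - D%:R * of_coords z =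
    D%:R * ((t2 - t1)%:R * (D%:R^-1 * x) - of_coords z).
  by rewrite mulrBr mulrCA mulVKf ?natF_neq0.
set y := _ - of_coords z.
have cy i : `|coords y 0 i| <= k%:R^-1.
  have -> : coords y 0 i = fr t2 i - fr t1 i.
    rewrite /y linearB /= of_coordsK mulr_natl linearMn /= mxE [X in _ + X]mxE mulmxnE [z _
      _]mxE.
    rewrite -/(g i) intrB -[_ *+ (t2 - t1)]mulr_natl natrB 1?ltnW // /fr; ring.
  have fk t : (`|Num.floor (k%:R * fr t i)| < k)%N.
    have /andP[f0 f1] := fr01 t i.
    rewrite -ltz_nat gez0_abs ?floor_ge0 ?mulr_ge0 ?ler0n // floor_lt_int.
    by rewrite -pmulrn -[X in _ < X]mulr1 ltr_pM2l.
  have : bx t1 i = bx t2 i by rewrite Eb.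
  rewrite !ffunE => /(congr1 val); rewrite /= !inordK // => /(congr1 Posz).
  have f0 t : 0 <= k%:R * fr t i by have /andP[f0 _] := fr01 t i; rewrite mulr_ge0 ?ler0n.
  rewrite !gez0_abs ?floor_ge0 // => Ef.
  have := floor_itv (k%:R * fr t1 i); have := floor_itv (k%:R * fr t2 i).
  rewrite Ef intrD => /andP[a1 a2] /andP[b1 b2].
  rewrite -(ler_pM2l k0) divff ?gt_eqF // -[X in X * _](gtr0_norm k0) -normrM mulrBr.
  by rewrite ler_norml; apply/andP; split; lra.
have Dk0 : 0 <= D%:R / k%:R :> rat by rewrite divr_ge0 ?ler0n.
have Dk1 : D%:R / k%:R <= 1 :> rat.
  by rewrite ler_pdivrMr // mul1r (le_trans _ (ltW CDk)) // ler_peMl ?ler0n.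
apply: (@le_lt_trans _ _ (C * (D%:R / k%:R) ^+ n)).
  apply: hC => // i; rewrite mulr_natl linearMn /= mulmxnE -[coords y 0 i *+ D]mulr_natl normrM.
  by rewrite normr_nat ler_wpM2l ?ler0n.
apply: (@le_lt_trans _ _ (C * (D%:R / k%:R))); last by rewrite mulrA ltr_pdivrMr // mul1r.
rewrite ler_wpM2l ?(ltW C0) // -[n]prednK ?dim_gt0 // exprS ler_piMr // exprn_ile1 //.
Qed.

(** Divide by a nonzero b in A of least norm.  For a in A some multiple t a, t <= H,
    differs from a multiple of b by an element of A of smaller norm, that is by 0;
    so H! a is in bR, and H! b^-1 A is integral and contains H!. *)
Lemma ideal_class_bound : exists2 m : nat, (0 < m)%N & forall A, frac_ideal A ->
  exists x B, [/\ x != 0, int_ideal B, B m%:R & A = set_scale x B].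
Proof.
have [H H0 hH] := hurwitz; exists H`!; first exact: fact_gt0.
move=> A fA; have [d [Od d0 dA]] := frac_ideal_denom fA.
pose P k := `[< exists b, [/\ A b, b != 0 & `|fnorm (d * b)| = k%:R] >].
have fnat x : O x -> exists k : nat, `|fnorm x| = k%:R.
  by move=> Ox; apply/natrP/natr_norm_int; exact: det_int.
have exP : exists k, P k.
  have [b Ab b0] := frac_ideal_neq0 fA.
  have [k Ek] : exists k : nat, `|fnorm (d * b)| = k%:R by apply: fnat; apply: dA; exists b.
  by exists k; apply/asboolP; exists b.
have [k /asboolP[b [Ab b0 Ek]] kmin] := ex_minnP exP.
have m0 := natF_neq0 F (fact_gt0 H).
have mA a : A a -> O (H`!%:R * (a / b)).
  move=> Aa; have [t [w [t0 tH Ow] tw]] := hH (a / b).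
  suff tab : t%:R * (a / b) = w.
    have [q ->] : exists q, H`! = (q * t)%N by apply/dvdnP; rewrite dvdn_fact // t0.
    by rewrite natrM -mulrA tab; apply: int_ringM => //; exact: int_ring_nat.
  apply/eqP; rewrite -subr_eq0; apply/negPn/negP => tw0.
  set c := _ - w in tw tw0.
  have Acb : A (c * b).
    rewrite /c mulrBl -mulrA divfK //; apply: fracIB => //; apply: fracIM => //;
      exact: int_ring_nat.
  have [l El] : exists l : nat, `|fnorm (d * (c * b))| = l%:R.
    by apply: fnat; apply: dA; exists (c * b).
  have /kmin : P l by apply/asboolP; exists (c * b); split=> //; rewrite mulf_neq0.
  rewrite leqNgt => /negP; apply;
    rewrite -(ltr_nat rat) -El -Ek mulrCA [fnorm (c * _)]fnormM (normrM (fnorm c)).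
  by rewrite gtr_pMl // normr_gt0 fnorm_neq0 // mulf_neq0.
exists (b / H`!%:R), (set_scale (H`!%:R / b) A).
have n0 : H`!%:R / b != 0 by rewrite mulf_neq0 ?invr_eq0.
split.
- by rewrite mulf_neq0 ?invr_eq0.
- split; first exact: frac_scale.
  by move=> _ [a Aa <-]; rewrite mulrAC -mulrA; exact: mA.
- by exists b => //; rewrite divfK.
apply/seteqP; split=> [a Aa|_ [_ [a Aa <-] <-]].
  exists (H`!%:R / b * a); first by exists a.
  by field; rewrite b0.
suff -> : b / H`!%:R * (H`!%:R / b * a) = a by [].
by field; rewrite b0.
Qed.

(** An ideal containing J is a union of classes modulo J. *)
Lemma ideal_code J : frac_ideal J -> exists (T : finType) (c : set F -> T),
  forall A B, int_ideal A -> int_ideal B -> J `<=` A -> J `<=` B -> c A = c B -> A = B.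
Proof.
move=> fJ; have [T [f hf]] := finite_quotient (frac_int_ring F) fJ.
pose c A : {set T} := [set t | `[< exists2 x, A x & f x = t >]]%SET.
exists _, c => A B.
suff h A' B' : int_ideal A' -> int_ideal B' -> J `<=` A' -> J `<=` B' ->
    c A' = c B' -> A' `<=` B' by move=> *; apply/seteqP; split; apply: h.
move=> [fA AO] [fB BO] JA JB /setP cAB x Ax.
have := cAB (f x); rewrite !inE.
have -> : `[< exists2 y, A' y & f y = f x >] by apply/asboolP; exists x.
move=> /esym/asboolP[y By fyx].
rewrite -[x](subrK y) addrC; apply: fracID => //; apply: JB; apply: hf => //; auto.
Qed.

(** Finiteness of the class number: an ideal is coded by a proportional ideal which
    contains the fixed integer m. *)
Lemma class_code : exists (T : finType) (c : set F -> T),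
  forall A B, frac_ideal A -> frac_ideal B -> c A = c B ->
    exists2 x, x != 0 & A = set_scale x B.
Proof.
have [m m0 hm] := ideal_class_bound.
have [T [c hc]] := ideal_code (frac_principal (natF_neq0 F m0)).
have h A : exists B, frac_ideal A ->
  [/\ int_ideal B, B m%:R & exists2 x, x != 0 & A = set_scale x B].
  case: (pselect (frac_ideal A)) => [/hm[x [B [x0 iB Bm ->]]]|]; last by exists A.
  by exists B => _; split=> //; exists x.
have [r hr] := boolp.choice h.
exists T, (c \o r) => A B fA fB /= cAB.
have [iA Am [x x0 EA]] := hr A fA; have [iB Bm [y y0 EB]] := hr B fB.
have Er : r A = r B.
  by apply: hc => //; apply: principal_sub => //; [case: iA|case: iB].
exists (x / y); first by rewrite mulf_neq0 ?invr_eq0.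
rewrite {1}EA EB Er; apply/seteqP; split=> [_ [z Iz <-]|_ [_ [z Iz <-] <-]].
  by exists (y * z); [exists z|rewrite mulrA divfK].
by exists z => //; rewrite mulrA divfK.
Qed.

(** If A^j = x A^i with i < j, then E = x^-1 A^(j-i) satisfies E A^i = A^i.  The
    determinant trick shows first that E consists of integers, then that it
    contains 1; so x^-1 A^(j-i-1) is an inverse of A. *)
Lemma ideal_mulV A : frac_ideal A -> ideal_mul A (ideal_inv A) = O.
Proof.
move=> fA; apply/seteqP; split; first exact: mul_inv_sub_int_ring.
pose pw i := iter i (ideal_mul A) O.
have fpw i : frac_ideal (pw i).
  by elim: i => [|i IH]; [exact: frac_int_ring|exact: frac_mul].
have pwD i j : pw (i + j)%N = ideal_mul (pw i) (pw j).
  by elim: i => [|i IH]; [rewrite ideal_mul1r|rewrite addSn /= -/(pw _) IH ideal_mulA].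
have [T [c hc]] := class_code.
have [i [j [/andP[ij _] cij]]] := pigeonhole (fun i => c (pw i)).
have [x x0 Ex] := hc _ _ (fpw j) (fpw i) (esym cij).
pose k := (j - i).-1.
have Ej : j = (k.+1 + i)%N by rewrite /k prednK ?subn_gt0 // subnK // ltnW.
pose E := set_scale x^-1 (pw k.+1).
have fE : frac_ideal E by apply: frac_scale; rewrite ?invr_eq0.
have ED : ideal_mul E (pw i) = pw i.
  rewrite /E set_scaleE // -ideal_mulA -pwD -Ej Ex -set_scaleE; last exact: frac_scale.
  apply/seteqP; split=> [_ [_ [z Iz <-] <-]|z Iz]; first by rewrite mulKf.
  by exists (x * z); [exists z|rewrite mulKf].
have EO : E `<=` O.
  move=> e Ee; apply: (stable_integral (fpw i)) => y Dy.
  by rewrite -ED; apply: ideal_mul_mem.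
have E1 : E 1.
  apply: (nakayama (fpw i)); rewrite ?ED //; first exact: fracI0.
  - by move=> y z; apply: fracID.
  - by move=> r y; apply: fracIM.
suff h1 : ideal_mul A (ideal_inv A) 1.
  by move=> y Oy; rewrite -[y]mulr1; apply: fracIM => //; apply: frac_mul => //;
    exact: frac_inv.
move: E1; rewrite /E set_scaleE // /= ideal_mulC -/(pw _) -ideal_mulA.
apply: ideal_mulS => // y; rewrite ideal_mulC -set_scaleE // => hy _ [z Az <-].
by apply: EO; rewrite /E set_scaleE // ideal_mulC /= -/(pw k) -ideal_mulA [z]lock mulrC -lock;
   apply: ideal_mul_mem => //; rewrite ideal_mulC -set_scaleE.
Qed.
End ClassNumber.

(** * Multiplicative congruences and narrow ray classes *)

Create HintDb frac_ideal.
#[export] Hint Resolve frac_mul frac_inv frac_int_ring frac_scale frac_principal : frac_ideal.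
Ltac solve_frac := by eauto 20 with frac_ideal.

Section IdealGroup.
Variable F : fieldExtType rat.
Local Notation O := (int_ring F).
Implicit Types (I J K L M N A B D E : set F) (x y z r : F).

Lemma ideal_Vmul I : frac_ideal I -> ideal_mul (ideal_inv I) I = O.
Proof. by move=> fI; rewrite ideal_mulC ideal_mulV. Qed.

Lemma ideal_mulK I J : frac_ideal I -> frac_ideal J ->
  ideal_mul (ideal_mul J I) (ideal_inv I) = J.
Proof. by move=> fI fJ; rewrite -ideal_mulA ideal_mulV // ideal_mulr1. Qed.
Lemma ideal_mulVK I J : frac_ideal I -> frac_ideal J ->
  ideal_mul (ideal_mul J (ideal_inv I)) I = J.
Proof. by move=> fI fJ; rewrite -ideal_mulA ideal_Vmul // ideal_mulr1. Qed.

Lemma ideal_inv_unique I J : frac_ideal I -> frac_ideal J -> ideal_mul I J = O ->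
  J = ideal_inv I.
Proof. by move=> fI fJ IJ;
  rewrite -[J](ideal_mulK fI) // [ideal_mul J I]ideal_mulC IJ ideal_mul1r //; solve_frac. Qed.
Lemma ideal_invK I : frac_ideal I -> ideal_inv (ideal_inv I) = I.
Proof. by move=> fI; apply/esym/ideal_inv_unique; rewrite ?ideal_Vmul //; solve_frac. Qed.
Lemma ideal_invM I J : frac_ideal I -> frac_ideal J ->
  ideal_inv (ideal_mul I J) = ideal_mul (ideal_inv I) (ideal_inv J).
Proof.
move=> fI fJ; apply/esym/ideal_inv_unique; try solve_frac.
by rewrite ideal_mulACA !ideal_mulV // ideal_mulr1 //; solve_frac.
Qed.
Lemma ideal_inv_principal x : x != 0 -> ideal_inv (principal x) = principal x^-1.
Proof.
move=> x0; apply/esym/ideal_inv_unique; rewrite ?principalM ?divff ?principal1 //.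
- solve_frac.
- by apply: frac_principal; rewrite invr_eq0.
Qed.
Lemma ideal_inv_int_ring : ideal_inv O = O.
Proof. by apply/esym/ideal_inv_unique; rewrite ?ideal_mulr1; try solve_frac. Qed.

Lemma set_scaleA x y I : set_scale x (set_scale y I) = set_scale (x * y) I.
Proof.
apply/seteqP; split=> [_ [_ [z Iz <-] <-]|_ [z Iz <-]]; first by exists z; rewrite ?mulrA.
by exists (y * z); [exists z|rewrite mulrA].
Qed.
Lemma set_scale1 I : set_scale 1 I = I.
Proof.
by apply/seteqP; split=> [_ [z Iz <-]|z Iz]; rewrite ?mul1r //; exists z; rewrite ?mul1r.
Qed.
Lemma ideal_mul_scalel x I J : frac_ideal I -> frac_ideal J ->
  ideal_mul (set_scale x I) J = set_scale x (ideal_mul I J).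
Proof. by move=> fI fJ; rewrite !set_scaleE ?ideal_mulA //; solve_frac. Qed.
Lemma ideal_mul_scaler x I J : frac_ideal I -> frac_ideal J ->
  ideal_mul I (set_scale x J) = set_scale x (ideal_mul I J).
Proof. by move=> fI fJ; rewrite ideal_mulC ideal_mul_scalel // ideal_mulC. Qed.
Lemma ideal_inv_scale x I : x != 0 -> frac_ideal I ->
  ideal_inv (set_scale x I) = set_scale x^-1 (ideal_inv I).
Proof. by move=> x0 fI; rewrite !set_scaleE ?ideal_invM ?ideal_inv_principal //;
  solve_frac. Qed.

Lemma int_ideal_frac M : int_ideal M -> frac_ideal M. Proof. by case. Qed.
Lemma int_ideal_sub M : int_ideal M -> M `<=` O. Proof. by case. Qed.
Hint Resolve int_ideal_frac : frac_ideal.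

Lemma ideal_coprime_intro I J : I `<=` O -> J `<=` O ->
  (forall r x, O r -> I x -> I (r * x)) -> (forall r x, O r -> J x -> J (r * x)) ->
  (exists2 x, I x & J (1 - x)) -> ideal_coprime I J.
Proof.
move=> IO JO IM JM [x Ix Jx]; apply/seteqP; split=> [_ [u Iu [v Jv <-]]|y Oy].
  by apply: int_ringD; auto.
exists (y * x); first exact: IM.
by exists (y * (1 - x)); [exact: JM|ring].
Qed.
Lemma ideal_coprime_elim I J : ideal_coprime I J -> exists2 x, I x & J (1 - x).
Proof.
move=> IJ; have : set_add I J 1 by rewrite IJ; exact: int_ring1.
by move=> [x Ix [y Jy <-]]; exists x; rewrite // addrAC subrr add0r.
Qed.
Lemma ideal_coprimeP I J : int_ideal I -> int_ideal J ->
  ideal_coprime I J <-> exists2 x, I x & J (1 - x).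
Proof.
move=> [fI IO] [fJ JO]; split; first exact: ideal_coprime_elim.
by apply: ideal_coprime_intro => // *; apply: fracIM.
Qed.
(** Coprimality of xR with M is invertibility of x modulo M; this elementwise form
    is used throughout. *)
Lemma ideal_coprime_principalP M x : int_ideal M -> O x ->
  ideal_coprime (principal x) M <-> exists2 y, O y & M (1 - x * y).
Proof.
move=> [fM MO] Ox; split=> [/ideal_coprime_elim[_ [y Oy <-] My]|[y Oy My]]; first by exists y.
apply: ideal_coprime_intro => //.
- by move=> _ [z Oz <-]; apply: int_ringM.
- by move=> r _ Or [z Oz <-]; exists (r * z); [exact: int_ringM|rewrite mulrCA].
- by move=> *; apply: fracIM.
by exists (x * y) => //; exists y.
Qed.
Lemma int_ideal_mul I J : int_ideal I -> int_ideal J -> int_ideal (ideal_mul I J).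
Proof.
move=> [fI IO] [fJ JO]; split; first solve_frac.
by apply: ideal_mul_sub_frac => [|x y Ix Jy]; [solve_frac|apply: int_ringM; auto].
Qed.
Lemma int_ideal_mul_subl I J : int_ideal I -> int_ideal J -> ideal_mul I J `<=` I.
Proof. by move=> [fI IO] [fJ JO]; apply: ideal_mul_sub_frac => // x y Ix Jy; apply: fracIMr;
  auto. Qed.
Lemma int_ideal_mul_subr I J : int_ideal I -> int_ideal J -> ideal_mul I J `<=` J.
Proof. by move=> iI iJ; rewrite ideal_mulC; apply: int_ideal_mul_subl. Qed.
Lemma int_ideal_int_ring : int_ideal O. Proof. by split; [solve_frac|]. Qed.

Lemma ideal_coprimeM I J M : int_ideal I -> int_ideal J -> int_ideal M ->
  ideal_coprime I M -> ideal_coprime J M -> ideal_coprime (ideal_mul I J) M.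
Proof.
move=> iI iJ iM /(ideal_coprimeP iI iM)[x Ix Mx] /(ideal_coprimeP iJ iM)[y Jy My].
apply/ideal_coprimeP => //; first exact: int_ideal_mul.
exists (x * y); first exact: ideal_mul_mem.
have -> : 1 - x * y = (1 - x) + x * (1 - y) by ring.
case: iM iI => fM MO [fI IO].
by apply: fracID => //; apply: fracIM => //; exact: IO.
Qed.

Lemma mult_congr1_intro M a b : int_ideal M -> a != 0 -> b != 0 -> O a -> O b ->
  (exists2 y, O y & M (1 - b * y)) -> M (a - b) -> mult_congr1 M (a / b).
Proof.
move=> iM a0 b0 Oa Ob [y Oy My] Mab; exists a, b; split=> //.
split; apply/ideal_coprime_principalP => //; last by exists y.
exists y => //; have -> : 1 - a * y = (1 - b * y) - (a - b) * y by ring.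
by case: iM => fM _; apply: fracIB => //; apply: fracIMr.
Qed.
(** The numerator and the denominator are congruent modulo M, so that they have a
    common inverse y. *)
Lemma mult_congr1_elim M x : int_ideal M -> mult_congr1 M x ->
  exists a b, [/\ a != 0, b != 0, O a /\ O b, M (a - b) & x = a / b /\
                exists y, [/\ O y, M (1 - a * y) & M (1 - b * y)]].
Proof.
move=> iM [a [b [[Oa Ob] [a0 b0] [_ /(ideal_coprime_principalP iM Ob)[y Oy My]] Mab ->]]].
exists a, b; split=> //; split=> //; exists y; split=> //.
have -> : 1 - a * y = (1 - b * y) - (a - b) * y by ring.
by case: iM => fM _; apply: fracIB => //; apply: fracIMr.
Qed.
Lemma mult_congr1_neq0 M x : mult_congr1 M x -> x != 0.
Proof. by move=> [a [b [_ [a0 b0] _ _ ->]]]; rewrite mulf_neq0 ?invr_eq0. Qed.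
Lemma mult_congr1_int M x : int_ideal M -> O x -> x != 0 -> M (x - 1) -> mult_congr1 M x.
Proof.
move=> iM Ox x0 Mx; rewrite -[x]divr1; apply: mult_congr1_intro; rewrite ?oner_neq0 //;
  first exact: int_ring1.
by exists 1; rewrite ?mulr1 ?subrr; [exact: int_ring1|apply: fracI0; case: iM].
Qed.
Lemma mult_congr1_1 M : int_ideal M -> mult_congr1 M 1.
Proof.
move=> iM; apply: mult_congr1_int; rewrite ?oner_neq0 ?subrr //; first exact: int_ring1.
by apply: fracI0; case: iM.
Qed.
Lemma mult_congr1M M x y : int_ideal M -> mult_congr1 M x -> mult_congr1 M y ->
  mult_congr1 M (x * y).
Proof.
move=> iM /(mult_congr1_elim iM)[a [b [a0 b0 [Oa Ob] Mab [-> [u [Ou Mau Mbu]]]]]].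
move=> /(mult_congr1_elim iM)[c [d [c0 d0 [Oc Od] Mcd [-> [v [Ov Mcv Mdv]]]]]].
rewrite mulf_div; have fM := int_ideal_frac iM.
apply: mult_congr1_intro; rewrite ?mulf_neq0 //; try exact: int_ringM.
  exists (u * v); first exact: int_ringM.
  have -> : 1 - b * d * (u * v) = (1 - b * u) + b * u * (1 - d * v) by ring.
  by apply: fracID => //; apply: fracIM => //; apply: int_ringM.
have -> : a * c - b * d = (a - b) * c + b * (c - d) by ring.
by apply: fracID => //; [apply: fracIMr|apply: fracIM].
Qed.
Lemma mult_congr1V M x : int_ideal M -> mult_congr1 M x -> mult_congr1 M x^-1.
Proof.
move=> iM /(mult_congr1_elim iM)[a [b [a0 b0 [Oa Ob] Mab [-> [u [Ou Mau Mbu]]]]]].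
rewrite invf_div; apply: mult_congr1_intro => //; first by exists u.
by rewrite -opprB; apply: fracIN => //; case: iM.
Qed.
Lemma mult_congr1S M N x : int_ideal M -> int_ideal N -> N `<=` M -> mult_congr1 N x ->
  mult_congr1 M x.
Proof.
move=> iM iN NM /(mult_congr1_elim iN)[a [b [a0 b0 [Oa Ob] Mab [-> [u [Ou Mau Mbu]]]]]].
by apply: mult_congr1_intro; auto; exists u; auto.
Qed.

(** The principal ideals of these elements form the trivial narrow ray class. *)
Definition narrow1 M x := totally_positive x /\ mult_congr1 M x.

Lemma narrow1_1 M : int_ideal M -> narrow1 M 1.
Proof. by move=> iM; split; [exact: totally_positive1|exact: mult_congr1_1]. Qed.
Lemma narrow1M M x y : int_ideal M -> narrow1 M x -> narrow1 M y -> narrow1 M (x * y).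
Proof. by move=> iM [px mx] [py my]; split; [exact: totally_positiveM|exact: mult_congr1M]. Qed.
Lemma narrow1V M x : int_ideal M -> narrow1 M x -> narrow1 M x^-1.
Proof. by move=> iM [px mx]; split; [exact: totally_positiveV|exact: mult_congr1V]. Qed.
Lemma narrow1_neq0 M x : narrow1 M x -> x != 0.
Proof. by case=> _; exact: mult_congr1_neq0. Qed.
Lemma narrow1S M N x : int_ideal M -> int_ideal N -> N `<=` M -> narrow1 N x -> narrow1 M x.
Proof. by move=> iM iN NM []; split=> //; apply: mult_congr1S NM _. Qed.

Lemma ray_classP M I D : frac_ideal I ->
  narrow_ray_class M I D <-> exists2 x, narrow1 M x & D = set_scale x I.
Proof.
move=> fI; split=> [[_ [x nx <-] <-]|[x nx ->]].
  by exists x; rewrite // set_scaleE // ideal_mulC.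
by exists (principal x); [exists x|rewrite set_scaleE // ideal_mulC].
Qed.

Lemma ray_class_id M I : int_ideal M -> frac_ideal I -> narrow_ray_class M I I.
Proof. by move=> iM fI; apply/ray_classP => //; exists 1; rewrite ?set_scale1 //;
  exact: narrow1_1. Qed.

Lemma ray_class_eqP M I J : int_ideal M -> frac_ideal I -> frac_ideal J ->
  narrow_ray_class M I = narrow_ray_class M J <-> exists2 x, narrow1 M x & I = set_scale x J.
Proof.
move=> iM fI fJ; split=> [E|[x nx ->]].
  by apply/ray_classP => //; rewrite -E; exact: ray_class_id.
have x0 := narrow1_neq0 nx.
apply/seteqP; split=> D /ray_classP[|y ny ->]; try solve_frac.
  by rewrite set_scaleA; apply/ray_classP => //; exists (y * x) => //; exact: narrow1M.
apply/ray_classP; first solve_frac.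
by exists (y / x); [apply: narrow1M => //; exact: narrow1V|rewrite set_scaleA divfK].
Qed.

Lemma class_mulE M I J : int_ideal M -> frac_ideal I -> frac_ideal J ->
  class_mul (narrow_ray_class M I) (narrow_ray_class M J) = narrow_ray_class M (ideal_mul I J).
Proof.
move=> iM fI fJ; apply/seteqP; split=> D.
  move=> [_ /ray_classP[//|x nx ->] [_ /ray_classP[//|y ny ->] <-]].
  have x0 := narrow1_neq0 nx; have y0 := narrow1_neq0 ny.
  apply/ray_classP; first solve_frac; exists (x * y); first exact: narrow1M.
  by rewrite ideal_mul_scalel ?ideal_mul_scaler ?set_scaleA //; solve_frac.
move=> /ray_classP[|x nx ->]; first solve_frac.
have x0 := narrow1_neq0 nx.
exists (set_scale x I); first by apply/ray_classP => //; exists x.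
by exists J; [exact: ray_class_id|rewrite ideal_mul_scalel].
Qed.

Lemma class_invE M I : int_ideal M -> frac_ideal I ->
  class_inv (narrow_ray_class M I) = narrow_ray_class M (ideal_inv I).
Proof.
move=> iM fI; apply/seteqP; split=> D.
  move=> [_ /ray_classP[//|x nx ->] <-]; have x0 := narrow1_neq0 nx.
  apply/ray_classP; first solve_frac; exists x^-1; first exact: narrow1V.
  by rewrite ideal_inv_scale.
move=> /ray_classP[|x nx ->]; first solve_frac.
have x0 := narrow1_neq0 nx.
exists (set_scale x^-1 I).
  by apply/ray_classP => //; exists x^-1 => //; exact: narrow1V.
by rewrite ideal_inv_scale ?invrK // invr_eq0.
Qed.

Lemma narrow_principalE M : narrow_principal M = narrow_ray_class M O.
Proof.
apply/seteqP; split=> D; first by move=> [x nx <-]; apply/ray_classP; [solve_frac|exists x].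
by move=> /ray_classP[|x nx ->]; [solve_frac|exists x].
Qed.
End IdealGroup.
#[export] Hint Resolve int_ideal_frac : frac_ideal.

(** * Finiteness of ray class groups and the quotients Q_i *)

Section QGroup.
Variable F : fieldExtType rat.
Hypothesis hF : totally_real F.
Local Notation O := (int_ring F).
Implicit Types (I J K L M N A B D E : set F) (x y z r : F).

(** Let m be a positive integer in u N.  Adding to a a large multiple of m u^-1,
    which lies in N, makes the product with u positive at all real places. *)
Lemma sign_lift N u a : frac_ideal N -> u != 0 ->
  exists2 x, N (x - a) & totally_positive (x * u).
Proof.
move=> fN u0; have [m m0 /set_scaleP-/(_ u0) Nm] := frac_nat_mem (frac_scale u0 fN).
have [k hk] := totally_positive_shift hF (a * u) m0.
exists (a + k%:R * (m%:R / u)); first by rewrite addrAC subrr add0r; apply: fracIM => //;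
  exact: int_ring_nat.
by rewrite mulrDl -mulrA divfK // -natrM.
Qed.

Lemma positive_lift N a : frac_ideal N -> exists2 x, N (x - a) & totally_positive x.
Proof.
move=> fN; have [x Nx px] := sign_lift a fN (oner_neq0 F).
by exists x => //; rewrite -[x]mulr1.
Qed.

Lemma int_ideal_scale_inv K a : frac_ideal K -> a != 0 -> K a ->
  int_ideal (set_scale a (ideal_inv K)).
Proof.
move=> fK a0 Ka; split; first solve_frac.
by move=> _ [y hy <-]; rewrite mulrC; apply: ideal_inv_mem hy Ka.
Qed.

Lemma prime_to_int M I : int_ideal M -> int_ideal I -> ideal_coprime I M -> ideals_prime_to M I.
Proof.
move=> iM iI cI; exists I, O; split=> //; first by split=> //; exact: int_ideal_int_ring.
  apply/ideal_coprimeP => //; first exact: int_ideal_int_ring.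
  by exists 1; [exact: int_ring1|rewrite subrr; apply: fracI0; solve_frac].
by rewrite ideal_inv_int_ring ideal_mulr1 //; solve_frac.
Qed.

(** For I = J K^-1 multiply by a totally positive k = 1 mod M lying in K: the ideal
    k K^-1 is integral, and contains k, so it is coprime to M. *)
Lemma integral_rep M I : int_ideal M -> ideals_prime_to M I -> exists J,
  [/\ int_ideal J, ideal_coprime J M & narrow_ray_class M I = narrow_ray_class M J].
Proof.
move=> iM [J [K [[iJ iK] cJ cK ->]]].
have [k Kk Mk] := ideal_coprime_elim cK.
have iKM := int_ideal_mul iK iM.
have [x KMx px] := positive_lift k (int_ideal_frac iKM).
have x0 := totally_positive_neq0 px.
have Kx : K x by rewrite -(subrK k x); apply: fracID => //;
  [solve_frac|exact: (int_ideal_mul_subl iK iM)].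
have Mx : M (x - 1).
  have -> : x - 1 = (x - k) - (1 - k) by ring.
  by apply: fracIB => //; [solve_frac|exact: (int_ideal_mul_subr iK iM)].
have iX := int_ideal_scale_inv (int_ideal_frac iK) x0 Kx.
have cX : ideal_coprime (set_scale x (ideal_inv K)) M.
  apply/ideal_coprimeP => //; exists x; last by rewrite -opprB; apply: fracIN => //; solve_frac.
  by exists 1; rewrite ?mulr1 // => _ [y Ky <-]; rewrite mul1r; exact: (int_ideal_sub iK).
exists (ideal_mul J (set_scale x (ideal_inv K))); split.
- exact: int_ideal_mul.
- exact: ideal_coprimeM.
apply/ray_class_eqP => //; [solve_frac|solve_frac|].
have nx : narrow1 M x by split=> //; apply: mult_congr1_int => //; exact: (int_ideal_sub iK).
exists x^-1; first exact: narrow1V.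
by rewrite ideal_mul_scaler ?set_scaleA ?mulVf ?set_scale1 //; solve_frac.
Qed.

Lemma finite_image_code (X Y : Type) (A : set X) (g : X -> Y) (T : finType) (c : X -> T) :
  (forall a b : X, A a -> A b -> c a = c b -> g a = g b) -> finite_set (g @` A).
Proof.
move=> h; case: (pselect (exists a, A a)) => [[a Aa]|nA]; last first.
  by apply: (sub_finite_set _ (finite_set0 Y)) => q [a Aa _]; apply: nA; exists a.
have hr t : exists b : X, A b /\ forall y : X, A y -> c y = t -> c b = t.
  case: (pselect (exists2 b : X, A b & c b = t)) => [[x Ax cx]|hn]; first by exists x.
  by exists a; split=> // y Ay cy; case: hn; exists y.
have [r rP] := boolp.choice hr.
apply: (@sub_finite_set _ _ ((g \o r) @` [set: T])); last exact/finite_image/finite_finset.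
move=> q [x Ax <-]; exists (c x) => //.
by apply: h => //; have [Ar cr] := rP (c x) => //; exact: (cr x).
Qed.

(** The denominator v is taken in B, with v = 1 mod M.  Then u = x v is in A, and uR
    is the product of A and v B^-1, both coprime to M. *)
Lemma ratio_units M A B x : int_ideal M -> int_ideal A -> int_ideal B ->
  ideal_coprime A M -> ideal_coprime B M -> x != 0 -> A = set_scale x B ->
  exists u v, [/\ x = u / v, u != 0 /\ v != 0, O u /\ O v, M (v - 1) &
    exists2 y, O y & M (1 - u * y)].
Proof.
move=> iM iA iB cA cB x0 EA; have [b Bb Mb] := ideal_coprime_elim cB.
have iBM := int_ideal_mul iB iM.
have [v BMv /totally_positive_neq0 v0] := positive_lift b (int_ideal_frac iBM).
have Bv : B v by rewrite -(subrK b v); apply: fracID => //;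
  [solve_frac|exact: (int_ideal_mul_subl iB iM)].
have Mv : M (v - 1).
  have -> : v - 1 = (v - b) - (1 - b) by ring.
  by apply: fracIB => //; [solve_frac|exact: (int_ideal_mul_subr iB iM)].
have Ov := int_ideal_sub iB Bv.
have Oxv : O (x * v) by apply: (int_ideal_sub iA); rewrite EA; exists v.
exists (x * v), v; split=> //; rewrite ?mulfK ?mulf_neq0 //.
apply/ideal_coprime_principalP => //.
have iX := int_ideal_scale_inv (int_ideal_frac iB) v0 Bv.
have cX : ideal_coprime (set_scale v (ideal_inv B)) M.
  apply/ideal_coprimeP => //; exists v; last by rewrite -opprB; apply: fracIN => //; solve_frac.
  by exists 1; rewrite ?mulr1 // => _ [y By <-]; rewrite mul1r; exact: (int_ideal_sub iB).
have -> : principal (x * v) = ideal_mul A (set_scale v (ideal_inv B)).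
  by rewrite EA ideal_mul_scalel ?ideal_mul_scaler ?set_scaleA ?ideal_mulV //; solve_frac.
exact: ideal_coprimeM.
Qed.

(** Each ideal A is compared with a fixed ideal of its ordinary class which is
    coprime to M.  The ratio is u/v with v = 1 mod M, and the ray class of A is
    determined by the ordinary class, the signs of the ratio, and u mod M. *)
Lemma finite_ray_class_group M : int_ideal M -> finite_set (narrow_ray_class_group M).
Proof.
move=> iM; pose P I := int_ideal I /\ ideal_coprime I M.
suff h : finite_set (narrow_ray_class M @` [set I | P I]).
  apply: (sub_finite_set _ h) => _ [I /(integral_rep iM)[J [iJ cJ EJ]] <-].
  by exists J.
have [T1 [c1 h1]] := class_code F.
have [T2 [c2 h2]] := sign_code hF.
have [T3 [c3 h3]] := finite_quotient (frac_int_ring F) (int_ideal_frac iM).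
have hr t : exists A, forall B, P B -> c1 B = t -> P A /\ c1 A = t.
  case: (pselect (exists2 A, P A & c1 A = t)) => [[A PA cA]|hn]; first by exists A.
  by exists O => B PB cB; case: hn; exists B.
have [r rP] := boolp.choice hr.
have hd A : exists xu : F * F, P A -> [/\ xu.1 != 0, A = set_scale xu.1 (r (c1 A)) &
    exists v, [/\ xu.1 = xu.2 / v, xu.2 != 0 /\ v != 0, O xu.2 /\ O v, M (v - 1) &
    exists2 y, O y & M (1 - xu.2 * y)]].
  case: (pselect (P A)) => PA; last by exists (0, 0).
  have [PB cB] := rP _ _ PA erefl; have [iA cA] := PA; have [iB cB'] := PB.
  have [x x0 Ex] := h1 _ _ (int_ideal_frac iA) (int_ideal_frac iB) (esym cB).
  have [u [v huv]] := ratio_units iM iA iB cA cB' x0 Ex.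
  by exists (x, u) => _; split=> //; exists v.
have [d dP] := boolp.choice hd.
apply: (finite_image_code (c := fun A => (c1 A, c2 (d A).1, c3 (d A).2))) => A B PA PB.
have [x0 EA [v [Exv [u0 v0] [Ou Ov] Mv [y Oy My]]]] := dP A PA.
have [x'0 EB [v' [Exv' [u'0 v'0] [Ou' Ov'] Mv' [y' Oy' My']]]] := dP B PB.
move=> [Ec1 /(h2 _ _ x0 x'0) px /(h3 _ _ Ou Ou') Muu].
have [[iA _] [iB _]] := (PA, PB).
apply/ray_class_eqP => //; [solve_frac|solve_frac|].
exists ((d A).1 / (d B).1); last by rewrite {1}EA {2}EB Ec1 set_scaleA divfK.
split=> //; have -> : (d A).1 / (d B).1 = ((d A).2 * v') / (v * (d B).2).
  by rewrite Exv Exv'; field; rewrite v0 v'0 u'0.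
have fM := int_ideal_frac iM.
apply: mult_congr1_intro; rewrite ?mulf_neq0 //; try exact: int_ringM.
  exists y' => //; have -> :
    1 - v * (d B).2 * y' = (1 - (d B).2 * y') - (v - 1) * ((d B).2 * y') by ring.
  by apply: fracIB => //; apply: fracIMr => //; exact: int_ringM.
have -> : (d A).2 * v' - v * (d B).2 =
  (d A).2 * (v' - 1) + ((d A).2 - (d B).2) - (v - 1) * (d B).2 by ring.
by apply: fracIB => //; [apply: fracID => //; apply: fracIM|apply: fracIMr].
Qed.

Lemma Q_condition_unit i N x : int_ideal N -> O x -> Q_condition i N x ->
  exists2 y, O y & N (1 - x * y).
Proof.
move=> iN Ox; rewrite /Q_condition; case: ifP => _;
  first by move/(ideal_coprime_principalP iN Ox).
by move=> Nx; exists 1; [exact: int_ring1|rewrite mulr1 -opprB; apply: fracIN => //;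
  solve_frac].
Qed.
Lemma Q_condition1 i N : int_ideal N -> Q_condition i N 1.
Proof.
move=> iN; rewrite /Q_condition; case: ifP => _; last by rewrite subrr; apply: fracI0;
  solve_frac.
apply/ideal_coprime_principalP => //; first exact: int_ring1.
by exists 1; [exact: int_ring1|rewrite mulr1 subrr; apply: fracI0; solve_frac].
Qed.
Lemma Q_conditionM i N x y : int_ideal N -> O x -> O y ->
  Q_condition i N x -> Q_condition i N y -> Q_condition i N (x * y).
Proof.
move=> iN Ox Oy; have fN := int_ideal_frac iN; rewrite /Q_condition; case: ifP => _.
  move=> /(ideal_coprime_principalP iN Ox)[u Ou Nu] /(ideal_coprime_principalP iN Oy)[v Ov Nv].
  apply/ideal_coprime_principalP => //; first exact: int_ringM.
  exists (u * v); first exact: int_ringM.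
  have -> : 1 - x * y * (u * v) = (1 - x * u) + x * u * (1 - y * v) by ring.
  by apply: fracID => //; apply: fracIM => //; apply: int_ringM.
move=> Nx Ny; have -> : x * y - 1 = (x - 1) * y + (y - 1) by ring.
by apply: fracID => //; apply: fracIMr.
Qed.
Lemma Q_conditionV i N x y : int_ideal N -> O x -> O y -> N (1 - x * y) ->
  Q_condition i N x -> Q_condition i N y.
Proof.
move=> iN Ox Oy Nxy; have fN := int_ideal_frac iN; rewrite /Q_condition; case: ifP => _ h.
  by apply/ideal_coprime_principalP => //; exists x => //; rewrite mulrC.
have -> : y - 1 = - (1 - x * y) - (x - 1) * y by ring.
by apply: fracIB => //; [exact: fracIN|exact: fracIMr].
Qed.
(** The inverse of the relation of x is the relation of any y inverse to x modulo N
    with the same signs as x, because xy then has trivial narrow ray class. *)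
Lemma Q_condition_inverse i N x : int_ideal N -> O x -> x != 0 -> Q_condition i N x ->
  exists y, [/\ O y, y != 0, Q_condition i N y, N (1 - x * y) & totally_positive (x * y)].
Proof.
move=> iN Ox x0 Qx; have [y0 Oy0 Ny0] := Q_condition_unit iN Ox Qx.
have [y Ny py] := sign_lift y0 (int_ideal_frac iN) x0.
have fN := int_ideal_frac iN.
have Oy : O y by rewrite -(subrK y0 y); apply: int_ringD => //; exact: (int_ideal_sub iN).
have Nxy : N (1 - x * y).
  have -> : 1 - x * y = (1 - x * y0) - x * (y - y0) by ring.
  by apply: fracIB => //; apply: fracIM.
exists y; split=> //; last by rewrite mulrC.
  by move/totally_positive_neq0: py; rewrite mulf_eq0 negb_or => /andP[].
exact: Q_conditionV Qx.
Qed.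

Section Level.
Variables (i : 'I_2) (M N : set F).
Hypotheses (iM : int_ideal M) (iN : int_ideal N) (MN : ideal_dvd M N).
Local Notation L := (ideal_div N M).

Lemma dvd_quotient : int_ideal L /\ ideal_mul L M = N.
Proof.
have [_ [J iJ ->]] := MN; rewrite /ideal_div [ideal_mul M J]ideal_mulC ideal_mulK; solve_frac.
Qed.
Let iL : int_ideal L := dvd_quotient.1.
Let LM : ideal_mul L M = N := dvd_quotient.2.

Lemma dvd_sub : N `<=` M. Proof. by rewrite -LM; apply: int_ideal_mul_subr. Qed.
Lemma dvd_quotient_sub : N `<=` L. Proof. by rewrite -{1}LM; apply: int_ideal_mul_subl. Qed.

(** Two pairs of ideals with the same class in Q_i(M, N): they differ by the
    relation of x, up to narrowly principal ideals. *)
Definition Q_equiv I J I' J' := exists x z w, [/\ O x /\ x != 0, Q_condition i N x,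
  narrow1 M z /\ narrow1 L w, I' = set_scale (x * z) I & J' = set_scale (x^-1 * w) J].

Lemma Q_equiv_sym I J I' J' : Q_equiv I J I' J' -> Q_equiv I' J' I J.
Proof.
move=> [x [z [w [[Ox x0] Qx [nz nw] -> ->]]]].
have [y [Oy y0 Qy Nxy pxy]] := Q_condition_inverse iN Ox x0 Qx.
have z0 := narrow1_neq0 nz; have w0 := narrow1_neq0 nw.
have nxy : narrow1 N (x * y).
  split=> //; apply: mult_congr1_int; rewrite ?mulf_neq0 //; first exact: int_ringM.
  by rewrite -opprB; apply: fracIN => //; solve_frac.
exists y, (x * y * z)^-1, (x * y * w^-1); split=> //.
- split.
    by apply: narrow1V => //; apply: narrow1M => //; apply: narrow1S nxy => //; exact: dvd_sub.
  apply: narrow1M => //; first by apply: narrow1S nxy => //; exact: dvd_quotient_sub.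
  exact: narrow1V.
- rewrite set_scaleA [X in set_scale X _](_ : _ = 1) ?set_scale1 //.
  by field; rewrite x0 y0 z0.
rewrite set_scaleA [X in set_scale X _](_ : _ = 1) ?set_scale1 //.
by field; rewrite x0 y0 w0.
Qed.

Local Notation H := (subgroup_gen (@class_pair_mul F)
       (narrow_principal M, narrow_principal L)
       (@class_pair_inv F) (Q_relations i M N)).

(** The relations are closed under products and inverses, hence already form the
    subgroup which they generate. *)
Lemma subgroup_genE : H = Q_relations i M N.
Proof.
apply/seteqP; split=> [p h|p Sp H' _ _ _]; last by apply.
apply: h => //.
- exists 1; last by rewrite invr1 principal1 !narrow_principalE.
  by split; [exact: int_ring1|exact: oner_neq0|exact: Q_condition1].
- move=> _ _ [x [Ox x0 Qx] <-] [y [Oy y0 Qy] <-].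
  exists (x * y); first by split; [exact: int_ringM|exact: mulf_neq0|exact: Q_conditionM].
  rewrite /class_pair_mul /= !class_mulE //; try by apply: frac_principal; rewrite ?invr_eq0.
  by rewrite !principalM invfM.
move=> _ [x [Ox x0 Qx] <-]; have xV0 : x^-1 != 0 by rewrite invr_eq0.
have [y [Oy y0 Qy Nxy pxy]] := Q_condition_inverse iN Ox x0 Qx.
exists y => //; rewrite /class_pair_inv /= !class_invE //; try exact: frac_principal.
have yV0 : y^-1 != 0 by rewrite invr_eq0.
rewrite !ideal_inv_principal // invrK.
have nxy : narrow1 N (x * y).
  split=> //; apply: mult_congr1_int; rewrite ?mulf_neq0 //; first exact: int_ringM.
  by rewrite -opprB; apply: fracIN => //; solve_frac.
congr (_, _); apply/ray_class_eqP => //; try exact: frac_principal.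
  exists (x * y); first by apply: narrow1S nxy => //; exact: dvd_sub.
  by rewrite /principal set_scaleA mulrAC divff // mul1r.
exists (x * y)^-1.
  by apply: narrow1V => //; apply: narrow1S nxy => //; exact: dvd_quotient_sub.
by rewrite /principal set_scaleA invfM mulrAC mulVf // mul1r.
Qed.

Definition Q_class I J := coset_by (@class_pair_mul F) H (narrow_ray_class M I,
  narrow_ray_class L J).

Lemma mem_Q_class I J p : frac_ideal I -> frac_ideal J ->
  Q_class I J p <-> exists x, [/\ O x, x != 0, Q_condition i N x &
    p = (narrow_ray_class M (set_scale x I), narrow_ray_class L (set_scale x^-1 J))].
Proof.
move=> fI fJ; rewrite /Q_class /coset_by subgroup_genE; split.
  move=> [_ [x [Ox x0 Qx] <-] <-]; exists x; split=> //.
  rewrite /class_pair_mul /= !class_mulE //; try by apply: frac_principal; rewrite ?invr_eq0.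
  by rewrite !set_scaleE // [ideal_mul I _]ideal_mulC [ideal_mul J _]ideal_mulC.
move=> [x [Ox x0 Qx ->]].
exists (narrow_ray_class M (principal x), narrow_ray_class L (principal x^-1));
  first by exists x.
rewrite /class_pair_mul /= !class_mulE //; try by apply: frac_principal; rewrite ?invr_eq0.
by rewrite !set_scaleE // [ideal_mul I _]ideal_mulC [ideal_mul J _]ideal_mulC.
Qed.

Lemma Q_class_eqP I J I' J' : frac_ideal I -> frac_ideal J -> frac_ideal I' -> frac_ideal J' ->
  Q_class I J = Q_class I' J' <-> Q_equiv I J I' J'.
Proof.
move=> fI fJ fI' fJ'.
have frs x K : x != 0 -> frac_ideal K -> frac_ideal (set_scale x^-1 K).
  by move=> x0 fK; apply: frac_scale; rewrite ?invr_eq0.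
split.
  move=> E; have : Q_class I' J' (narrow_ray_class M I', narrow_ray_class L J').
    apply/mem_Q_class => //; exists 1; rewrite invr1 !set_scale1; split=> //.
    + exact: int_ring1. + exact: oner_neq0. + exact: Q_condition1.
  rewrite -E => /(mem_Q_class _ fI fJ)[x [Ox x0 Qx [/ray_class_eqP E1 /ray_class_eqP E2]]].
  have [z nz Ez] := E1 iM fI' (frac_scale x0 fI).
  have [w nw Ew] := E2 iL fJ' (frs _ _ x0 fJ).
  exists x, z, w; split=> //; first by rewrite Ez set_scaleA mulrC.
  by rewrite Ew set_scaleA mulrC.
have sub K1 K2 K1' K2' : frac_ideal K1 -> frac_ideal K2 -> frac_ideal K1' -> frac_ideal K2' ->
    Q_equiv K1 K2 K1' K2' -> Q_class K1' K2' `<=` Q_class K1 K2.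
  move=> f1 f2 f1' f2' [x [z [w [[Ox x0] Qx [nz nw] E1 E2]]]] p.
  move=> /(mem_Q_class _ f1' f2')[y [Oy y0 Qy ->]]; apply/mem_Q_class => //.
  have xy0 : x * y != 0 by rewrite mulf_neq0.
  exists (x * y); split=> //; [exact: int_ringM|exact: Q_conditionM|].
  congr (_, _); apply/ray_class_eqP => //; try by [apply: frac_scale|apply: frs].
    by exists z => //; rewrite E1 !set_scaleA; congr set_scale; ring.
  exists w => //; rewrite E2 !set_scaleA; congr set_scale; field.
  by rewrite x0 y0.
move=> h; apply/seteqP; split; last exact: sub.
by apply: sub => //; exact: Q_equiv_sym.
Qed.

Lemma Q_groupE : Q_group i M N =
  [set Q_class I J | I in ideals_prime_to M & J in ideals_prime_to L].
Proof.
apply/seteqP; split=> [_ [[C D] [/= [I hI <-] [J hJ <-]] <-]|_ [I hI [J hJ <-]]].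
  by exists I => //; exists J.
by exists (narrow_ray_class M I, narrow_ray_class L J) => //; split; [exists I|exists J].
Qed.

Lemma finite_Q_group : finite_set (Q_group i M N).
Proof.
apply: finite_image; apply: finite_setX; exact: finite_ray_class_group.
Qed.
End Level.
End QGroup.

(** * Generators of a fractional ideal modulo an ideal *)

Section Lifting.
Variable F : fieldExtType rat.
Local Notation O := (int_ring F).
Implicit Types (I J K L M N A B D E C S : set F) (x y z r : F).

Lemma ideal_mul_mem_eq I J K x y : I x -> J y -> ideal_mul I J = K -> K (x * y).
Proof. by move=> Ix Jy <-; apply: ideal_mul_mem. Qed.

Lemma mul_inv_mem M S x q : frac_ideal M -> frac_ideal S ->
  ideal_mul M S x -> ideal_inv S q -> M (x * q).
Proof. by move=> fM fS MSx Sq; apply: ideal_mul_mem_eq MSx Sq _; apply: ideal_mulK. Qed.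

Lemma int_ideal_mul_sub_frac M S : int_ideal M -> frac_ideal S -> ideal_mul M S `<=` S.
Proof. by move=> [fM MO] fS; apply: ideal_mul_sub_frac => // x y /MO Ox Sy; apply: fracIM. Qed.

Lemma mul_inv_int S x q : S x -> ideal_inv S q -> O (x * q).
Proof. by move=> Sx Sq; rewrite mulrC; apply: ideal_inv_mem Sq Sx. Qed.

(** The powers of x repeat modulo C; the exponent n+1 is a multiple of the period
    which lies beyond the start of the repetition. *)
Lemma power_idempotent C x : int_ideal C -> O x ->
  exists n, C (x ^+ n.+1 * x ^+ n.+1 - x ^+ n.+1).
Proof.
move=> iC Ox; have fC := int_ideal_frac iC.
have [T [f hf]] := finite_quotient (frac_int_ring F) fC.
have [i [j [/andP[ij _] fij]]] := pigeonhole (fun i => f (x ^+ i)).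
pose d := (j - i)%N; have d0 : (0 < d)%N by rewrite subn_gt0.
have Cd l : C (x ^+ (i + l + d) - x ^+ (i + l)).
  have -> : (i + l + d = j + l)%N by rewrite /d addnAC subnKC // ltnW.
  rewrite !exprD -mulrBl; apply: fracIMr => //; first exact: int_ringX.
  by apply: hf => //; exact: int_ringX.
have Cld k l : C (x ^+ (i + l + k * d) - x ^+ (i + l)).
  elim: k => [|k IH]; first by rewrite addn0 subrr; apply: fracI0.
  have -> : (i + l + k.+1 * d = i + (l + k * d) + d)%N by rewrite mulSn; ring.
  have := fracID fC (Cd (l + k * d)%N) IH; rewrite -[(i + l + k * d)%N]addnA addrA subrK.
  exact.
have iSd : (i < i.+1 * d)%N by rewrite leq_pmulr.
exists (i.+1 * d).-1; rewrite prednK ?muln_gt0 ?d0 // -exprD.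
by have := Cld i.+1 (i.+1 * d - i)%N; rewrite subnKC // ltnW.
Qed.

Lemma binomial_split x y m k : O x -> O y ->
  exists A B : F, [/\ O A, O B & (x + y) ^+ (m + k) = x ^+ m * A + y ^+ k * B].
Proof.
move=> Ox Oy; have Oxy := int_ringD Ox Oy.
elim: m k => [|m IHm] k.
  exists ((x + y) ^+ k), 0; split;
    [exact: int_ringX|exact: int_ring0|by rewrite mulr0 addr0 mul1r].
elim: k => [|k [A [B [OA OBc E]]]].
  exists 0, ((x + y) ^+ m.+1); split;
    [exact: int_ring0|exact: int_ringX|by rewrite mulr0 add0r mul1r addn0].
have [A' [B' [OA' OB' E']]] := IHm k.+1.
exists (A' + y * A), (x * B' + B); split.
- by apply: int_ringD => //; apply: int_ringM.
- by apply: int_ringD => //; apply: int_ringM.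
rewrite addSn exprS mulrDl {1}E' addnS -addSn E !exprS; ring.
Qed.

(** S/CS is a cyclic R/C-module.  Write 1 = sum u_i v_i with u_i in S, v_i in S^-1,
    and treat the terms one at a time.  The element w found so far generates S on
    the part of R/C cut out by an idempotent e = w V, and the partial sum y is
    nilpotent on the complement; the idempotent power f of x = u_i v_i cuts out a
    part on which u_i generates, so w becomes e w + (1 - e) f u_i.
    At the end y = 1 is nilpotent where e vanishes, that is e = 1. *)
Lemma locally_principal C S : int_ideal C -> frac_ideal S ->
  exists w V, [/\ S w, ideal_inv S V & C (1 - w * V)].
Proof.
move=> iC fS; have [fC CO] := iC.
have : ideal_mul S (ideal_inv S) 1 by rewrite ideal_mulV //; exact: int_ring1.
move=> [n [u [v [Su Sv E1]]]].
pose P y := O y /\ exists w V k, [/\ S w, ideal_inv S V,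
  C (w * V * (w * V) - w * V) & C (y ^+ k * (1 - w * V))].
have fSi : frac_ideal (ideal_inv S) by solve_frac.
suff : P 1.
  by move=> [_ [w [V [k [Sw SV _]]]]]; rewrite expr1n mul1r; exists w, V.
rewrite E1; elim/big_rec: _ => [|i y _ [Oy [w [V [k [Sw SV Ce Cy]]]]]].
  split; first exact: int_ring0; exists 0, 0, 1%N; rewrite !mul0r subrr.
  by split; apply: fracI0; solve_frac.
have Ox : O (u i * v i) by apply: (@mul_inv_int S).
split; first exact: int_ringD.
have [m Cf] := power_idempotent iC Ox.
set x := u i * v i in Ox Cf *; set f := x ^+ m.+1 in Cf.
have Of : O f by exact: int_ringX.
have Og : O (x ^+ m) by exact: int_ringX.
have Oe : O (w * V) by apply: (@mul_inv_int S).
set e := w * V in Ce Cy Oe.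
have O1e : O (1 - e) by apply: int_ringB => //; exact: int_ring1.
have [A [B [OA OB_ EAB]]] := binomial_split m.+1 k Ox Oy.
exists (e * w + (1 - e) * f * u i), (e * V + (1 - e) * f * x ^+ m * v i), (m.+1 + k)%N.
set W := _ + _; set VV := _ + _.
(* W VV is congruent to the idempotent e + (1 - e) f *)
have CE : C (W * VV - (e + (1 - e) * f)).
  have -> : W * VV - (e + (1 - e) * f) = (e * e - e) * (e + 1)
      - (e * e - e) * (w * f * x ^+ m * v i + f * u i * V)
      + (1 - e) * (f * f - f) * (f + 1) + (e * e - e) * (f * f * f).
    have Ef : f = x ^+ m * (u i * v i) by rewrite /f exprSr.
    rewrite /W /VV /e; move: Ef; rewrite /x; set g := _ ^+ m => ->.
    ring.
  have Owv : O (w * f * x ^+ m * v i).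
    have -> : w * f * x ^+ m * v i = w * v i * (f * x ^+ m) by ring.
    by apply: int_ringM; [exact: (@mul_inv_int S)|exact: int_ringM].
  have OuV : O (f * u i * V) by rewrite -mulrA; apply: int_ringM => //; exact: (@mul_inv_int S).
  apply: fracID => //; last by apply: fracIMr => //; do 2?[apply: int_ringM].
  apply: fracID => //; last by apply: fracIMr => //; [apply: int_ringD => //;
    exact: int_ring1|apply: fracIM].
  by apply: fracIB => //; apply: fracIMr => //; apply: int_ringD => //; exact: int_ring1.
have OE : O (e + (1 - e) * f) by apply: int_ringD => //; exact: int_ringM.
set E := e + _ in CE OE.
have OWV : O (W * VV) by rewrite -(subrK E (W * VV)); apply: int_ringD => //; exact: CO.
split.
- by rewrite /W; apply: fracID => //; apply: fracIM => //; exact: int_ringM.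
- by rewrite /VV; apply: (fracID fSi); apply: (fracIM fSi) => //; apply: int_ringM => //;
  exact: int_ringM.
- have -> : W * VV * (W * VV) - W * VV = (W * VV - E) * (W * VV + E - 1)
     + (e * e - e) * (1 - f) + (1 - e) * (1 - e) * (f * f - f).
    by rewrite /E; ring.
  have O1f : O (1 - f) by apply: int_ringB => //; exact: int_ring1.
  apply: fracID => //; last by apply: fracIM => //; exact: int_ringM.
  apply: fracID => //; apply: fracIMr => //.
  by apply: int_ringB; [exact: int_ringD|exact: int_ring1].
have -> : (x + y) ^+ (m.+1 + k) * (1 - W * VV) =
   (f * A + y ^+ k * B) * ((1 - e) * (1 - f)) - (x + y) ^+ (m.+1 + k) * (W * VV - E).
  by rewrite EAB /E /f; ring.
have OyB : O (y ^+ k) by exact: int_ringX.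
have O1f : O (1 - f) by apply: int_ringB => //; exact: int_ring1.
apply: fracIB => //; last by apply: fracIM => //; apply: int_ringX; exact: int_ringD.
have -> : (f * A + y ^+ k * B) * ((1 - e) * (1 - f)) =
   - (f * f - f) * (A * (1 - e)) + (y ^+ k * (1 - e)) * (B * (1 - f)) by ring.
apply: fracID => //; first by rewrite mulNr; apply: fracIN => //; apply: fracIMr => //;
  exact: int_ringM.
by apply: fracIMr => //; exact: int_ringM.
Qed.

(** An inverse q of a in S^-1, up to M, exists when a generates S modulo M S. *)
Definition generates_mod M S a := S a /\ exists2 q, ideal_inv S q & M (1 - a * q).

Lemma generates_mod_congr M S a a' : int_ideal M -> frac_ideal S ->
  generates_mod M S a -> ideal_mul M S (a' - a) -> generates_mod M S a'.
Proof.
move=> iM fS [Sa [q Sq Mq]] h; have fM := int_ideal_frac iM; split.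
  by rewrite -(subrK a a'); apply: fracID => //; exact: (int_ideal_mul_sub_frac iM fS).
exists q => //; have -> : 1 - a' * q = (1 - a * q) - (a' - a) * q by ring.
by apply: fracIB => //; apply: mul_inv_mem h Sq.
Qed.

(** Fix a generator w of S modulo C S.  Then a = x w with x a unit modulo M, and the
    task is to lift x to a unit modulo C.  If f is the idempotent power of x modulo
    C, then f = 1 mod M, and x f + (1 - f) is such a lift. *)
Lemma generates_mod_lift M C S a : int_ideal M -> int_ideal C -> C `<=` M -> frac_ideal S ->
  generates_mod M S a -> exists2 a', ideal_mul M S (a' - a) & generates_mod C S a'.
Proof.
move=> iM iC CM fS [Sa [q Sq Mq]]; have [fM MO] := iM; have [fC CO] := iC.
have fSi : frac_ideal (ideal_inv S) by solve_frac.
have [w [V [Sw SV CwV]]] := locally_principal iC fS.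
have Ox : O (a * V) by exact: (@mul_inv_int S).
set x := a * V in Ox.
have Ot : O (w * q) by exact: (@mul_inv_int S).
have Mx : M (1 - x * (w * q)).
  have -> : 1 - x * (w * q) = (1 - a * q) + (1 - w * V) * (a * q) by rewrite /x; ring.
  by apply: fracID => //; apply: fracIMr; [|exact: (@mul_inv_int S)|exact: CM].
have [n Cf] := power_idempotent iC Ox; set f := x ^+ n.+1 in Cf.
have Of : O f by exact: int_ringX.
have [t' Ot' Mft] : exists2 t', O t' & M (1 - f * t').
  rewrite /f; elim: n.+1 => [|l [t' Ot' IH]].
    by exists 1; [exact: int_ring1|rewrite expr0 mulr1 subrr; apply: fracI0].
  exists (t' * (w * q)); first exact: int_ringM.
  have -> : 1 - x ^+ l.+1 * (t' * (w * q)) =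
    (1 - x ^+ l * t') + x ^+ l * t' * (1 - x * (w * q)).
    by rewrite exprSr; ring.
  by apply: fracID => //; apply: fracIM => //; apply: int_ringM => //; exact: int_ringX.
have Mf : M (1 - f).
  have -> : 1 - f = (1 - f * t') * (1 - f) - t' * (f * f - f) by ring.
  apply: fracIB => //; first by apply: fracIMr => //; apply: int_ringB => //; exact: int_ring1.
  by apply: fracIM => //; exact: CM.
have O1f : O (1 - f) by exact: MO.
(* x is invertible on the part of f, with inverse x^n there *)
pose x' := x * f + (1 - f); pose y' := x ^+ n * f + (1 - f).
have Ox' : O x' by apply: int_ringD => //; exact: int_ringM.
have Oy' : O y' by apply: int_ringD => //; apply: int_ringM => //; exact: int_ringX.
have Cxy : C (1 - x' * y').
  have -> : 1 - x' * y' = (f * f - f) * (x + x ^+ n - f - 2%:R).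
    rewrite /x' /y'; have : f = x * x ^+ n by rewrite /f exprS.
    set g := x ^+ n => Ef.
    have -> : 1 - (x * f + (1 - f)) * (g * f + (1 - f)) =
       1 - (x * g) * f * f - (x + g) * (f * (1 - f)) - (1 - f) * (1 - f) by ring.
    by rewrite -Ef; ring.
  apply: fracIMr => //; apply: int_ringB; last exact: int_ring_nat.
  by apply: int_ringB => //; apply: int_ringD => //; exact: int_ringX.
exists (x' * w).
  have -> : x' * w - a = (1 - f) * ((1 - x) * w) - (1 - w * V) * a.
    by rewrite /x' /x; ring.
  have fMS : frac_ideal (ideal_mul M S) by solve_frac.
  apply: fracIB => //; apply: ideal_mul_mem => //; last exact: CM.
  by apply: fracIM => //; apply: int_ringB => //; exact: int_ring1.
split; first exact: fracIM.
exists (V * y'); first exact: (fracIMr fSi).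
have -> : 1 - x' * w * (V * y') = (1 - x' * y') + x' * y' * (1 - w * V) by ring.
by apply: fracID => //; apply: fracIM => //; exact: int_ringM.
Qed.
End Lifting.

(** * The ideals attached to a cusp *)

Section CuspData.
Variable F : fieldExtType rat.
Local Notation O := (int_ring F).
Implicit Types (I J K L M N A B D E C S b : set F) (x y z r a c : F).

(** The ideal a S^-1, integral when a is in S. *)
Definition quot_ideal S a := set_scale a (ideal_inv S).

Lemma generates_mod_coprime M S a : int_ideal M -> frac_ideal S -> a != 0 ->
  generates_mod M S a ->
  int_ideal (quot_ideal S a) /\ ideal_coprime (quot_ideal S a) M.
Proof.
move=> iM fS a0 [Sa [q Sq Mq]];
  have iR : int_ideal (quot_ideal S a) by exact: int_ideal_scale_inv.
by split=> //; apply/ideal_coprimeP => //; exists (a * q) => //; exists q.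
Qed.

(** For q in S^-1 with a q = 1 mod M the ratio a'/a equals (a' q)/(a q), a quotient
    of integers congruent to 1 modulo M. *)
Lemma generators_narrow1 M S a a' : int_ideal M -> frac_ideal S -> generates_mod M S a ->
  S a' ->
  totally_positive a -> totally_positive a' -> ideal_mul M S (a' - a) ->
  narrow1 M (a' / a).
Proof.
move=> iM fS [Sa [q0 Sq0 Mq0]] Sa' pa pa' h; have [fM MO] := iM.
have a0 := totally_positive_neq0 pa; have a'0 := totally_positive_neq0 pa'.
split; first by apply: totally_positiveM => //; exact: totally_positiveV.
have [q [q_neq0 Sq Mq]] : exists q, [/\ q != 0, ideal_inv S q & M (1 - a * q)].
  have [q00|] := eqVneq q0 0; last by exists q0.
  have [q Sq q_neq0] := frac_ideal_neq0 (frac_inv fS); exists q; split=> //.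
  rewrite q00 mulr0 subr0 in Mq0; rewrite -[X in M X]mulr1; apply: fracIM => //.
  by apply: int_ringB; [exact: int_ring1|exact: (@mul_inv_int F S)].
have -> : a' / a = (a' * q) / (a * q) by field; rewrite a0 q_neq0.
apply: mult_congr1_intro; rewrite ?mulf_neq0 //; try exact: (@mul_inv_int F S).
  by exists 1; rewrite ?mulr1 //; exact: int_ring1.
by rewrite -mulrBl; apply: mul_inv_mem h Sq.
Qed.

(** A converse to [generators_narrow1].  With z = u/v one has
    v (z a - a) = (u - v) a in M S, and v is invertible modulo M. *)
Lemma narrow_congr M S a z : int_ideal M -> frac_ideal S -> S a -> S (z * a) ->
  mult_congr1 M z -> ideal_mul M S (z * a - a).
Proof.
move=> iM fS Sa Sza /(mult_congr1_elim iM)[u [v [u0 v0 [Ou Ov] Muv [Ez [y [Oy _ My]]]]]].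
have fM := int_ideal_frac iM; have fMS : frac_ideal (ideal_mul M S) by solve_frac.
have -> : z * a - a = (1 - v * y) * (z * a - a) + y * ((u - v) * a) by rewrite Ez; field.
apply: (fracID fMS); last by apply: (fracIM fMS) => //; apply: ideal_mul_mem.
by apply: ideal_mul_mem => //; apply: fracIB.
Qed.

(** A point (a : c) on the component of b with its ideal S = aR + c b^-1, described
    by a Bezout relation; q and p are the entries of the second column of a matrix
    of determinant 1 whose first column is (a, c). *)
Definition cusp_datum b S a c := [/\ frac_ideal S, S a, ideal_mul b S c &
  exists q p, [/\ ideal_inv S q, ideal_inv (ideal_mul b S) p & a * q - c * p = 1]].

Lemma cusp_s_frac b a c : frac_ideal b -> (a, c) != (0, 0) -> frac_ideal (cusp_s b a c).
Proof.
move=> fb; rewrite xpair_eqE negb_and => ac0; have fbi := frac_inv fb.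
have mem x y : O x -> ideal_inv b y -> cusp_s b a c (a * x + c * y).
  by move=> Ox by_; exists (a * x); [exists x|exists (c * y) => //; exists y].
split.
- have := mem 0 0 (int_ring0 F) (fracI0 fbi); by rewrite !mulr0 addr0.
- move=> _ _ [_ [x Ox <-] [_ [y hy <-] <-]] [_ [x' Ox' <-] [_ [y' hy' <-] <-]].
  by rewrite addrACA -!mulrDr; apply: mem; [exact: int_ringD|exact: (fracID fbi)].
- move=> r _ Or [_ [x Ox <-] [_ [y hy <-] <-]].
  by rewrite mulrDr !(mulrCA r); apply: mem; [exact: int_ringM|exact: (fracIM fbi)].
- case/orP: ac0 => [a0|c0].
    by exists a => //; have := mem 1 0 (int_ring1 F) (fracI0 fbi); rewrite mulr1 mulr0 addr0.
  have [y hy y0] := frac_ideal_neq0 fbi; exists (c * y); last exact: mulf_neq0.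
  by have := mem 0 y (int_ring0 F) hy; rewrite mulr0 add0r.
have [d [Od d0 db]] := frac_ideal_denom fbi.
have [k k0 Oka] := int_ring_denominator a; have [l l0 Olc] := int_ring_denominator c.
exists (d * k%:R * l%:R); split.
- by do ![apply: int_ringM => //]; exact: int_ring_nat.
- by rewrite !mulf_neq0 // natF_neq0.
move=> _ [_ [_ [x Ox <-] [_ [y hy <-] <-]] <-].
have -> : d * k%:R * l%:R * (a * x + c * y) =
  (d * l%:R * x) * (k%:R * a) + (l%:R * c) * k%:R * (d * y) by ring.
apply: int_ringD; last by apply: int_ringM; [apply: int_ringM => //;
  exact: int_ring_nat|apply: db; exists y].
by do 3![apply: int_ringM => //]; exact: int_ring_nat.
Qed.

(** The relation S S^-1 = R, expanded along S = aR + c b^-1. *)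
Lemma cusp_datum_cusp_s b a c : frac_ideal b -> (a, c) != (0, 0) ->
  cusp_datum b (cusp_s b a c) a c.
Proof.
move=> fb ac0; have fS := cusp_s_frac fb ac0; have fbi := frac_inv fb.
set S := cusp_s b a c in fS *.
have fT : frac_ideal (ideal_mul b S) by solve_frac.
have fSi := frac_inv fS; have fTi := frac_inv fT.
split=> //.
- exists a; first exact: principal_id.
  by exists 0; rewrite ?addr0 //; exists 0; rewrite ?mulr0 //; exact: fracI0.
- have sub : set_scale c (ideal_inv b) `<=` S.
    move=> y hy; exists 0; last by exists y; rewrite ?add0r.
    by exists 0; rewrite ?mulr0 //; exact: int_ring0.
  have : ideal_mul (principal c) (ideal_mul (ideal_inv b) b) c.
    rewrite -[X in ideal_mul _ _ X]mulr1; apply: ideal_mul_mem; first exact: principal_id.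
    by rewrite ideal_Vmul //; exact: int_ring1.
  rewrite ideal_mulA -set_scaleE // ideal_mulC; exact: (ideal_mulS (@subset_refl _ _) sub).
pose K := [set x | exists q p, [/\ ideal_inv S q,
  ideal_inv (ideal_mul b S) p & a * q + c * p = x]].
suff : K 1.
  move=> [q [p [hq hp E]]]; exists q, (- p); split=> //; first exact: (fracIN fTi).
  by rewrite mulrN opprK.
have : ideal_mul S (ideal_inv S) 1 by rewrite ideal_mulV //; exact: int_ring1.
apply: ideal_mul_sub.
- by exists 0, 0; split; [exact: (fracI0 fSi)|exact: (fracI0 fTi)|rewrite !mulr0 addr0].
- move=> x y [q [p [hq hp <-]]] [q' [p' [hq' hp' <-]]].
  exists (q + q'), (p + p'); split; [exact: (fracID fSi)|exact: (fracID fTi)|ring].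
move=> x v [_ [r Or <-] [_ [y hy <-] <-]] hv.
exists (r * v), (y * v); split; [exact: (fracIM fSi)| |by rewrite mulrDl !mulrA].
by rewrite ideal_invM //; exact: ideal_mul_mem.
Qed.

Lemma cusp_datum_uniq b S a c : frac_ideal b -> cusp_datum b S a c -> S = cusp_s b a c.
Proof.
move=> fb [fS Sa Tc [q [p [hq hp E]]]].
have fbi := frac_inv fb.
have e1 : ideal_mul (ideal_mul b S) (ideal_inv b) =
  S by rewrite ideal_mulAC ideal_mulV // ideal_mul1r.
have e2 : ideal_mul (ideal_inv (ideal_mul b S)) S = ideal_inv b.
  by rewrite ideal_invM // ideal_mulVK.
apply/seteqP; split=> [y Sy|_ [_ [r Or <-] [_ [y hy <-] <-]]].
  exists (a * (q * y)); first by exists (q * y) => //; exact: ideal_inv_mem hq Sy.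
  exists (c * (- (p * y))); last by rewrite mulrN !mulrA -mulrBl E mul1r.
  by exists (- (p * y)) => //; apply: (fracIN fbi); exact: ideal_mul_mem_eq hp Sy e2.
by apply: fracID => //; [apply: fracIMr|exact: ideal_mul_mem_eq Tc hy e1].
Qed.

Lemma cusp_datum_neq0 b S a c : cusp_datum b S a c -> (a, c) != (0, 0).
Proof.
move=> [_ _ _ [q [p [_ _ E]]]]; apply/eqP => -[a0 c0].
by move: E; rewrite a0 c0 !mul0r subrr => /esym/eqP; rewrite oner_eq0.
Qed.

(** With T = b S this is the level of the cusp, but here T may be any fractional
    ideal containing c. *)
Definition level_ideal N T c := set_add N (set_scale c (ideal_inv T)).

Lemma level_ideal_int N T c : int_ideal N -> frac_ideal T -> T c ->
  int_ideal (level_ideal N T c).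
Proof.
move=> [fN NO] fT Tc; have fTi := frac_inv fT.
have sub : level_ideal N T c `<=` O.
  by move=> _ [x Nx [_ [y hy <-] <-]]; apply: int_ringD; [exact: NO|exact: (@mul_inv_int F T)].
split=> //; split.
- by exists 0; [exact: fracI0|exists 0; rewrite ?addr0 //; exists 0;
  [exact: (fracI0 fTi)|rewrite mulr0]].
- move=> _ _ [x Nx [_ [y hy <-] <-]] [x' Nx' [_ [y' hy' <-] <-]].
  exists (x + x'); first exact: fracID.
  exists (c * (y + y')); last by ring.
  by exists (y + y') => //; exact: (fracID fTi).
- move=> r _ Or [x Nx [_ [y hy <-] <-]]; exists (r * x); first exact: fracIM.
  exists (c * (r * y)); last by ring.
  by exists (r * y) => //; exact: (fracIM fTi).
- have [x Nx x0] := frac_ideal_neq0 fN; exists x => //.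
  by exists x => //; exists 0; [exists 0; [exact: (fracI0 fTi)|rewrite mulr0]|rewrite addr0].
exists 1; rewrite oner_neq0; split=> //; first exact: int_ring1.
by move=> _ [y hy <-]; rewrite mul1r; exact: sub.
Qed.

Lemma level_ideal_sub N T c : frac_ideal T -> N `<=` level_ideal N T c.
Proof.
move=> fT x Nx; exists x => //.
by exists 0; [exists 0; [exact: (fracI0 (frac_inv fT))|rewrite mulr0]|rewrite addr0].
Qed.

Lemma dvd_of_sub M N : int_ideal M -> int_ideal N -> N `<=` M -> ideal_dvd M N.
Proof.
move=> iM iN NM; split=> //; exists (ideal_mul N (ideal_inv M)); last first.
  by rewrite ideal_mulC ideal_mulVK //; solve_frac.
split; first by solve_frac.
move=> x hx; have := ideal_mulS NM (@subset_refl _ (ideal_inv M)) hx.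
by rewrite ideal_mulV //; solve_frac.
Qed.

Lemma level_ideal_dvd N T c : int_ideal N -> frac_ideal T -> T c ->
  ideal_dvd (level_ideal N T c) N.
Proof. by move=> iN fT Tc; apply: dvd_of_sub => //;
  [exact: level_ideal_int|exact: level_ideal_sub]. Qed.

(** Expand M M^-1 = R along M = N + c T^-1. *)
Lemma level_ideal_generates M N T c : int_ideal N -> int_ideal M -> frac_ideal T -> T c ->
  M = level_ideal N T c -> generates_mod (ideal_div N M) (ideal_mul M T) c.
Proof.
move=> iN iM fT Tc EM; have fM := int_ideal_frac iM; have fN := int_ideal_frac iN.
have fTi := frac_inv fT; have fMi := frac_inv fM.
have cM : set_scale c (ideal_inv T) `<=` M.
  rewrite [X in _ `<=` X]EM => y hy; exists 0; first exact: fracI0.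
  by exists y; rewrite ?add0r.
split.
  have : ideal_mul (principal c) (ideal_mul (ideal_inv T) T) c.
    rewrite -[X in ideal_mul _ _ X]mulr1; apply: ideal_mul_mem; first exact: principal_id.
    by rewrite ideal_Vmul //; exact: int_ring1.
  rewrite ideal_mulA -set_scaleE //; exact: (ideal_mulS cM (@subset_refl _ _)).
pose K := [set x | exists2 q, ideal_inv (ideal_mul M T) q & ideal_div N M (x - c * q)].
suff [q hq h] : K 1 by exists q.
have fL : frac_ideal (ideal_div N M) by rewrite /ideal_div; solve_frac.
have fMT : frac_ideal (ideal_inv (ideal_mul M T)) by solve_frac.
have : ideal_mul M (ideal_inv M) 1 by rewrite ideal_mulV //; exact: int_ring1.
apply: ideal_mul_sub.
- by exists 0; [exact: (fracI0 fMT)|rewrite mulr0 subrr; exact: (fracI0 fL)].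
- move=> x y [q hq hx] [q' hq' hy]; exists (q + q'); first exact: (fracID fMT).
  have -> : x + y - c * (q + q') = (x - c * q) + (y - c * q') by ring.
  exact: (fracID fL).
move=> x v; rewrite {1}EM => -[n Nn [_ [y hy <-] <-]] hv.
exists (y * v); first by rewrite ideal_invM // ideal_mulC; exact: ideal_mul_mem.
have -> : (n + c * y) * v - c * (y * v) = n * v by ring.
exact: ideal_mul_mem.
Qed.

(** Split m in M as m (1 - c r) + c (m r), where r is inverse to c modulo N M^-1. *)
Lemma generates_mod_level M N T c : int_ideal N -> int_ideal M -> ideal_dvd M N ->
  frac_ideal T ->
  generates_mod (ideal_div N M) (ideal_mul M T) c -> M = level_ideal N T c.
Proof.
move=> iN iM MN fT [MTc [r hr Lr]]; have fM := int_ideal_frac iM; have fN := int_ideal_frac iN.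
have [iL LM] := dvd_quotient iM MN.
have e1 : ideal_mul M (ideal_inv (ideal_mul M T)) = ideal_inv T.
  by rewrite ideal_invM // ideal_mulA ideal_mulV // ideal_mul1r //; solve_frac.
apply/seteqP; split=> [m Mm|_ [x Nx [_ [y hy <-] <-]]].
  exists (m * (1 - c * r)).
    by rewrite -LM ideal_mulC; exact: ideal_mul_mem.
  exists (c * (m * r)); last by ring.
  by exists (m * r) => //; exact: ideal_mul_mem_eq Mm hr e1.
apply: fracID => //; last exact: (mul_inv_mem (S := T)).
exact: (dvd_sub iM MN).
Qed.
End CuspData.

(** * Orbits of the congruence groups *)

Section GammaAction.
Variable F : fieldExtType rat.
Local Notation O := (int_ring F).
Implicit Types (I J K L M N A B D E C S b : set F) (x y z r a c : F).

(** Membership of [[al, be], [ga, de]] in Gamma_i(N)_b, uniformly in i. *)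
Definition gamma_coeffs (i : 'I_2) N b (al be ga de : F) :=
  [/\ O al /\ O de, ideal_inv b be, ideal_mul N b ga, totpos_unit (al * de - be * ga)
    & i != 0 -> N (al - 1)].

Lemma det22 (g : 'M[F]_2) : \det g = g 0 0 * g 1 1 - g 0 1 * g 1 0.
Proof.
rewrite (expand_det_row _ 0) !big_ord_recl big_ord0 /= /cofactor !det_mx11 !mxE /=.
rewrite addr0 expr0 mul1r /= expr1 mulN1r mulrN.
by congr (g _ _ * g _ _ - g _ _ * g _ _); apply/val_inj.
Qed.

Lemma GammaE i N b (g : 'M[F]_2) :
  Gamma i N b g <-> gamma_coeffs i N b (g 0 0) (g 0 1) (g 1 0) (g 1 1).
Proof.
rewrite /Gamma /gamma_coeffs -det22; case: (i == 0); first by split=> [[]|[]].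
by split=> [[[? ? ? ?] ?]|[? ? ? ? h]]; split=> //; exact: h.
Qed.

Definition mx22 (a b c d : F) : 'M[F]_2 :=
  \matrix_(i, j) if i == 0 then (if j == 0 then a else b) else (if j == 0 then c else d).

Lemma GammaE22 i N b al be ga de : Gamma i N b (mx22 al be ga de) <->
  gamma_coeffs i N b al be ga de.
Proof. by rewrite GammaE !mxE. Qed.

Definition col2 (a c : F) : 'cV[F]_2 := \col_(k < 2) (if k == 0 then a else c).

Lemma ord2P (j : 'I_2) : j = 0 \/ j = 1.
Proof. by case: j => [[|[|j]] hj] //; [left|right]; apply/val_inj. Qed.

Lemma mul_col2 (g : 'M[F]_2) a c :
  g *m col2 a c = col2 (g 0 0 * a + g 0 1 * c) (g 1 0 * a + g 1 1 * c).
Proof.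
apply/matrixP => k j; rewrite !mxE !big_ord_recl big_ord0 addr0 !mxE /=.
have -> : lift ord0 ord0 = 1 :> 'I_2 by apply/val_inj.
by case: (ord2P k) => ->.
Qed.

Lemma col2Z x a c : col2 (x * a) (x * c) = x *: col2 a c.
Proof. by apply/matrixP => k j; rewrite !mxE; case: ifP. Qed.

Lemma col2_inj a c a' c' : col2 a c = col2 a' c' -> a = a' /\ c = c'.
Proof. by move=> /matrixP h; split; [have := h 0 0|have := h 1 0]; rewrite !mxE. Qed.

Lemma col2_eq0 a c : (col2 a c == 0) = ((a, c) == (0, 0)).
Proof.
apply/eqP/eqP => [E|[-> ->]]; last by apply/matrixP => k j; rewrite !mxE if_same.
have [-> ->] // : a = 0 /\ c = 0.
by apply: col2_inj; rewrite E; apply/matrixP => k j; rewrite !mxE if_same.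
Qed.

Lemma proj_actE (g : 'M[F]_2) a c : proj_act g (proj_point a c) =
  proj_point (g 0 0 * a + g 0 1 * c) (g 1 0 * a + g 1 1 * c).
Proof. by rewrite /proj_act /proj_point limg_line lfunE /= -/(col2 _ _) mul_col2. Qed.

Lemma proj_act_mul (g h : 'M[F]_2) (l : {vspace 'cV[F]_2}) : proj_act (g *m h) l =
  proj_act g (proj_act h l).
Proof.
rewrite /proj_act -limg_comp; congr (_ @: _)%VS; apply/lfunP => v.
by rewrite comp_lfunE !lfunE /= mulmxA.
Qed.

Lemma proj_act1 (l : {vspace 'cV[F]_2}) : proj_act 1%:M l = l.
Proof.
rewrite /proj_act -[RHS]lim1g; congr (_ @: _)%VS; apply/lfunP => v.
by rewrite id_lfunE lfunE /= mul1mx.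
Qed.

Section Orbits.
Variables (N b : set F) (i : 'I_2).
Hypotheses (iN : int_ideal N) (fb : frac_ideal b).
Let fN := int_ideal_frac iN.
Let fbi := frac_inv fb.

Lemma gamma_coeffs_mulN be ga : ideal_inv b be -> ideal_mul N b ga -> N (be * ga).
Proof. by move=> hb hg; apply: ideal_mul_mem_eq hb hg _; rewrite ideal_mulC ideal_mulK. Qed.

Lemma Gamma_1 : Gamma i N b 1%:M.
Proof.
apply/GammaE; rewrite !mxE /= !mulr1n !mulr0n; split.
- by split; exact: int_ring1.
- exact: (fracI0 fbi).
- exact: ideal_mul0.
- by rewrite mulr1 mulr0 subr0; split; rewrite ?invr1;
  [exact: int_ring1|exact: int_ring1|exact: totally_positive1].
by move=> _; rewrite subrr; exact: fracI0.
Qed.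

Lemma GammaM g h : Gamma i N b g -> Gamma i N b h -> Gamma i N b (g *m h).
Proof.
have fNb : frac_ideal (ideal_mul N b) by solve_frac.
move=> /GammaE[[Oa Od] hb hg hD h1] /GammaE[[Oa' Od'] hb' hg' hD' h1'].
apply/GammaE; rewrite /gamma_coeffs -det22 det_mulmx !det22 !mxE !big_ord_recl !big_ord0 !addr0.
have -> : lift ord0 ord0 = 1 :> 'I_2 by apply/val_inj.
split.
- split; apply: int_ringD; try exact: int_ringM; apply: (int_ideal_sub iN);
  first exact: gamma_coeffs_mulN.
  by rewrite mulrC; exact: gamma_coeffs_mulN.
- by apply: (fracID fbi); [exact: (fracIM fbi)|exact: (fracIMr fbi)].
- by apply: (fracID fNb); [exact: (fracIMr fNb)|exact: (fracIM fNb)].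
- case: hD hD' => [Odet Odeti pD] [Odet' Odeti' pD']; split; first exact: int_ringM.
    by rewrite invfM; exact: int_ringM.
  exact: totally_positiveM.
move=> i0; have -> : g 0 0 * h 0 0 + g 0 1 * h 1 0 - 1 =
  (g 0 0 - 1) * h 0 0 + (h 0 0 - 1) + g 0 1 * h 1 0 by ring.
apply: fracID => //; last exact: gamma_coeffs_mulN.
by apply: fracID => //; [apply: fracIMr => //; exact: h1|exact: h1'].
Qed.

Lemma Gamma_inv g : Gamma i N b g -> exists2 h, Gamma i N b h & h *m g = 1%:M.
Proof.
have fNb : frac_ideal (ideal_mul N b) by solve_frac.
move=> /GammaE[[Oa Od] hb hg [Odet Odeti pD] h1].
set D := _ - _ in Odet Odeti pD; have D0 := totally_positive_neq0 pD.
exists (mx22 (g 1 1 / D) (- g 0 1 / D) (- g 1 0 / D) (g 0 0 / D)).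
  apply/GammaE22; split.
  - by split; exact: int_ringM.
  - by apply: (fracIMr fbi) => //; exact: (fracIN fbi).
  - by apply: (fracIMr fNb) => //; exact: (fracIN fNb).
  - have -> : g 1 1 / D * (g 0 0 / D) - - g 0 1 / D * (- g 1 0 / D) = D^-1.
      by rewrite !mulrA -mulrBl; rewrite /D in D0 *; field.
    by split; rewrite ?invrK //; exact: totally_positiveV.
  move=> i0; have -> : g 1 1 / D - 1 = (g 0 1 * g 1 0 - (g 0 0 - 1) * g 1 1) * D^-1.
    by rewrite /D in D0 *; field.
  by apply: fracIMr => //; apply: fracIB => //;
    [exact: gamma_coeffs_mulN|apply: fracIMr => //; exact: h1].
apply/matrixP => k l; rewrite !mxE !big_ord_recl big_ord0 addr0 !mxE /=.
have -> : lift ord0 ord0 = 1 :> 'I_2 by apply/val_inj.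
by case: (ord2P k) (ord2P l) => -> [] ->; rewrite /= ?mulr1n ?mulr0n; rewrite /D in D0 *; field.
Qed.

Lemma proj_orbit_eqP (l l' : {vspace 'cV[F]_2}) :
  proj_orbit (Gamma i N b) l = proj_orbit (Gamma i N b) l' <->
  exists2 g, Gamma i N b g & proj_act g l = l'.
Proof.
split=> [E|[g Gg <-]].
  have : proj_orbit (Gamma i N b) l' l' by exists 1%:M; [exact: Gamma_1|exact: proj_act1].
  by rewrite -E => -[g Gg <-]; exists g.
apply/seteqP; split=> _ [h Gh <-].
  have [k Gk Ek] := Gamma_inv Gg; exists (h *m k); first exact: GammaM.
  by rewrite -proj_act_mul -mulmxA Ek mulmx1.
by exists (h *m g); [exact: GammaM|rewrite proj_act_mul].
Qed.

Lemma proj_point_eqP a c a' c' : (a, c) != (0, 0) ->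
  proj_point a c = proj_point a' c' <-> exists2 x, x != 0 & a' = x * a /\ c' = x * c.
Proof.
rewrite -col2_eq0 => v0; split=> [E|[x x0 [-> ->]]].
  have : col2 a c \in proj_point a' c' by rewrite -E memv_line.
  move=> /vlineP[x Ex]; have x0 : x != 0.
    by apply: contra_neq v0 => x0; rewrite Ex x0 scale0r.
  exists x^-1; rewrite ?invr_eq0 //.
  by apply: col2_inj; rewrite col2Z Ex scalerA mulVf // scale1r.
apply/esym/eqP; rewrite /proj_point -!/(col2 _ _) col2Z eqEdim !dim_vline scaler_eq0 (negbTE
  x0) /=.
by rewrite leqnn andbT -memvE memvZ // memv_line.
Qed.

Lemma orbit_eqP a c a' c' : (a, c) != (0, 0) -> (a', c') != (0, 0) ->
  proj_orbit (Gamma i N b) (proj_point a c) = proj_orbit (Gamma i N b) (proj_point a' c') <->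
  exists al be ga de x, [/\ gamma_coeffs i N b al be ga de, x != 0,
    a' = x * (al * a + be * c) & c' = x * (ga * a + de * c)].
Proof.
move=> ac0 ac'0; rewrite proj_orbit_eqP; split.
  move=> [g /GammaE Gg]; rewrite proj_actE => /esym/(proj_point_eqP _ _ ac'0)[x x0 [E1 E2]].
  exists (g 0 0), (g 0 1), (g 1 0), (g 1 1), x^-1; split; rewrite ?invr_eq0 //.
    by rewrite E1 mulKf.
  by rewrite E2 mulKf.
move=> [al [be [ga [de [x [G x0 E1 E2]]]]]].
exists (mx22 al be ga de); first exact/GammaE22.
rewrite proj_actE !mxE /=; apply/esym/(proj_point_eqP _ _ ac'0); exists x^-1;
  rewrite ?invr_eq0 //.
by rewrite E1 E2 !mulKf.
Qed.
End Orbits.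

(** The matrix sought is g2 [[1, n], [0, tau]] g1^-1, where g1 = [[a, p], [c, q]] and
    g2 = [[A, p2], [C, q2]] have determinant 1.  Modulo N b its lower left entry is
    C (y - c n), with y = q - x q2, so c n = y mod N S^-1 suffices.  This is
    possible since y is in M S^-1 = N S^-1 + c T^-1 S^-1: indeed y = (a y) q - (c p) y,
    and both a y and c p lie in M.  With this n the upper left entry is congruent to
    x modulo N. *)
Lemma cusp_datum_matrix N b S M a c (A C : F) x tau :
  int_ideal N -> int_ideal M -> frac_ideal b ->
  cusp_datum b S a c -> cusp_datum b S A C -> M = level_ideal N (ideal_mul b S) c ->
  M = level_ideal N (ideal_mul b S) C ->
  O x -> O tau -> ideal_mul M S (A - x * a) ->
  ideal_mul N (ideal_mul b S) (x * C - tau * c) ->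
  exists al be ga de, [/\ O al /\ O de, ideal_inv b be /\ ideal_mul N b ga,
    al * de - be * ga = tau, N (al - x) & al * a + be * c = A /\ ga * a + de * c = C].
Proof.
move=> iN iM fb [fS Sa Tc [q [p [hq hp E1]]]] [_ SA TC [q2 [p2 [hq2 hp2 E2]]]] Mc MC.
move=> Ox Otau hA hC.
have fN := int_ideal_frac iN; have fM := int_ideal_frac iM.
set T := ideal_mul b S in Tc TC hp hp2 Mc MC hC.
have fT : frac_ideal T by rewrite /T; solve_frac.
have fSi := frac_inv fS; have fTi := frac_inv fT; have fbi := frac_inv fb.
have levM (e t : F) : M = level_ideal N T e -> ideal_inv T t -> M (e * t).
  move=> -> ht; exists 0; first exact: fracI0.
  by exists (e * t); rewrite ?add0r //; exists t.
set y := q - x * q2.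
have Sy : ideal_inv S y by apply: (fracIB fSi) => //; exact: (fracIM fSi).
have May : M (a * y).
  have -> : a * y = c * p - C * p2 + (A - x * a) * q2.
    have -> : a * y = (a * q - c * p) - (A * q2 - C * p2) + (c * p - C * p2 + (A - x * a) * q2).
      by rewrite /y; ring.
    by rewrite E1 E2 subrr add0r.
  by apply: fracID => //; [apply: fracIB => //; exact: levM|exact: mul_inv_mem hA hq2].
have MSy : ideal_mul M (ideal_inv S) y.
  have -> : y = a * y * q - c * p * y.
    by rewrite -[LHS]mul1r -E1; ring.
  have fMS : frac_ideal (ideal_mul M (ideal_inv S)) by solve_frac.
  by apply: (fracIB fMS); apply: ideal_mul_mem => //; exact: levM.
have [n hn Nn] : exists2 n, ideal_mul (ideal_inv T) (ideal_inv S) n &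
    ideal_mul N (ideal_inv S) (y - c * n).
  move: MSy; set U := ideal_mul (ideal_inv T) (ideal_inv S).
  set V := ideal_mul N (ideal_inv S).
  have fU : frac_ideal U by rewrite /U; solve_frac.
  have fV : frac_ideal V by rewrite /V; solve_frac.
  apply: (ideal_mul_sub (K := [set z | exists2 n, U n & V (z - c * n)])).
  - by exists 0; [exact: (fracI0 fU)|rewrite mulr0 subrr; exact: (fracI0 fV)].
  - move=> z z' [m hm Vm] [m' hm' Vm']; exists (m + m'); first exact: (fracID fU).
    have -> : z + z' - c * (m + m') = (z - c * m) + (z' - c * m') by ring.
    exact: (fracID fV).
  move=> z v; rewrite {1}Mc => -[n0 Nn0 [_ [t ht <-] <-]] hv.
  exists (t * v); first exact: ideal_mul_mem.
  by rewrite mulrDl mulrA addrK; exact: ideal_mul_mem.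
have nc : ideal_inv S (n * c).
  by apply: ideal_mul_mem_eq hn Tc _; rewrite ideal_mulAC ideal_Vmul // ideal_mul1r.
have na : ideal_inv T (n * a).
  by apply: ideal_mul_mem_eq hn Sa _; rewrite ideal_mulVK.
have ST : ideal_mul S (ideal_inv T) = ideal_inv b.
  by rewrite /T ideal_invM // ideal_mulC ideal_mulVK.
have TNS : ideal_mul T (ideal_mul N (ideal_inv S)) = ideal_mul N b.
  by rewrite ideal_mulCA /T ideal_mulK.
have NTS : ideal_mul (ideal_mul N T) (ideal_inv S) = ideal_mul N b.
  by rewrite -ideal_mulA /T ideal_mulK.
have SNS : ideal_mul S (ideal_mul N (ideal_inv S)) = N.
  by rewrite ideal_mulCA ideal_mulV // ideal_mulr1.
have qnc : ideal_inv S (q - n * c) by exact: (fracIB fSi).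
have pna : ideal_inv T (n * a - p) by exact: (fracIB fTi).
exists (A * (q - n * c) - tau * (c * p2)), (A * (n * a - p) + tau * (a * p2)).
exists (C * (y - c * n) + (x * C - tau * c) * q2), (C * (n * a - p) + tau * (a * q2)).
split.
- split.
    apply: int_ringB; first exact: (mul_inv_int SA qnc).
    by apply: int_ringM => //; exact: (mul_inv_int Tc hp2).
  apply: int_ringD; first exact: (mul_inv_int TC pna).
  by apply: int_ringM => //; exact: (mul_inv_int Sa hq2).
- split.
    apply: (fracID fbi); first exact: ideal_mul_mem_eq SA pna ST.
    by apply: (fracIM fbi) => //; exact: ideal_mul_mem_eq Sa hp2 ST.
  have fNb : frac_ideal (ideal_mul N b) by solve_frac.
  by apply: (fracID fNb); [exact: ideal_mul_mem_eq TC Nn TNS|exact: ideal_mul_mem_eq hC hq2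
    NTS].
- transitivity (tau * (a * q - c * p) * (A * q2 - C * p2)); last by rewrite E1 E2 !mulr1.
  by rewrite /y; ring.
- have -> : A * (q - n * c) - tau * (c * p2) - x =
      A * (y - c * n) + (x * C - tau * c) * p2 + x * (A * q2 - C * p2 - 1) by rewrite /y; ring.
  rewrite E2 subrr mulr0 addr0; apply: fracID => //; first exact: ideal_mul_mem_eq SA Nn SNS.
  exact: mul_inv_mem hC hp2.
split.
  have -> : (A * (q - n * c) - tau * (c * p2)) * a + (A * (n * a - p) + tau * (a * p2)) * c
     = A * (a * q - c * p) by ring.
  by rewrite E1 mulr1.
have -> : (C * (y - c * n) + (x * C - tau * c) * q2) * a + (C * (n * a - p) + tau * (a * q2))
  * c =
  C * (a * q - c * p) by rewrite /y; ring.
by rewrite E1 mulr1.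
Qed.
End GammaAction.

(** * The invariant of a cusp *)

Section CuspInvariant.
Variable F : fieldExtType rat.
Hypothesis hF : totally_real F.
Local Notation O := (int_ring F).
Implicit Types (I J K L M N S T b : set F) (x y z r a c : F).

Lemma totally_positive_sqr x : x != 0 -> totally_positive (x ^+ 2).
Proof.
move=> x0 s; rewrite rmorphXn /= -real_normK ?hF // exprn_gt0 // normr_gt0 fmorph_eq0 //.
Qed.

Lemma cusp_datum_scale b S a c x : frac_ideal b -> x != 0 -> cusp_datum b S a c ->
  cusp_datum b (set_scale x S) (x * a) (x * c).
Proof.
move=> fb x0 [fS Sa Tc [q [p [hq hp E]]]].
have Tx : ideal_mul b (set_scale x S) = set_scale x (ideal_mul b S) by rewrite ideal_mul_scaler.
split; first exact: frac_scale.
- by exists a.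
- by rewrite Tx; exists c.
exists (x^-1 * q), (x^-1 * p); split.
- by rewrite ideal_inv_scale //; exists q.
- by rewrite Tx ideal_inv_scale //; [exists p|solve_frac].
by rewrite -E; field.
Qed.

(** The matrix acts on both columns of [[a, p], [c, q]]; dividing the second one by
    the determinant, a unit, restores determinant 1. *)
Lemma cusp_datum_gamma i N b S a c al be ga de : int_ideal N -> frac_ideal b ->
  gamma_coeffs i N b al be ga de -> cusp_datum b S a c ->
    cusp_datum b S (al * a + be * c) (ga * a + de * c).
Proof.
move=> iN fb [[Oa Od] hb hg [Odet Odeti pD] _] [fS Sa Tc [q [p [hq hp E]]]].
set D := _ - _ in Odet Odeti pD; have D0 := totally_positive_neq0 pD.
set T := ideal_mul b S in Tc hp *.
have fT : frac_ideal T by rewrite /T; solve_frac.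
have fSi := frac_inv fS; have fTi := frac_inv fT; have fbi := frac_inv fb.
have bga : b ga by apply: (int_ideal_mul_sub_frac iN fb).
have bT : ideal_mul (ideal_inv b) T = S by rewrite /T ideal_mulA ideal_Vmul // ideal_mul1r.
have bTi : ideal_mul b (ideal_inv T) = ideal_inv S.
  by rewrite /T ideal_invM // ideal_mulA ideal_mulV // ideal_mul1r.
split=> //.
- by apply: fracID => //; [exact: fracIM|exact: ideal_mul_mem_eq hb Tc bT].
- by apply: fracID => //; [exact: ideal_mul_mem|exact: fracIM].
exists ((de * q + ga * p) * D^-1), ((be * q + al * p) * D^-1); split.
- apply: (fracIMr fSi) => //; apply: (fracID fSi); first exact: (fracIM fSi).
  exact: ideal_mul_mem_eq bga hp bTi.
- apply: (fracIMr fTi) => //; apply: (fracID fTi); last exact: (fracIM fTi).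
  by rewrite /T ideal_invM //; exact: ideal_mul_mem.
rewrite -E; rewrite /D in D0 *; field; exact: D0.
Qed.

Lemma generates_mod_scale M S x a : x != 0 -> int_ideal M -> frac_ideal S ->
  generates_mod M S a -> generates_mod M (set_scale x S) (x * a).
Proof.
move=> x0 iM fS [Sa [q hq Mq]]; split; first by exists a.
exists (x^-1 * q); first by rewrite ideal_inv_scale //; exists q.
by have -> : x * a * (x^-1 * q) = a * q by field.
Qed.

Lemma generates_mod_unit M S x y a : int_ideal M -> frac_ideal S -> O x -> O y ->
  M (1 - x * y) ->
  generates_mod M S a -> generates_mod M S (x * a).
Proof.
move=> iM fS Ox Oy Mxy [Sa [q hq Mq]]; have fM := int_ideal_frac iM; have fSi := frac_inv fS.
split; first exact: fracIM.
exists (y * q); first exact: (fracIM fSi).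
have -> : 1 - x * a * (y * q) = (1 - x * y) + x * y * (1 - a * q) by ring.
by apply: fracID => //; apply: fracIM => //; exact: int_ringM.
Qed.

Lemma level_ideal_mem N T c t : int_ideal N -> ideal_inv T t -> level_ideal N T c (c * t).
Proof.
move=> iN ht; exists 0; first by apply: fracI0; solve_frac.
by exists (c * t); rewrite ?add0r //; exists t.
Qed.

(** The Bezout relation gives a q = 1 + c p, and c p lies in c T^-1, hence in M. *)
Lemma cusp_datum_generates N M b S a c : int_ideal N -> int_ideal M -> cusp_datum b S a c ->
  M = level_ideal N (ideal_mul b S) c -> generates_mod M S a.
Proof.
move=> iN iM [fS Sa Tc [q [p [hq hp E]]]] EM; split=> //; exists q => //.
have -> : 1 - a * q = - (c * p) by rewrite -E; ring.
by apply: fracIN; [solve_frac|rewrite EM; exact: level_ideal_mem].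
Qed.

Lemma scale_mem_mul M S x y : frac_ideal M -> frac_ideal S -> ideal_mul M S y ->
  ideal_mul M (set_scale x S) (x * y).
Proof. by move=> fM fS h; rewrite ideal_mul_scaler //; exists y. Qed.

Lemma scale_unit K x : O x -> O x^-1 -> x != 0 -> frac_ideal K -> set_scale x K = K.
Proof.
move=> Ox Oxi x0 fK; apply/seteqP; split=> [_ [y Ky <-]|y Ky]; first exact: fracIM.
by exists (x^-1 * y); [exact: fracIM|rewrite mulVKf].
Qed.

Lemma frac_prime_to_one I : frac_ideal I -> ideals_prime_to O I.
Proof.
move=> fI; have [d [Od d0 dI]] := frac_ideal_denom fI; have iO := int_ideal_int_ring F.
have coprime_one K : int_ideal K -> ideal_coprime K O.
  move=> iK; apply/ideal_coprimeP => //.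
  by exists 0; [apply: fracI0; exact: int_ideal_frac|rewrite subr0; exact: int_ring1].
have idI : int_ideal (set_scale d I) by split=> //; exact: frac_scale.
have idO : int_ideal (principal d).
  by split; [exact: frac_principal|move=> _ [y Oy <-]; exact: int_ringM].
exists (set_scale d I), (principal d); split=> //; try exact: coprime_one.
by rewrite ideal_inv_principal // ideal_mulC -set_scaleE ?set_scaleA ?mulVf ?set_scale1 //;
  exact: frac_scale.
Qed.

Lemma narrow1_one x : totally_positive x -> narrow1 O x.
Proof.
move=> px; split=> //; have x0 := totally_positive_neq0 px; have iO := int_ideal_int_ring F.
have [d d0 Odx] := int_ring_denominator x; have dF := natF_neq0 F d0;
  have Od := int_ring_nat F d.
have -> : x = (d%:R * x) / d%:R by field.
apply: mult_congr1_intro; rewrite ?mulf_neq0 //; last exact: int_ringB.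
by exists 0; [exact: int_ring0|rewrite mulr0 subr0; exact: int_ring1].
Qed.

(** The ideals b and x b have the same narrow class, which contains a single ideal
    of B. *)
Lemma narrow_reps_inj (B : set (set F)) b b' x : narrow_class_reps B -> B b -> B b' ->
  totally_positive x -> b' = set_scale x b -> b' = b.
Proof.
move=> [Bfr Bcl] Bb Bb' px Eb; have fb := Bfr _ Bb; have x0 := totally_positive_neq0 px.
have [|b1 [_ b1P]] := Bcl (narrow_ray_class O b); first by exists b => //;
  exact: frac_prime_to_one.
rewrite -(b1P b'); first by apply: b1P; split=> //;
  exact: ray_class_id (int_ideal_int_ring F) fb.
by split=> //; apply/ray_classP => //; exists x => //; exact: narrow1_one.
Qed.

Section FixedLevel.
Variables (i : 'I_2) (M N : set F).
Hypotheses (iM : int_ideal M) (iN : int_ideal N) (MN : ideal_dvd M N).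
Local Notation L := (ideal_div N M).
Let iL : int_ideal L := (dvd_quotient iM MN).1.
Let LM : ideal_mul L M = N := (dvd_quotient iM MN).2.
Let NM : N `<=` M := dvd_sub iM MN.
Let fM := int_ideal_frac iM.
Let fN := int_ideal_frac iN.

(** Here a' has the residue of a as a generator of S modulo M S, and c' that of c as
    a generator of M T modulo N T; positivity makes the classes of a' S^-1 and
    c' (M T)^-1 independent of the choice. *)
Definition positive_lifts S T a c a' c' :=
  [/\ totally_positive a', totally_positive c',
    ideal_mul M S (a' - a) & ideal_mul N T (c' - c)].

Lemma positive_lifts_exist S T a c : frac_ideal S -> frac_ideal T ->
  exists a' c', positive_lifts S T a c a' c'.
Proof.
move=> fS fT; have fMS : frac_ideal (ideal_mul M S) by solve_frac.
have fNT : frac_ideal (ideal_mul N T) by solve_frac.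
have [a' ha pa] := positive_lift hF a fMS; have [c' hc pc] := positive_lift hF c fNT.
by exists a', c'.
Qed.

Definition cusp_invariant S T a' c' :=
  Q_class i M N (quot_ideal S a') (quot_ideal (ideal_mul M T) c').

Lemma mul_div_mul T : ideal_mul L (ideal_mul M T) = ideal_mul N T.
Proof. by rewrite ideal_mulA LM. Qed.

(** For x = al mod N with the signs of lam, the elements lam x a' and a2' are totally
    positive and congruent modulo lam M S; x c2' / lam and D c' are totally positive
    and congruent modulo N T, D being the determinant.  So the two pairs of ideals
    differ by the relation of x, the unit D having no effect on ideals. *)
Lemma cusp_invariant_orbit b S a c a' c' S2 a2 c2 a2' c2' al be ga de lam :
  frac_ideal b -> cusp_datum b S a c -> M = level_ideal N (ideal_mul b S) c ->
  positive_lifts S (ideal_mul b S) a c a' c' ->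
  gamma_coeffs i N b al be ga de -> lam != 0 ->
  a2 = lam * (al * a + be * c) -> c2 = lam * (ga * a + de * c) ->
  cusp_datum b S2 a2 c2 -> positive_lifts S2 (ideal_mul b S2) a2 c2 a2' c2' ->
  cusp_invariant S (ideal_mul b S) a' c' = cusp_invariant S2 (ideal_mul b S2) a2' c2'.
Proof.
move=> fb dat EM [pa pc ha hc] G lam0 Ea2 Ec2 dat2.
have d1 := cusp_datum_gamma iN fb G dat; have d2 := cusp_datum_scale fb lam0 d1.
rewrite -Ea2 -Ec2 in d2.
rewrite (cusp_datum_uniq fb dat2) -(cusp_datum_uniq fb d2) => {dat2 S2}.
move: d1 d2 => _ _.
have [fS Sa Tc _] := dat; have [[Oal Ode] hbe hga [Odet Odeti pD] hal] := G.
set D := _ - _ in Odet Odeti pD; have D0 := totally_positive_neq0 pD.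
set T := ideal_mul b S in Tc EM hc *.
have fT : frac_ideal T by rewrite /T; solve_frac.
have fMT : frac_ideal (ideal_mul M T) by solve_frac.
have fMS : frac_ideal (ideal_mul M S) by solve_frac.
have fNT : frac_ideal (ideal_mul N T) by solve_frac.
rewrite ideal_mul_scaler // -/T => -[pa2 pc2 ha2 hc2].
have lamV0 : lam^-1 != 0 by rewrite invr_eq0.
(* x / lam is totally positive exactly when x has the signs of lam *)
have [x Nx px] := sign_lift hF al fN lamV0.
have x0 : x != 0 by move/totally_positive_neq0: px; rewrite mulf_eq0 negb_or => /andP[].
have Ox : O x by rewrite -(subrK al x); apply: int_ringD => //; exact: (int_ideal_sub iN).
have Nbg : N (be * ga) by exact: gamma_coeffs_mulN hbe hga.
have Nxd : N (x * de - D).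
  have -> : x * de - D = (x - al) * de + be * ga by rewrite /D; ring.
  by apply: fracID => //; exact: fracIMr.
have Nxu : N (1 - x * (de * D^-1)).
  have -> : 1 - x * (de * D^-1) = - (x * de - D) * D^-1 by field.
  by apply: fracIMr => //; exact: fracIN.
have Qx : Q_condition i N x.
  rewrite /Q_condition; case: ifP => [_|/negbT i0].
    by apply/ideal_coprime_principalP => //; exists (de * D^-1) => //; exact: int_ringM.
  have -> : x - 1 = (x - al) + (al - 1) by ring.
  by apply: fracID => //; exact: hal.
have genc : generates_mod L (ideal_mul M T) c by exact: level_ideal_generates.
have MTc := genc.1.
have gena : generates_mod M S a by exact: cusp_datum_generates dat EM.
have a'0 := totally_positive_neq0 pa; have c'0 := totally_positive_neq0 pc.
have gena' : generates_mod M S a' by exact: generates_mod_congr ha.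
have genxa : generates_mod M S (x * a').
  by apply: (@generates_mod_unit _ _ _ (de * D^-1)) => //; [exact: int_ringM|exact: NM].
have Mbc : ideal_mul M S (be * c).
  by apply: ideal_mul_mem_eq hbe MTc _;
    rewrite /T ideal_mulCA [ideal_mul (ideal_inv b) _]ideal_mulA ideal_Vmul // ideal_mul1r.
have nz : narrow1 M (a2' / (lam * (x * a'))).
  have hh : ideal_mul M (set_scale lam S) (a2' - lam * (x * a')).
    have -> : a2' - lam * (x * a') = (a2' - a2)
       + lam * (- ((x - al) * a) + be * c - x * (a' - a)) by rewrite Ea2; ring.
    have fMS2 : frac_ideal (ideal_mul M (set_scale lam S)) by solve_frac.
    apply: (fracID fMS2) => //; apply: scale_mem_mul => //.
    apply: (fracIB fMS); last exact: (fracIM fMS).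
    by apply: (fracID fMS) => //; apply: (fracIN fMS); apply: ideal_mul_mem => //; exact: NM.
  have genl := generates_mod_scale lam0 iM fS genxa.
  apply: (generators_narrow1 (S := set_scale lam S)) => //; first solve_frac.
  - by case: (generates_mod_congr iM (frac_scale lam0 fS) genl hh).
  have -> : lam * (x * a') = x * lam^-1 * lam ^+ 2 * a' by field.
  by do 2?[apply: totally_positiveM] => //; exact: totally_positive_sqr.
have Dunit : L (1 - D * D^-1) by rewrite divff // subrr; apply: fracI0; solve_frac.
have genc' : generates_mod L (ideal_mul M T) c' by apply: generates_mod_congr genc _;
  rewrite // mul_div_mul.
have genDc : generates_mod L (ideal_mul M T) (D * c') by exact: generates_mod_unit Dunit genc'.
have hh : ideal_mul N T (x * c2' / lam - D * c').
  have -> : x * c2' / lam - D * c' = x * (lam^-1 * (c2' - c2)) + x * (ga * a)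
     + ((x * de - D) * c - D * (c' - c)) by rewrite Ec2; field.
  have hc2' : ideal_mul N T (lam^-1 * (c2' - c2)).
    move: hc2; rewrite ideal_mul_scaler // => -[y hy <-].
    by rewrite mulKf.
  have NTga : ideal_mul N T (ga * a) by rewrite /T ideal_mulA; exact: ideal_mul_mem.
  apply: (fracID fNT).
    by apply: (fracID fNT); exact: (fracIM fNT).
  by apply: (fracIB fNT); [exact: ideal_mul_mem|exact: (fracIM fNT)].
have nw : narrow1 L (x * c2' / lam / (D * c')).
  have hh' := hh; rewrite -mul_div_mul in hh'.
  apply: (generators_narrow1 (S := ideal_mul M T)) => //.
  - by case: (generates_mod_congr iL fMT genDc hh').
  - exact: totally_positiveM.
  by rewrite mulrAC; apply: totally_positiveM.
have a2'0 := totally_positive_neq0 pa2; have c2'0 := totally_positive_neq0 pc2.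
have fS2 : frac_ideal (set_scale lam S) by solve_frac.
have fMT2 : frac_ideal (ideal_mul M (set_scale lam T)) by solve_frac.
have frI : frac_ideal (quot_ideal S a') by apply: frac_scale => //; exact: frac_inv.
have frJ : frac_ideal (quot_ideal (ideal_mul M T) c') by apply: frac_scale => //;
  exact: frac_inv.
have frI2 : frac_ideal (quot_ideal (set_scale lam S) a2') by apply: frac_scale => //;
  exact: frac_inv.
have frJ2 : frac_ideal (quot_ideal (ideal_mul M (set_scale lam T)) c2').
  by apply: frac_scale => //; exact: frac_inv.
rewrite /cusp_invariant; apply/(Q_class_eqP hF i iM iN MN frI frJ frI2 frJ2);
  rewrite /quot_ideal.
exists x, (a2' / (lam * (x * a'))), (x * c2' / lam / (D * c')); split=> //.
  rewrite ideal_inv_scale // !set_scaleA; congr set_scale; field.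
  by rewrite lam0 x0 a'0.
rewrite ideal_mul_scaler // ideal_inv_scale //.
rewrite -[X in _ = set_scale _ (set_scale _ X)](@scale_unit _ D) //; last solve_frac.
rewrite !set_scaleA; congr set_scale; field.
by rewrite D0 x0 c'0 lam0.
Qed.

Lemma ideal_inv_inj I J : frac_ideal I -> frac_ideal J -> ideal_inv I = ideal_inv J -> I = J.
Proof. by move=> fI fJ E; rewrite -[I]ideal_invK // E ideal_invK. Qed.

(** Equality of the invariants gives S2 = lam S and b2 S2 = mu b S for explicit lam
    and mu, hence b2 = tau b with tau = mu / lam, which is totally positive since lam
    and mu both have the signs of x.  If b2 = b then tau is a unit,
      and the congruences required by
    [cusp_datum_matrix] hold for the point rescaled by lam^-1. *)
Lemma cusp_invariant_inj b S a c a' c' b2 S2 a2 c2 a2' c2' :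
  frac_ideal b -> cusp_datum b S a c -> M = level_ideal N (ideal_mul b S) c ->
  positive_lifts S (ideal_mul b S) a c a' c' ->
  frac_ideal b2 -> cusp_datum b2 S2 a2 c2 -> M = level_ideal N (ideal_mul b2 S2) c2 ->
  positive_lifts S2 (ideal_mul b2 S2) a2 c2 a2' c2' ->
  cusp_invariant S (ideal_mul b S) a' c' = cusp_invariant S2 (ideal_mul b2 S2) a2' c2' ->
  exists2 tau, totally_positive tau /\ b2 = set_scale tau b &
    b2 = b -> exists al be ga de lam, [/\ gamma_coeffs i N b al be ga de, lam != 0,
      a2 = lam * (al * a + be * c) & c2 = lam * (ga * a + de * c)].
Proof.
move=> fb dat EM [pa pc ha hc] fb2 dat2 EM2 [pa2 pc2 ha2 hc2].
have [fS Sa Tc _] := dat; have [fS2 Sa2 Tc2 _] := dat2.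
have fT : frac_ideal (ideal_mul b S) by solve_frac.
have fT2 : frac_ideal (ideal_mul b2 S2) by solve_frac.
have fMT : frac_ideal (ideal_mul M (ideal_mul b S)) by solve_frac.
have fMT2 : frac_ideal (ideal_mul M (ideal_mul b2 S2)) by solve_frac.
have a'0 := totally_positive_neq0 pa; have c'0 := totally_positive_neq0 pc.
have a2'0 := totally_positive_neq0 pa2; have c2'0 := totally_positive_neq0 pc2.
have frI : frac_ideal (quot_ideal S a') by apply: frac_scale => //; exact: frac_inv.
have frJ : frac_ideal (quot_ideal (ideal_mul M (ideal_mul b S)) c')
  by apply: frac_scale => //; exact: frac_inv.
have frI2 : frac_ideal (quot_ideal S2 a2') by apply: frac_scale => //; exact: frac_inv.
have frJ2 : frac_ideal (quot_ideal (ideal_mul M (ideal_mul b2 S2)) c2')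
  by apply: frac_scale => //; exact: frac_inv.
move=> /(Q_class_eqP hF i iM iN MN frI frJ frI2 frJ2)[x [z [w [[Ox x0] Qx [nz nw] EI EJ]]]].
have z0 := narrow1_neq0 nz; have w0 := narrow1_neq0 nw.
pose lam := a2' / (x * z * a'); pose mu := c2' * x / (w * c').
have lam0 : lam != 0 by rewrite /lam !mulf_neq0 ?invr_neq0 ?mulf_neq0.
have mu0 : mu != 0 by rewrite /mu !mulf_neq0 ?invr_neq0 ?mulf_neq0.
have ES : S2 = set_scale lam S.
  apply: ideal_inv_inj => //; first solve_frac.
  rewrite ideal_inv_scale //; move: EI => /(congr1 (set_scale a2'^-1)).
  rewrite /quot_ideal !set_scaleA mulVf // set_scale1 => ->; congr set_scale.
  by rewrite /lam; field; rewrite a2'0 x0 z0 a'0.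
have ET : ideal_mul b2 S2 = set_scale mu (ideal_mul b S).
  have h : ideal_mul M (ideal_mul b2 S2) = set_scale mu (ideal_mul M (ideal_mul b S)).
    apply: ideal_inv_inj; try solve_frac.
    rewrite ideal_inv_scale //.
    move: EJ => /(congr1 (set_scale c2'^-1)).
    rewrite /quot_ideal !set_scaleA mulVf // set_scale1 => ->; congr set_scale.
    by rewrite /mu; field; rewrite c2'0 x0 w0 c'0.
  rewrite -[LHS](ideal_mulK fM) // [ideal_mul _ M]ideal_mulC h -ideal_mul_scaler //.
  by rewrite [ideal_mul M _]ideal_mulC ideal_mulK //; solve_frac.
pose tau := mu / lam.
have tau0 : tau != 0 by rewrite mulf_neq0 ?invr_neq0.
have ptau : totally_positive tau.
  have -> : tau = x ^+ 2 * (z * a' * c2') * (w * c' * a2')^-1.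
    by rewrite /tau /mu /lam; field; rewrite a2'0 x0 z0 a'0 w0 c'0.
  have [[pz _] [pw _]] := (nz, nw).
  apply: totally_positiveM; last by apply: totally_positiveV; do 2?[apply: totally_positiveM].
  apply: totally_positiveM; first exact: totally_positive_sqr.
  by do 2?[apply: totally_positiveM].
have Eb : b2 = set_scale tau b.
  rewrite -[LHS](ideal_mulK fS2) // ET ES ideal_inv_scale // ideal_mul_scaler; try solve_frac.
  by rewrite ideal_mul_scalel ?ideal_mulK ?set_scaleA; try solve_frac; rewrite mulrC.
exists tau => // Ebb.
have Otau : O tau.
  by apply: (stable_integral fb) => y hy; rewrite -Ebb Eb; exists y.
have OtauV : O tau^-1.
  apply: (stable_integral fb) => y; rewrite -{1}Ebb Eb => -[t ht <-].
  by rewrite mulKf.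
have lamV0 : lam^-1 != 0 by rewrite invr_eq0.
have dat3 := cusp_datum_scale fb2 lamV0 dat2.
clear Eb; subst b2; subst S2; rewrite set_scaleA mulVf // set_scale1 in dat3.
have [_ SA TC _] := dat3.
have fMS : frac_ideal (ideal_mul M S) by solve_frac.
have fNT : frac_ideal (ideal_mul N (ideal_mul b S)) by solve_frac.
have bT : ideal_mul b (set_scale lam S) =
  set_scale lam (ideal_mul b S) by rewrite ideal_mul_scaler.
rewrite bT in hc2 EM2 Tc2.
set T := ideal_mul b S in fT fMT fNT TC Tc Tc2 EM EM2 hc hc2.
have unscale K J y : frac_ideal K -> frac_ideal J -> ideal_mul K (set_scale lam J) y ->
    ideal_mul K J (lam^-1 * y).
  by move=> fK fJ; rewrite ideal_mul_scaler // => -[t ht <-]; rewrite mulKf.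
have EMC : M = level_ideal N T (lam^-1 * c2).
  by rewrite /level_ideal mulrC -set_scaleA -ideal_inv_scale.
have Sa' : S a' by rewrite -(subrK a a'); apply: fracID => //;
  exact: (int_ideal_mul_sub_frac iM fS).
have Sa2' : S (lam^-1 * a2').
  rewrite -(subrK (lam^-1 * a2) (lam^-1 * a2')); apply: fracID => //.
  by rewrite -mulrBr; apply: (int_ideal_mul_sub_frac iM fS); exact: unscale.
have X1 : ideal_mul M S (lam^-1 * a2 - x * a).
  have -> : lam^-1 * a2 - x * a = (z * (x * a') - x * a') + x * (a' - a) - lam^-1 * (a2' - a2).
    by rewrite /lam; field; rewrite a2'0 x0 z0 a'0.
  apply: (fracIB fMS); last exact: unscale.
  apply: (fracID fMS); last exact: (fracIM fMS).
  apply: narrow_congr => //; [exact: fracIM| |exact: nz.2].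
  have -> : z * (x * a') = lam^-1 * a2' by rewrite /lam; field; rewrite a2'0 x0 z0 a'0.
  exact: Sa2'.
have genc := level_ideal_generates iN iM fT Tc EM; have MTc := genc.1.
have genC := level_ideal_generates iN iM fT TC EMC; have MTC := genC.1.
have MTc' : ideal_mul M T c'.
  rewrite -(subrK c c'); apply: (fracID fMT) => //; apply: (int_ideal_mul_sub_frac iL fMT).
  by rewrite mul_div_mul.
have X2 : ideal_mul N T (x * (lam^-1 * c2) - tau * c).
  have Ew : w * (tau * c') = x * (lam^-1 * c2').
    by rewrite /tau /mu; field; rewrite lam0 w0 c'0.
  have -> : x * (lam^-1 * c2) - tau * c =
      (w * (tau * c') - tau * c') + tau * (c' - c) - x * (lam^-1 * (c2' - c2)).
    by rewrite Ew; ring.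
  have hC : ideal_mul N T (lam^-1 * (c2' - c2)) by exact: unscale.
  apply: (fracIB fNT); last exact: (fracIM fNT).
  apply: (fracID fNT); last exact: (fracIM fNT).
  rewrite -mul_div_mul; apply: narrow_congr => //; [exact: (fracIM fMT)| |exact: nw.2].
  rewrite Ew; apply: (fracIM fMT) => //.
  rewrite -(subrK (lam^-1 * c2) (lam^-1 * c2')); apply: (fracID fMT) => //.
  by rewrite -mulrBr; apply: (int_ideal_mul_sub_frac iL fMT); rewrite mul_div_mul.
have [al [be [ga [de [[Oal Ode] [hbe hga] Edet Nal [E1 E2]]]]]] :=
  cusp_datum_matrix iN iM fb dat dat3 EM EMC Ox Otau X1 X2.
exists al, be, ga, de, lam; split; rewrite ?E1 ?E2 ?mulVKf //.
split=> //; first by rewrite Edet; split.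
move=> i0; have -> : al - 1 = (al - x) + (x - 1) by ring.
by apply: fracID => //; move: Qx; rewrite /Q_condition (negbTE i0).
Qed.

(** With S = A^-1 and b = t C^-1 M^-1 A one has M T = t C^-1; so the elements 1 of S and
    t of M T give back the ideals A and C exactly. *)
Lemma cusp_invariant_surj B I J : narrow_class_reps B -> ideals_prime_to M I ->
  ideals_prime_to L J ->
  exists b S a c a' c', [/\ B b, cusp_datum b S a c, M = level_ideal N (ideal_mul b S) c,
    positive_lifts S (ideal_mul b S) a c a' c' & cusp_invariant S (ideal_mul b S) a' c' =
      Q_class i M N I J].
Proof.
move=> [Bfr Bcl] hI hJ.
have [A [iA cA EA]] := integral_rep hF iM hI.
have [C [iC cC EC]] := integral_rep hF iL hJ.
have fA := int_ideal_frac iA; have fC := int_ideal_frac iC.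
pose b0 := ideal_mul (ideal_inv C) (ideal_mul (ideal_inv M) A).
have fb0 : frac_ideal b0 by rewrite /b0; solve_frac.
have hb0 : narrow_class_group F (narrow_ray_class O b0).
  by exists b0 => //; exact: frac_prime_to_one.
have [b [[Bb /ray_classP-/(_ fb0)[t [pt _] Eb]] _]] := Bcl _ hb0.
have t0 := totally_positive_neq0 pt.
have fb : frac_ideal b := Bfr _ Bb.
pose S := ideal_inv A; have fS : frac_ideal S by exact: frac_inv.
have CMint : int_ideal (ideal_mul C M) := int_ideal_mul iC iM.
have S1 : S 1 by move=> _ [y Ay <-]; rewrite mul1r; exact: (int_ideal_sub iA).
have Sinv : ideal_inv S = A by exact: ideal_invK.
have ET : ideal_mul b S = set_scale t (ideal_inv (ideal_mul C M)).
  rewrite Eb ideal_mul_scalel // /b0 /S ideal_invM //; congr set_scale.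
  by rewrite -!ideal_mulA ideal_mulV // [ideal_mul (ideal_inv M) _]ideal_mulr1 //; solve_frac.
set T := ideal_mul b S in ET.
have fT : frac_ideal T by rewrite /T; solve_frac.
have Tinv : ideal_inv T = set_scale t^-1 (ideal_mul C M).
  by rewrite ET ideal_inv_scale // ?ideal_invK //; solve_frac.
have EMT : ideal_mul M T = set_scale t (ideal_inv C).
  rewrite ET ideal_mul_scaler //; try solve_frac.
  by rewrite ideal_invM // ideal_mulCA ideal_mulV // ideal_mulr1 //; solve_frac.
have EMTi : ideal_inv (ideal_mul M T) = set_scale t^-1 C.
  by rewrite EMT ideal_inv_scale // ?ideal_invK //; solve_frac.
have gen1 : generates_mod M S 1.
  split=> //; have [q Aq Mq] := ideal_coprime_elim cA.
  by exists q; rewrite ?Sinv // mul1r.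
have [a ha [Sa [q hq Cq]]] := generates_mod_lift iM CMint (int_ideal_mul_subr iC iM) fS gen1.
have Tt : T t.
  rewrite ET -[t in X in _ X]mulr1; exists 1 => // _ [y hy <-]; rewrite mul1r.
  exact: (int_ideal_sub CMint).
have gent : generates_mod L (ideal_mul M T) t.
  split; first by rewrite EMT; exists 1; rewrite ?mulr1 // => _ [y hy <-]; rewrite mul1r;
    exact: (int_ideal_sub iC).
  have [y Cy Ly] := ideal_coprime_elim cC; exists (t^-1 * y); last by rewrite mulVKf.
  by rewrite EMTi; exists y.
exists b, S, a, t, 1, t; split=> //.
- split=> //; exists q, (t^-1 * - (1 - a * q)); split=> //; last by rewrite mulVKf //; ring.
  rewrite -/T Tinv; exists (- (1 - a * q)) => //; apply: fracIN => //; solve_frac.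
- exact: (generates_mod_level iN iM MN fT gent).
- split=> //; first exact: totally_positive1.
    by rewrite -opprB; apply: fracIN => //; solve_frac.
  by rewrite subrr; exact: ideal_mul0.
rewrite /cusp_invariant /Q_class EA EC; congr coset_by; congr (_, _).
  by rewrite /quot_ideal set_scale1 Sinv.
by rewrite /quot_ideal EMTi set_scaleA mulfV // set_scale1.
Qed.
End FixedLevel.
End CuspInvariant.

(** * Cardinals of disjoint unions *)

Section Cardinality.
Local Open Scope nat_scope.

Lemma card_fset_set_eq (T : choiceType) (A : set T) :
  finite_set A -> (A #= `I_(#|` fset_set A|)%fset)%card.
Proof. by move=> /finite_setP[n An]; rewrite (card_fset_set An). Qed.

Lemma card_disjoint_bigcup (I T : choiceType) (D : set I) (A : I -> set T) (n : I -> nat) :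
  finite_set D -> (forall i, D i -> (A i #= `I_(n i))%card) ->
  (forall i j x, D i -> D j -> A i x -> A j x -> i = j) ->
  (\bigcup_(i in D) A i #= `I_(\big[addn/0%N]_(i \in D) n i))%card.
Proof.
move=> Dfin An Adisj; rewrite fsbig_finite //=.
suff h (s : seq I) : uniq s -> (forall i, i \in s -> D i) ->
    finite_set (\bigcup_(i in [set` s]) A i) /\
    #|` fset_set (\bigcup_(i in [set` s]) A i)|%fset = \sum_(i <- s) n i.
  have [| |fU cU] := h (fset_set D); first exact: fset_uniq.
    by move=> i; rewrite in_fset_set // inE.
  by rewrite -[in X in (X #= _)%card](fset_setK Dfin) -cU; exact: card_fset_set_eq.
elim: s => [_ _|i s IH /= /andP[iNs us] sD].
  by rewrite set_nil bigcup_set0 big_nil fset_set0 cardfs0; split.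
have [|fU cU] := IH us; first by move=> j js; apply: sD; rewrite inE js orbT.
have Di : D i by apply: sD; rewrite mem_head.
have fA : finite_set (A i) by apply/finite_setP; exists (n i); exact: An.
have -> : \bigcup_(j in [set` i :: s]) A j = A i `|` \bigcup_(j in [set` s]) A j.
  apply/seteqP; split=> x.
    move=> [j]; rewrite /= inE => /orP[/eqP ->|js] Ajx; first by left.
    by right; exists j.
  move=> [Aix|[j js Ajx]]; first by exists i => //=; exact: mem_head.
  by exists j => //=; rewrite inE [j \in s]js orbT.
split; first by rewrite finite_setU.
rewrite fset_setU // cardfsU -fset_setI // cU (card_fset_set (An i Di)) big_cons.
suff -> : A i `&` \bigcup_(i0 in [set` s]) A i0 = set0 by rewrite fset_set0 cardfs0 subn0.
apply/seteqP; split=> // x [Aix [j /= js Ajx]].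
have Dj : D j by apply: sD; rewrite inE js orbT.
by move: iNs; rewrite (Adisj _ _ _ Di Dj Aix Ajx) js.
Qed.
End Cardinality.

(** * Counting cusps *)

Section Cusps.
Variable F : fieldExtType rat.
Hypothesis hF : totally_real F.
Implicit Types (I J K L M N S T b : set F) (x y z r a c : F).

Lemma cusp_level N b a c : cusp_M N b a c = level_ideal N (ideal_mul b (cusp_s b a c)) c.
Proof. by []. Qed.

Lemma finite_divisors N : int_ideal N -> finite_set [set M : set F | ideal_dvd M N].
Proof.
move=> iN; have [T [c hc]] := ideal_code (int_ideal_frac iN).
rewrite -[X in finite_set X]image_id.
apply: (finite_image_code (c := c)) => A B [iA [J hJ EJ]] [iB [K hK EK]].
by apply: hc => //; apply: dvd_sub => //; split=> //; [exists J|exists K].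
Qed.

(** A matrix of the group changes c T^-1 by ga a T^-1, contained in N.  The opposite
    inclusion is this one for the inverse matrix. *)
Lemma cusp_level_orbit i N b a c a' c' al be ga de x : int_ideal N -> frac_ideal b ->
  (a, c) != (0, 0) -> gamma_coeffs i N b al be ga de -> x != 0 ->
  a' = x * (al * a + be * c) -> c' = x * (ga * a + de * c) ->
  cusp_M N b a' c' `<=` cusp_M N b a c.
Proof.
move=> iN fb ac0 G x0 Ea Ec; have dat := cusp_datum_cusp_s fb ac0.
have d2 := cusp_datum_scale fb x0 (cusp_datum_gamma iN fb G dat); rewrite -Ea -Ec in d2.
have [fS Sa Tc _] := dat; have [[Oal Ode] hbe hga _ _] := G.
rewrite !cusp_level -(cusp_datum_uniq fb d2).
set S := cusp_s b a c in fS Sa Tc *; have fN := int_ideal_frac iN.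
rewrite ideal_mul_scaler //; set T := ideal_mul b S in Tc *.
have fT : frac_ideal T by rewrite /T; solve_frac.
have iL := level_ideal_int iN fT Tc; have fL := int_ideal_frac iL.
move=> _ [n Nn [_ [t ht <-] <-]]; apply: (fracID fL); first exact: level_ideal_sub.
move: ht; rewrite ideal_inv_scale // => -[u hu <-].
have -> : c' * (x^-1 * u) = ga * a * u + de * (c * u) by rewrite Ec; field.
apply: (fracID fL); last by apply: (fracIM fL) => //; exact: level_ideal_mem.
apply: level_ideal_sub => //; apply: (mul_inv_mem (S := T)) => //.
by rewrite /T ideal_mulA; exact: ideal_mul_mem.
Qed.

Lemma cusp_level_eq i N b a c a' c' : int_ideal N -> frac_ideal b ->
  (a, c) != (0, 0) -> (a', c') != (0, 0) ->
  proj_orbit (Gamma i N b) (proj_point a c) = proj_orbit (Gamma i N b) (proj_point a' c') ->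
  cusp_M N b a c = cusp_M N b a' c'.
Proof.
move=> iN fb ac0 ac0' E; apply/seteqP; split.
  have [al [be [ga [de [x [G x0 Ea Ec]]]]]] := (orbit_eqP i iN fb ac0' ac0).1 (esym E).
  exact: cusp_level_orbit G x0 Ea Ec.
have [al [be [ga [de [x [G x0 Ea Ec]]]]]] := (orbit_eqP i iN fb ac0 ac0').1 E.
exact: cusp_level_orbit G x0 Ea Ec.
Qed.

Section Bijection.
Variables (N : set F) (B : set (set F)) (i : 'I_2).
Hypotheses (iN : int_ideal N) (hB : narrow_class_reps B).

(** The invariant is read off from data chosen for each cusp; other data of the same
    cusp give the same value, and this is what surjectivity rests on. *)
Lemma cusps_at_card M : ideal_dvd M N -> (cusps_at B i M N #= Q_group i M N)%card.
Proof.
move=> MN; have iM : int_ideal M := MN.1; have [iL LM] := dvd_quotient iM MN.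
have fM := int_ideal_frac iM; have fL := int_ideal_frac iL.
have Bfr := hB.1.
pose R (p : set F * set {vspace 'cV[F]_2}) q := exists a c a' c',
  [/\ (a, c) != (0, 0), p.2 = proj_orbit (Gamma i N p.1) (proj_point a c),
      cusp_M N p.1 a c = M,
      positive_lifts M N (cusp_s p.1 a c) (ideal_mul p.1 (cusp_s p.1 a c)) a c a' c' &
      q = cusp_invariant i M N (cusp_s p.1 a c) (ideal_mul p.1 (cusp_s p.1 a c)) a' c'].
have Rtotal p : exists q, cusps_at B i M N p -> R p q.
  case: (pselect (cusps_at B i M N p)) => [[Bp [a [c [ac0 Ep EM]]]]|]; last by exists set0.
  have fS := cusp_s_frac (Bfr _ Bp) ac0.
  have [a' [c' hl]] := positive_lifts_exist hF iM iN a c fS (frac_mul (Bfr _ Bp) fS).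
  by exists (cusp_invariant i M N (cusp_s p.1 a c) (ideal_mul p.1 (cusp_s p.1 a c)) a' c') => _;
     exists a, c, a', c'.
have [f fP] := boolp.choice Rtotal.
apply/card_set_bijP; exists f; split.
- move=> p Ap; have [a [c [a' [c' [ac0 Ep EM hl ->]]]]] := fP p Ap.
  have fb := Bfr _ Ap.1; have dat := cusp_datum_cusp_s fb ac0; have [fS _ Tc _] := dat.
  have [pa pc ha hc] := hl; have fT := frac_mul fb fS.
  have lev : M = level_ideal N (ideal_mul p.1 (cusp_s p.1 a c)) c by rewrite -EM.
  have gena := cusp_datum_generates iN iM dat lev.
  have genc := level_ideal_generates iN iM fT Tc lev.
  have [] := generates_mod_coprime iM fS (totally_positive_neq0 pa) (generates_mod_congr iM
    fS gena ha).
  have fMT := frac_mul fM fT.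
  have hc' : ideal_mul (ideal_div N M) (ideal_mul M (ideal_mul p.1 (cusp_s p.1 a c))) (c' - c).
    by rewrite mul_div_mul.
  have [] := generates_mod_coprime iL fMT (totally_positive_neq0 pc) (generates_mod_congr iL
    fMT genc hc').
  move=> iC cC iA cA; rewrite Q_groupE.
  by exists (quot_ideal (cusp_s p.1 a c) a'); [exact: prime_to_int|
     exists (quot_ideal (ideal_mul M (ideal_mul p.1 (cusp_s p.1 a c))) c') => //;
       exact: prime_to_int].
- move=> p p' /set_mem Ap /set_mem Ap' Ef.
  have [a [c [a' [c' [ac0 Ep EM hl Ev]]]]] := fP p Ap.
  have [u [v [u' [v' [uv0 Ep' EM' hl' Ev']]]]] := fP p' Ap'.
  have fb := Bfr _ Ap.1; have fb' := Bfr _ Ap'.1.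
  have E := etrans (esym Ev) (etrans Ef Ev').
  have [tau [ptau Eb] h] := cusp_invariant_inj hF iM iN MN fb (cusp_datum_cusp_s fb ac0)
    (esym EM) hl
    fb' (cusp_datum_cusp_s fb' uv0) (esym EM') hl' E.
  have Ebb := narrow_reps_inj hB Ap.1 Ap'.1 ptau Eb.
  have [al [be [ga [de [x [G x0 Eu Ec]]]]]] := h Ebb.
  rewrite [p]surjective_pairing [p']surjective_pairing Ep Ep' Ebb; congr (_, _).
  by apply/(orbit_eqP i iN fb ac0 uv0); exists al, be, ga, de, x.
move=> q; rewrite Q_groupE // => -[I hI [J hJ <-]].
have [b [S [a [c [a' [c' [Bb dat EM hl Ev]]]]]]] := cusp_invariant_surj hF i iM iN MN hB hI hJ.
have fb := Bfr _ Bb; have ac0 := cusp_datum_neq0 dat; have ES := cusp_datum_uniq fb dat.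
pose p := (b, proj_orbit (Gamma i N b) (proj_point a c)).
have Ap : cusps_at B i M N p.
  by split=> //; exists a, c; split=> //; rewrite cusp_level -ES.
exists p => //; have [u [v [u' [v' [uv0 Ep EM' hl' ->]]]]] := fP p Ap;
  rewrite /= in Ep EM' hl' *.
have [al [be [ga [de [x [G x0 Eu Ec]]]]]] := (orbit_eqP i iN fb ac0 uv0).1 Ep.
rewrite -Ev; apply/esym; exact: (cusp_invariant_orbit hF iM iN MN fb dat EM hl G x0 Eu Ec
  (cusp_datum_cusp_s fb uv0) hl').
Qed.

Lemma cusps_bigcup : cusps B i N = \bigcup_(M in [set M | ideal_dvd M N]) cusps_at B i M N.
Proof.
apply/seteqP; split=> [p [Bp [l hl El]]|p [M _ [Bp [a [c [ac0 Ep EM]]]]]]; last first.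
  split=> //; exists (proj_point a c) => //.
  by rewrite /proj_line /proj_point /= dim_vline -/(col2 a c) col2_eq0 ac0.
have [a [c [ac0 Elac]]] : exists a c : F, (a, c) != (0, 0) /\ l = proj_point a c.
  pose v := vpick l.
  have v0 : v != 0 by rewrite vpick0; apply: contra_eq_neq hl => ->; rewrite dimv0.
  have Ev : v = col2 (v 0 0) (v 1 0).
    by apply/matrixP => k m; rewrite [m]ord1 !mxE; case: (ord2P k) => ->.
  exists (v 0 0), (v 1 0); split; first by rewrite -col2_eq0 -Ev.
  apply/esym/eqP; rewrite /proj_point -/(col2 _ _) -Ev eqEdim -memvE memv_pick /=.
  by rewrite hl dim_vline v0.
have fb := hB.1 _ Bp; have fS := cusp_s_frac fb ac0.
have [_ _ Tc _] := cusp_datum_cusp_s fb ac0.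
exists (cusp_M N p.1 a c); first exact: (level_ideal_dvd iN (frac_mul fb fS) Tc).
by split=> //; exists a, c; split=> //; rewrite El Elac.
Qed.

Lemma cusps_at_disjoint M M' p : cusps_at B i M N p -> cusps_at B i M' N p -> M = M'.
Proof.
move=> [Bp [a [c [ac0 Ep <-]]]] [_ [a' [c' [ac0' Ep' <-]]]].
by apply: (cusp_level_eq (i := i) iN (hB.1 _ Bp)) => //; rewrite -Ep.
Qed.
End Bijection.
End Cusps.

Theorem corollary3p1p18 (F : fieldExtType rat) (hF : totally_real F)
    (N : set F) (hN : int_ideal N)
    (B : set (set F)) (hB : narrow_class_reps B) (i : 'I_2) :
  (forall M : set F, ideal_dvd M N ->
     finite_set (Q_group i M N) /\ (cusps_at B i M N #= Q_group i M N)%card) /\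
  finite_set [set M : set F | ideal_dvd M N] /\
  (cusps B i N #=
    `I_(\big[addn/0%N]_(M \in [set M : set F | ideal_dvd M N])
          #|` fset_set (Q_group i M N)|)%fset)%card.
Proof.
have finQ M : ideal_dvd M N -> finite_set (Q_group i M N).
  by move=> MN; exact: (finite_Q_group hF i MN.1 MN).
have finD := finite_divisors hN.
split; first by move=> M MN; split; [exact: finQ|exact: cusps_at_card].
split=> //; rewrite cusps_bigcup //.
apply: card_disjoint_bigcup => // [M MN|M M' p _ _]; last exact: cusps_at_disjoint.
apply: card_eq_trans (cusps_at_card hF i hN hB MN) _.
exact: card_fset_set_eq (finQ M MN).
Qed.
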